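(* Let $R$ be a skew-invertible involutive Hecke symmetry, $R^2=I$, and let $U\subset\mathbb K$ be a neighbourhood of $1\in\mathbb K$. Consider a family of skew-invertible Hecke symmetries $R_q$, analytically depending on $q\in U$ and satisfying $R_1=R$. Denote the homogeneous component of order $k$ of $\mathcal L(R_q)$ by $\mathcal L^{(k)}(R_q)$. Then, provided $q$ is generic: 1. $\dim\mathcal L^{(k)}(R_q)=\dim\mathcal L^{(k)}(R)$ for all $k\ge0$. 2. $\mathrm{Gr}\,\mathcal L(R_q,\hbar)\cong\mathcal L(R_q)$, where $\mathrm{Gr}\,\mathcal L(R_q,\hbar)$ is the graded algebra associated to the filtered algebra $\mathcal L(R_q,\hbar)$.
   Context: $V$ is a finite dimensional space over $\mathbb K$ ($\mathbb C$, or sometimes $\mathbb R$), $N=\dim V$, with basis $\{x_i\}$. A Hecke symmetry with parameter $q\in\mathbb K\setminus\{0\}$ is an invertible operator $R$ on $V^{\otimes2}$ with $R_{12}R_{23}R_{12}=R_{23}R_{12}R_{23}$ (where $R_{12}=R\otimes I$, $R_{23}=I\otimes R$) and $(R-qI)(R+q^{-1}I)=0$; in the family, $R_q$ satisfies this with parameter $q$. The value $q$ is generic if $q=1$ or $q$ is not a root of unity. Writing $R(x_i\otimes x_j)=x_k\otimes x_lR^{kl}_{\;ij}$ (summation convention), $R$ is skew-invertible if there is $\Psi$ with $R^{ia}_{\;jb}\Psi^{bl}_{\;ak}=\delta^i_k\delta^l_j=\Psi^{ia}_{\;jb}R^{bl}_{\;ak}$. For a Hecke symmetry $R_q$ with matrix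 $R^{kl}_{\;ij}$, the algebra $\mathcal L(R_q,\hbar)$ is the associative algebra generated by the unit $e_{\mathcal L}$ and $l_i^j$, $1\le i,j\le N$, with relations $$R_{\;ij}^{kl}\,l_k^m\,R_{\;ml}^{pq}\,l_p^r-l_i^a\,R_{\;aj}^{bc}\,l_b^d\,R_{\;dc}^{rq}-\hbar\,(R_{\;ij}^{aq}\,l_a^r-l_i^b\,R_{\;bj}^{rq})=0$$ (here $q$ among upper indices is an index). For $\hbar\ne0$ it is the modified reflection equation algebra (mREA), filtered by degree in the $l_i^j$; for $\hbar=0$ it is denoted $\mathcal L(R_q)$ (the reflection equation algebra), which is graded with $\deg l_i^j=1$.
   Formalization: The neighbourhood U of 1 is taken open and connected; on a disconnected U the dimension claim fails (a GL(2)-type family near 1 and a GL(1|1)-type family on another component give dimensions 10 and 8 for N=2, k=2). *)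

(* Defs.v *)
From HB Require Import structures.
From mathcomp Require Import all_boot all_order all_algebra.
From mathcomp Require Import all_classical all_reals all_analysis.
From mathcomp Require Import complex mxtens.
(* The notations of monalg clash with those of the analysis library. *)
From mathcomp Require Export -(notations) monalg.

Set Implicit Arguments.
Unset Strict Implicit.
Unset Printing Implicit Defensive.

Import Order.TTheory GRing.Theory Num.Theory.
Import numFieldNormedType.Exports.

Local Open Scope classical_set_scope.
Local Open Scope quotient_scope.
Local Open Scope ring_scope.

Variant real_or_complex (R : realType) : numFieldType -> Prop :=
  | ground_real : real_or_complex R R
  | ground_complex : real_or_complex R R[i].

Section Dimension.
Variable K : fieldType.

Definition has_dim (V : lmodType K) (W : set V) (n : nat) : Prop :=
  exists e : 'I_n -> V,
    W = range (fun c : 'I_n -> K => \sum_i c i *: e i) /\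
    (forall c : 'I_n -> K, \sum_i c i *: e i = 0 -> forall i, c i = 0).

Definition same_dim (V V' : lmodType K) (W : set V) (W' : set V') : Prop :=
  exists2 n : nat, has_dim W n & has_dim W' n.

(* [gA k] and [gB k] are the homogeneous components of order [k]. *)
Definition graded_iso (A B : algType K) (gA : nat -> set A)
    (gB : nat -> set B) : Prop :=
  exists f : {lrmorphism A -> B},
    bijective f /\ (forall k : nat, f @` gA k = gB k).

End Dimension.

(* Proper two-sided ideals; [idealr] already gives a proper additive subgroup
   stable under left multiplication. Properness is needed because [algType]
   structures are non trivial. *)
HB.mixin Record isRMulStable (A : nzRingType) (S : A -> bool) := {
  ideal2_mulr : forall u v : A, S u -> S (u * v)
}.

#[short(type="ideal2")]
HB.structure Definition Ideal2 (A : nzRingType) :=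
  {S of Idealr A S & isRMulStable A S}.

Definition algquot (A : nzRingType) (I : ideal2 A) : Type := Quotient.quot I.

Section QuotientRing.
Variables (A : nzRingType) (I : ideal2 A).

HB.instance Definition _ : EqQuotient A (Quotient.equiv I) (algquot I) :=
  EqQuotient.on (algquot I).
HB.instance Definition _ := GRing.Zmodule.on (algquot I).
HB.instance Definition _ :=
  ZmodQuotient.copy (algquot I) (Quotient.quot I).

Lemma eqquotP (x y : A) : (\pi_(algquot I) x == \pi y) = (x - y \in I).
Proof. exact: (esym (Quotient.idealrBE I x y)). Qed.

Lemma subr_repr (x : A) : x - repr (\pi_(algquot I) x) \in I.
Proof. by rewrite -eqquotP reprK. Qed.

Definition quot_one : algquot I := lift_cst (algquot I) 1.

Lemma pi_quot_one : \pi_(algquot I) 1 = quot_one.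
Proof. by unlock quot_one. Qed.
Definition quot_mul := lift_op2 (algquot I) *%R.

Lemma pi_quot_mul x y : \pi_(algquot I) (x * y) =
  quot_mul (\pi_(algquot I) x) (\pi_(algquot I) y).
Proof.
unlock quot_mul; apply/eqP; rewrite eqquotP.
set x' := repr _; set y' := repr _.
have -> : x * y - x' * y' = (x - x') * y + x' * (y - y').
  by rewrite mulrBl mulrBr addrA subrK.
apply: rpredD; first exact/ideal2_mulr/subr_repr.
exact/idealMr/subr_repr.
Qed.

Lemma quot_mulA : associative quot_mul.
Proof.
move=> x y z; rewrite -[x]reprK -[y]reprK -[z]reprK.
by rewrite -!pi_quot_mul mulrA.
Qed.

Lemma quot_mul1 : left_id quot_one quot_mul.
Proof. by move=> x; rewrite -[x]reprK -pi_quot_one -pi_quot_mul mul1r. Qed.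

Lemma quot_mulr1 : right_id quot_one quot_mul.
Proof. by move=> x; rewrite -[x]reprK -pi_quot_one -pi_quot_mul mulr1. Qed.

Lemma quot_mulDl : left_distributive quot_mul +%R.
Proof.
move=> x y z; rewrite -[x]reprK -[y]reprK -[z]reprK.
by rewrite -raddfD -!pi_quot_mul mulrDl raddfD.
Qed.

Lemma quot_mulDr : right_distributive quot_mul +%R.
Proof.
move=> x y z; rewrite -[x]reprK -[y]reprK -[z]reprK.
by rewrite -raddfD -!pi_quot_mul mulrDr raddfD.
Qed.

Lemma quot_nonzero : quot_one != 0.
Proof.
by rewrite -pi_quot_one -(raddf0 \pi_(algquot I)) eqquotP subr0 idealr1.
Qed.

HB.instance Definition _ := GRing.Zmodule_isNzRing.Build (algquot I)
  quot_mulA quot_mul1 quot_mulr1 quot_mulDl quot_mulDr quot_nonzero.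

End QuotientRing.

Section QuotientAlgebra.
Variables (K : fieldType) (A : algType K) (I : ideal2 A).

Definition quot_scale (c : K) := lift_op1 (algquot I) ( *:%R c).

Lemma pi_quot_scale c x :
  \pi_(algquot I) (c *: x) = quot_scale c (\pi_(algquot I) x).
Proof.
unlock quot_scale; apply/eqP; rewrite eqquotP -scalerBr -mulr_algl.
exact/idealMr/subr_repr.
Qed.

Lemma quot_scalerA a b x :
  quot_scale a (quot_scale b x) = quot_scale (a * b) x.
Proof. by rewrite -[x]reprK -!pi_quot_scale scalerA. Qed.

Lemma quot_scale1r : left_id 1 quot_scale.
Proof. by move=> x; rewrite -[x]reprK -!pi_quot_scale scale1r. Qed.

Lemma quot_scalerDr : right_distributive quot_scale +%R.
Proof.
move=> c x y; rewrite -[x]reprK -[y]reprK.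
by rewrite -raddfD -!pi_quot_scale scalerDr raddfD.
Qed.

Lemma quot_scalerDl x : {morph quot_scale^~ x : a b / a + b}.
Proof.
by move=> a b; rewrite -[x]reprK -!pi_quot_scale scalerDl raddfD.
Qed.

HB.instance Definition _ := GRing.Zmodule_isLmodule.Build K (algquot I)
  quot_scalerA quot_scale1r quot_scalerDr quot_scalerDl.

Lemma quot_scalerAl (c : K) (x y : algquot I) : c *: (x * y) = (c *: x) * y.
Proof.
rewrite -[x]reprK -[y]reprK.
set x' := repr x; set y' := repr y.
change (quot_scale c (quot_mul (\pi_(algquot I) x') (\pi_(algquot I) y')) =
  quot_mul (quot_scale c (\pi_(algquot I) x')) (\pi_(algquot I) y')).
by rewrite -pi_quot_mul -!pi_quot_scale -pi_quot_mul scalerAl.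
Qed.

HB.instance Definition _ :=
  GRing.Lmodule_isLalgebra.Build K (algquot I) quot_scalerAl.

Lemma quot_scalerAr (c : K) (x y : algquot I) : c *: (x * y) = x * (c *: y).
Proof.
rewrite -[x]reprK -[y]reprK.
set x' := repr x; set y' := repr y.
change (quot_scale c (quot_mul (\pi_(algquot I) x') (\pi_(algquot I) y')) =
  quot_mul (\pi_(algquot I) x') (quot_scale c (\pi_(algquot I) y'))).
by rewrite -pi_quot_mul -!pi_quot_scale -pi_quot_mul scalerAr.
Qed.

HB.instance Definition _ :=
  GRing.Lalgebra_isAlgebra.Build K (algquot I) quot_scalerAr.

End QuotientAlgebra.

Section AssociatedGraded.
Variables (K : fieldType) (A : algType K).

Record filtration := Filtration {
  fil :> nat -> set A;
  fil0 : forall n, fil n 0;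
  filP : forall n (c : K) x y, fil n x -> fil n y -> fil n (c *: x + y);
  filS : forall n, fil n `<=` fil n.+1;
  fil1 : fil 0%N 1;
  filM : forall m n x y, fil m x -> fil n y -> fil (m + n)%N (x * y);
  filT : forall x, exists n, fil n x }.

Variable F : filtration.

(* The Rees algebra: polynomials over A with k-th coefficient in F_k. The
   associated graded algebra (+)_k F_k / F_(k-1), with F_(-1) = 0, is its
   quotient by the polynomials with k-th coefficient in F_(k-1). *)
Definition rees_pred : {pred {poly A}} :=
  fun p => `[< forall k, F k p`_k >].

Record rees : Type := Rees { rees_val : {poly A}; _ : rees_pred rees_val }.

HB.instance Definition _ := [isSub for rees_val].
HB.instance Definition _ := [Choice of rees by <:].

Lemma filD n x y : F n x -> F n y -> F n (x + y).
Proof. by move=> Fx Fy; rewrite -[x]scale1r; apply: filP. Qed.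

Lemma filZ n c x : F n x -> F n (c *: x).
Proof. by move=> Fx; rewrite -[_ *: _]addr0; apply/filP/fil0. Qed.

Lemma fil_sum n (I : Type) (r : seq I) (P : pred I) (G : I -> A) :
  (forall i, P i -> F n (G i)) -> F n (\sum_(i <- r | P i) G i).
Proof.
by move=> FG; elim/big_rec: _ => [|i x /FG Fi Fx]; [exact: fil0|exact: filD].
Qed.

Lemma fil_le m n x : (m <= n)%N -> F m x -> F n x.
Proof.
by move=> /subnK <-; elim: (n - m)%N => // k IH /IH; exact: filS.
Qed.

Lemma rees_subring : subring_closed rees_pred.
Proof.
split.
- apply/asboolP => k; rewrite coef1.
  by case: k => [|k]; [exact: fil1|exact: fil0].
- move=> p q /asboolP Fp /asboolP Fq; apply/asboolP => k.
  by rewrite coefB -scaleN1r addrC; apply: filP.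
- move=> p q /asboolP Fp /asboolP Fq; apply/asboolP => k.
  rewrite coefM; apply: fil_sum => i _.
  by rewrite -[k in F k](subnKC (leq_ord i)); apply: filM.
Qed.

HB.instance Definition _ :=
  GRing.SubChoice_isSubNzRing.Build {poly A} rees_pred rees rees_subring.

Lemma rees_scale_subproof (c : K) (p : rees) : rees_pred (c%:A%:P * val p).
Proof.
apply/asboolP => k; rewrite coefCM mulr_algl; apply: filZ.
by case: p => p /= /asboolP.
Qed.

Definition rees_scale (c : K) (p : rees) : rees := Rees (rees_scale_subproof c p).

Lemma rees_scalerA a b p : rees_scale a (rees_scale b p) = rees_scale (a * b) p.
Proof.
by apply: val_inj; rewrite /= mulrA -polyCM -scalerAl mul1r scalerA.
Qed.

Lemma rees_scale1r : left_id 1 rees_scale.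
Proof. by move=> p; apply: val_inj; rewrite /= scale1r mul1r. Qed.

Lemma rees_scalerDr : right_distributive rees_scale +%R.
Proof. by move=> c p q; apply: val_inj; rewrite /= mulrDr. Qed.

Lemma rees_scalerDl p : {morph rees_scale^~ p : a b / a + b}.
Proof. by move=> a b; apply: val_inj; rewrite /= scalerDl polyCD mulrDl. Qed.

HB.instance Definition _ := GRing.Zmodule_isLmodule.Build K rees
  rees_scalerA rees_scale1r rees_scalerDr rees_scalerDl.

Lemma rees_scalerAl (c : K) (p q : rees) : c *: (p * q) = (c *: p) * q.
Proof. by apply: val_inj; rewrite /= mulrA. Qed.

HB.instance Definition _ := GRing.Lmodule_isLalgebra.Build K rees rees_scalerAl.

Lemma rees_scalerAr (c : K) (p q : rees) : c *: (p * q) = p * (c *: q).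
Proof.
apply: val_inj; rewrite /= !mulrA; congr (_ * _).
by apply/polyP => k; rewrite coefCM coefMC mulr_algl mulr_algr.
Qed.

HB.instance Definition _ := GRing.Lalgebra_isAlgebra.Build K rees rees_scalerAr.

Definition fil_pred (k : nat) : set A := if k is k'.+1 then F k' else [set 0].

Definition gr_ideal (p : rees) : bool :=
  `[< forall k, fil_pred k (val p)`_k >].

Lemma fil_pred0 k : fil_pred k 0.
Proof. by case: k => [|k] //=; exact: fil0. Qed.

Lemma fil_predB k x y : fil_pred k x -> fil_pred k y -> fil_pred k (x - y).
Proof.
case: k => [|k] /=; first by move=> -> ->; rewrite subr0.
by move=> Fx Fy; rewrite -scaleN1r addrC; apply: filP.
Qed.

Lemma fil_predD k x y : fil_pred k x -> fil_pred k y -> fil_pred k (x + y).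
Proof.
move=> Fx Fy; rewrite -[y]opprK; apply: fil_predB => //.
by rewrite -sub0r; apply: fil_predB => //; exact: fil_pred0.
Qed.

Lemma fil_pred_sum n (I : Type) (r : seq I) (P : pred I) (G : I -> A) :
  (forall i, P i -> fil_pred n (G i)) -> fil_pred n (\sum_(i <- r | P i) G i).
Proof.
move=> FG; elim/big_rec: _ => [|i x /FG Fi Fx]; first exact: fil_pred0.
exact: fil_predD.
Qed.

Lemma fil_predMl m n x y : F m x -> fil_pred n y -> fil_pred (m + n) (x * y).
Proof.
case: n => [|n] /= Fx; last by rewrite addnS /=; apply: filM.
by move=> ->; rewrite mulr0; exact: fil_pred0.
Qed.

Lemma fil_predMr m n x y : fil_pred m x -> F n y -> fil_pred (m + n) (x * y).
Proof.
case: m => [|m] /= Fx Fy; last by apply: filM.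
by rewrite Fx mul0r; exact: fil_pred0.
Qed.

Lemma reesP (p : rees) k : F k (val p)`_k.
Proof. by case: p => p /= /asboolP. Qed.

Lemma gr_ideal_zmod : zmod_closed gr_ideal.
Proof.
split; first by apply/asboolP => k; rewrite /= coef0; exact: fil_pred0.
move=> p q /asboolP Fp /asboolP Fq; apply/asboolP => k.
by rewrite raddfB /= coefB; apply: fil_predB.
Qed.

Lemma gr_ideal_proper :
  1 \notin gr_ideal /\ forall a, {in gr_ideal, forall u, a * u \in gr_ideal}.
Proof.
split.
  apply/negP => /asboolP /(_ 0%N) /=.
  by rewrite coef1 => /eqP; rewrite oner_eq0.
move=> a u /asboolP Fu; apply/asboolP => k.
rewrite rmorphM /= coefM; apply: fil_pred_sum => i _.
rewrite -[k in fil_pred k](subnKC (leq_ord i)).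
by apply: fil_predMl => //; exact: reesP.
Qed.

Lemma gr_ideal_mulr u v : gr_ideal u -> gr_ideal (u * v).
Proof.
move=> /asboolP Fu; apply/asboolP => k.
rewrite rmorphM /= coefM; apply: fil_pred_sum => i _.
rewrite -[k in fil_pred k](subnKC (leq_ord i)).
by apply: fil_predMr => //; exact: reesP.
Qed.

HB.instance Definition _ := GRing.isZmodClosed.Build rees gr_ideal gr_ideal_zmod.
HB.instance Definition _ := isProperIdeal.Build rees gr_ideal gr_ideal_proper.
HB.instance Definition _ := isRMulStable.Build rees gr_ideal gr_ideal_mulr.

Definition gr := algquot gr_ideal.
HB.instance Definition _ := GRing.Algebra.on gr.

(* F_k / F_(k-1), as a subspace of [gr]. *)
Definition gr_comp (k : nat) : set gr :=
  \pi_gr @` [set p : rees | forall i, i != k -> (val p)`_i = 0].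

End AssociatedGraded.

Arguments gr_comp {K A} F k.

Section GeneratedIdeal.
Variables (A : nzRingType) (J : Type) (rel : J -> A).

Definition gen_ideal (x : A) : bool :=
  `[< exists s : seq (A * J * A),
        x = \sum_(t <- s) t.1.1 * rel t.1.2 * t.2 >].

Lemma gen_ideal_mull u v : gen_ideal v -> gen_ideal (u * v).
Proof.
move=> /asboolP [s ->]; apply/asboolP.
exists [seq (u * t.1.1, t.1.2, t.2) | t <- s].
by rewrite big_map mulr_sumr; apply: eq_bigr => t _; rewrite !mulrA.
Qed.

Lemma gen_ideal_mulr u v : gen_ideal u -> gen_ideal (u * v).
Proof.
move=> /asboolP [s ->]; apply/asboolP.
exists [seq (t.1.1, t.1.2, t.2 * v) | t <- s].
by rewrite big_map mulr_suml; apply: eq_bigr => t _; rewrite !mulrA.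
Qed.

Lemma gen_ideal_zmod : zmod_closed gen_ideal.
Proof.
split; first by apply/asboolP; exists [::]; rewrite big_nil.
move=> x y xI yI; rewrite -mulN1r; have /asboolP[s ->] : gen_ideal x by [].
have /asboolP[t ->] : gen_ideal (-1 * y) by apply: gen_ideal_mull.
by apply/asboolP; exists (s ++ t); rewrite big_cat.
Qed.

End GeneratedIdeal.

Section ReflectionEquationAlgebra.
Variables (K : fieldType) (N : nat).

(* The free associative algebra on the letters l_i^j, with basis the words
   [fmonom ('I_N * 'I_N)]; the letter (i, j) stands for l_i^j. *)
Definition freealg : Type := malg (fmonom ('I_N * 'I_N)%type) K.

HB.instance Definition _ := GRing.Lalgebra.on freealg.

Lemma freealg_scalerAr (c : K) (x y : freealg) : c *: (x * y) = x * (c *: y).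
Proof.
have cC (z : freealg) : z * malgC c = malgC c * z.
  have -> : z * malgC c = fgmul z (malgC c) by [].
  have -> : malgC c * z = fgmul (malgC c) z by [].
  rewrite fgmulgU fgmulUg; apply: eq_bigr => w _.
  by rewrite mulm1 mul1m mulrC.
by rewrite -!mul_malgC [RHS]mulrA cC mulrA.
Qed.

HB.instance Definition _ :=
  GRing.Lalgebra_isAlgebra.Build K freealg freealg_scalerAr.

Definition word := fmonom ('I_N * 'I_N)%type.
Definition letter (i j : 'I_N) : freealg := mkmalgU (fmu (i, j)) 1.

(* V = K^N with its canonical basis x_0, ..., x_(N-1); x_i (x) x_j is the
   basis vector of index [mxtens_index (i, j)] of K^(N * N), and operators act
   on column vectors: [coef R k l i j] is R^{kl}_{ij} in
   R (x_i (x) x_j) = sum_(k, l) R^{kl}_{ij} x_k (x) x_l. *)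
Definition coef (R : 'M[K]_(N * N)) (k l i j : 'I_N) : K :=
  R (mxtens_index (k, l)) (mxtens_index (i, j)).

Definition op12 (R : 'M[K]_(N * N)) : 'M[K]_(N * N * N) := R *t (1%:M : 'M[K]_N).
Definition op23 (R : 'M[K]_(N * N)) : 'M[K]_(N * N * N) :=
  castmx (mulnA N N N, mulnA N N N) ((1%:M : 'M[K]_N) *t R).

Definition hecke_symmetry (q : K) (R : 'M[K]_(N * N)) : Prop :=
  [/\ q != 0, R \in unitmx,
      op12 R *m op23 R *m op12 R = op23 R *m op12 R *m op23 R
    & (R - q%:M) *m (R + q^-1%:M) = 0].

Definition skew_invertible (R : 'M[K]_(N * N)) : Prop :=
  exists Psi : 'M[K]_(N * N), forall i j k l : 'I_N,
    \sum_a \sum_b coef R i a j b * coef Psi b l a k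
      = ((i == k) && (l == j))%:R /\
    \sum_a \sum_b coef Psi i a j b * coef R b l a k
      = ((i == k) && (l == j))%:R.

Variables (R : 'M[K]_(N * N)) (hbar : K).

(* The four free indices of the defining relation are i, j (lower) and
   r, s (upper); s is the one that is written q in
   R_{ij}^{kl} l_k^m R_{ml}^{pq} l_p^r - l_i^a R_{aj}^{bc} l_b^d R_{dc}^{rq}
   - hbar (R_{ij}^{aq} l_a^r - l_i^b R_{bj}^{rq}). *)
Definition mrea_rel (t : 'I_N * 'I_N * 'I_N * 'I_N) : freealg :=
  let: (i, j, r, s) := t in
  \sum_k \sum_l \sum_m \sum_p
    (coef R k l i j * coef R p s m l) *: (letter k m * letter p r)
  - \sum_a \sum_b \sum_c \sum_d
    (coef R b c a j * coef R r s d c) *: (letter i a * letter b d)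
  - hbar *: (\sum_a coef R a s i j *: letter a r
             - \sum_b coef R r s b j *: letter i b).

Definition mrea_ideal : freealg -> bool := gen_ideal mrea_rel.

HB.instance Definition _ :=
  GRing.isZmodClosed.Build freealg mrea_ideal (gen_ideal_zmod mrea_rel).

Lemma mcoeff1_sum0 (F : 'I_N -> freealg) :
  (forall i, mcoeff mone (F i) = 0) -> mcoeff mone (\sum_i F i) = 0.
Proof.
move=> F0; rewrite (@raddf_sum freealg K (mcoeff mone)).
apply: big1 => i _; exact: F0.
Qed.

Lemma mcoeff1_letter i j : mcoeff mone (letter i j) = 0.
Proof. by rewrite mcoeffU -fdeg_eq0 fdegU mulr0n. Qed.

Lemma mcoeff1B0 (x y : freealg) :
  mcoeff mone x = 0 -> mcoeff mone y = 0 -> mcoeff mone (x - y) = 0.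
Proof. by move=> x0 y0; rewrite mcoeffB x0 y0 subr0. Qed.

Lemma mcoeff1Z0 (c : K) (x : freealg) :
  mcoeff mone x = 0 -> mcoeff mone (c *: x) = 0.
Proof. by move=> x0; rewrite mcoeffZ x0 mulr0. Qed.

Lemma mcoeff1M (x y : freealg) :
  mcoeff mone (x * y) = mcoeff mone x * mcoeff mone y.
Proof. exact: (@rmorphM freealg K (mcoeff mone)). Qed.

Lemma mcoeff1_letter2 i j k l : mcoeff mone (letter i j * letter k l) = 0.
Proof. by rewrite mcoeff1M mcoeff1_letter mul0r. Qed.

Lemma mcoeff1_rel t : mcoeff mone (mrea_rel t) = 0.
Proof.
case: t => [[[i j] r] s]; rewrite /mrea_rel.
apply: mcoeff1B0; first apply: mcoeff1B0.
- by do 4![apply: mcoeff1_sum0 => ?]; apply/mcoeff1Z0/mcoeff1_letter2.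
- by do 4![apply: mcoeff1_sum0 => ?]; apply/mcoeff1Z0/mcoeff1_letter2.
apply/mcoeff1Z0/mcoeff1B0; apply: mcoeff1_sum0 => ?.
- exact/mcoeff1Z0/mcoeff1_letter.
- exact/mcoeff1Z0/mcoeff1_letter.
Qed.

Lemma mrea_ideal_aug (x : freealg) : mrea_ideal x -> mcoeff mone x = 0.
Proof.
move=> /asboolP [u ->]; rewrite (@raddf_sum freealg K (mcoeff mone)).
rewrite big1 // => -[[a t] b] _.
transitivity (mcoeff mone (a * mrea_rel t * b)); first by [].
by rewrite !mcoeff1M mcoeff1_rel mulr0 mul0r.
Qed.

Lemma mrea_ideal_proper :
  1 \notin mrea_ideal /\
  forall a, {in mrea_ideal, forall u, a * u \in mrea_ideal}.
Proof.
split; last by move=> a u; apply: gen_ideal_mull.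
by apply/negP => /mrea_ideal_aug /eqP; rewrite mcoeff1 eqxx oner_eq0.
Qed.

HB.instance Definition _ :=
  isProperIdeal.Build freealg mrea_ideal mrea_ideal_proper.
HB.instance Definition _ :=
  isRMulStable.Build freealg mrea_ideal (gen_ideal_mulr (rel := mrea_rel)).

Definition mrea := algquot mrea_ideal.
HB.instance Definition _ := GRing.Algebra.on mrea.

Definition of_degree_le (n : nat) : set freealg :=
  [set x | forall w : word, mcoeff w x != 0 -> (fdeg w <= n)%N].
Definition of_degree (n : nat) : set freealg :=
  [set x | forall w : word, mcoeff w x != 0 -> fdeg w = n].

Lemma of_degree_leM m n x y :
  of_degree_le m x -> of_degree_le n y -> of_degree_le (m + n) (x * y).
Proof.
move=> xm yn w; rewrite mcoeff_neq0 => /msuppM_le [u [v [ux vy ->]]].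
by rewrite fdegM leq_add // ?xm ?yn // mcoeff_neq0.
Qed.

Definition mrea_fil_set (n : nat) : set mrea := \pi_mrea @` of_degree_le n.

Lemma mrea_fil0 n : mrea_fil_set n 0.
Proof.
exists 0; last exact: (raddf0 \pi_mrea).
by move=> w; rewrite mcoeff0 eqxx.
Qed.

Lemma mrea_filP n (c : K) x y :
  mrea_fil_set n x -> mrea_fil_set n y -> mrea_fil_set n (c *: x + y).
Proof.
move=> [u un <-] [v vn <-]; exists (c *: u + v); last first.
  by rewrite (raddfD \pi_mrea) /= (@pi_quot_scale K freealg).
move=> w; rewrite mcoeffD mcoeffZ => w0.
have [uw|/un//] := eqVneq (mcoeff w u) 0.
by apply: vn; move: w0; rewrite uw mulr0 add0r.
Qed.

Lemma mrea_filS n : mrea_fil_set n `<=` mrea_fil_set n.+1.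
Proof. by move=> _ [u un <-]; exists u => // w /un /leqW. Qed.

Lemma mrea_fil1 : mrea_fil_set 0 1.
Proof.
exists 1; last exact: pi_quot_one.
move=> w; rewrite mcoeff1; have [->|_] := eqVneq w mone; first by rewrite fdeg1.
by rewrite mulr0n eqxx.
Qed.

Lemma mrea_filM m n x y :
  mrea_fil_set m x -> mrea_fil_set n y -> mrea_fil_set (m + n) (x * y).
Proof.
move=> [u um <-] [v vn <-]; exists (u * v); first exact: of_degree_leM.
exact: pi_quot_mul.
Qed.

Lemma mrea_filT x : exists n, mrea_fil_set n x.
Proof.
rewrite -[x]reprK; set u : freealg := repr x.
exists (\max_(w <- finmap.enum_fset (msupp u)) fdeg w)%N; exists u => // w.
by rewrite mcoeff_neq0 => wu; apply: leq_bigmax_seq.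
Qed.

Definition mrea_fil : filtration mrea :=
  Filtration mrea_fil0 mrea_filP mrea_filS mrea_fil1 mrea_filM mrea_filT.

End ReflectionEquationAlgebra.

Definition rea (K : fieldType) (N : nat) (R : 'M[K]_(N * N)) := mrea R 0.

Definition rea_comp (K : fieldType) (N : nat) (R : 'M[K]_(N * N)) (k : nat) :
    set (rea R) :=
  \pi_(rea R) @` of_degree k.

Arguments rea_comp {K N} R k.

Section AnalyticFamily.
Variable K : numFieldType.

Definition generic (q : K) : Prop :=
  q = 1 \/ forall n : nat, (0 < n)%N -> ~~ n.-unity_root q.

Definition analytic_at (f : K -> K) (a : K) : Prop :=
  exists c : nat -> K,
    \forall z \near a, [series c n * (z - a) ^+ n]_n @ \oo --> f z.

Definition analytic_on (U : set K) (m n : nat) (M : K -> 'M[K]_(m, n)) : Prop :=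
  forall i j a, U a -> analytic_at (fun q => M q i j) a.

End AnalyticFamily.

(* Main.v *)
(* Proof idea. For generic q the Hecke algebra H_k(q) is split semisimple: the
   common eigenvectors of its Jucys-Murphy elements are labelled by standard
   tableaux, encoded by their content vectors, and Lagrange interpolation in the
   Jucys-Murphy elements yields matrix units, continuous in q. Consequently the
   space of intertwiners between two representations of H_k(q) depending
   continuously on q is the image of a continuous projection, so its dimension is
   lower semicontinuous in q.
   A linear form on words of length k in the letters l_i^j that kills the degree
   k relations of L(R_q) is turned, by inserting R-matrices between the letters,
   into an intertwiner V^(x)k -> V^(x)k of H_k(q) for two actions built from R;
   skew-invertibility makes this a bijection. Hence
   dim L^(k)(R_q) = dim (intertwiners), while the rank of the degree k relations
   is N^(2k) minus that dimension. Both ranks are lower semicontinuous, so they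
   are locally constant at generic q. Non-generic q are isolated, and U is
   connected: this gives part 1.
   For part 2, let J_m(hbar) be the span of the products (word)(relation)(word) of
   degree at most m. The shift l |-> l - c with c = - hbar / (q - q^-1) maps the
   relations of L(R_q, hbar) to those of L(R_q), so J_m(hbar) and J_m(0) have the
   same dimension if q <> q^-1; semicontinuity in q and part 1 give
   dim J_m(hbar) <= dim J_m(0) at q = 1. Degenerating hbar to 0 by rescaling the
   letters bounds the rank of J_m(hbar) modulo degree k, and the dimension of
   J_k(hbar), from below by those for hbar = 0. Therefore the elements of degree
   at most k in J_m(hbar) are exactly J_k(hbar), whose leading parts are relations
   of L(R_q): this is the PBW property, and Gr L(R_q, hbar) = L(R_q). *)
Require Import Defs.
From HB Require Import structures.
From mathcomp Require Import all_boot all_order all_algebra.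
From mathcomp Require Import all_classical all_reals all_analysis.
From mathcomp Require Import complex mxtens ssrAC zify ring lra.

Set Implicit Arguments.
Unset Strict Implicit.
Unset Printing Implicit Defensive.

Import Order.TTheory GRing.Theory Num.Theory numFieldNormedType.Exports.
Local Open Scope classical_set_scope.
Local Open Scope quotient_scope.
Local Open Scope ring_scope.

(** * Content vectors of standard tableaux *)

(** Genericity need not be an open condition on q, since roots of unity accumulate on the unit
    circle. In a fixed degree k only finitely many of them matter: the eigenvalues of the contents c
    with |c| <= k must be distinct and 1 + q^2 nonzero. This is [good k]; it is open and holds at 1,
    and the semicontinuity arguments rest on it. Continuity of the projection asks for formulas in
    which only R_q and q move: the interpolation nodes are all contents of a fixed range, and the
    paths between tableaux are chosen once for all q. No irreducible representation is constructed.
    It is enough that the joint spectrum of the Jucys-Murphy elements consists of content vectors of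
    tableaux, and that p H p consists of scalars for each resulting projection p. The two ground
    fields need different endings. Over the complex numbers a punctured disc is connected, so an
    isolated bad point can be bypassed. Over the reals it is not, but there U is an interval that
    contains 1 and avoids 0, hence consists of positive numbers, all of them generic. *)

Section ContentVectors.
Implicit Types (a b : seq int) (c d : int).

(* If [a] is the content vector of a standard tableau of shape lambda, then
   [maya a c] is the c-th step (0 or 1) of the boundary path of lambda; a box of
   content c can be added iff steps c - 1 and c are 0 and 1. *)
Definition maya a c : int :=
  (0 <= c)%R%:Z + (count_mem (c + 1) a)%:Z - (count_mem c a)%:Z.

Definition addable a c := (maya a (c - 1) == 0) && (maya a c == 1).
Definition removable a c := (maya a (c - 1) == 1) && (maya a c == 0).

Definition is_tab a :=
  all (fun i => addable (take i a) a`_i) (iota 0 (size a)).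

Lemma is_tab_rcons a c : is_tab (rcons a c) = is_tab a && addable a c.
Proof.
rewrite /is_tab size_rcons -[(size a).+1]addn1 iotaD all_cat /= andbT add0n.
rewrite -cats1 take_size_cat // nth_cat ltnn subnn /=; congr andb.
apply: eq_in_all => i; rewrite mem_iota add0n => /andP[_ lt_i].
by rewrite takel_cat ?nth_cat ?lt_i // ltnW.
Qed.

Lemma maya_perm a b c : perm_eq a b -> maya a c = maya b c.
Proof. by move=> /permP ab; rewrite /maya !ab. Qed.

(** Adding a box of content d to a shape turns the steps d - 1 and d from 0, 1 into 1, 0. This is
    why the values stay in {0, 1} along a tableau ([maya01]). *)
Lemma maya_rcons a d c : maya (rcons a d) c =
  maya a c + (d == c + 1)%:Z - (d == c)%:Z.
Proof. rewrite /maya -cats1 !count_cat /= !addn0 !PoszD; lia. Qed.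

Lemma addable_perm a b c : perm_eq a b -> addable a c = addable b c.
Proof. by move=> ab; rewrite /addable !(maya_perm _ ab). Qed.

Lemma removable_perm a b c : perm_eq a b -> removable a c = removable b c.
Proof. by move=> ab; rewrite /removable !(maya_perm _ ab). Qed.

Lemma maya01 a c : is_tab a -> (maya a c == 0) || (maya a c == 1).
Proof.
elim/last_ind: a c => [|a d IH] c; first by rewrite /maya /=; lia.
rewrite is_tab_rcons => /andP[/(IH c) ha /andP[h0 h1]].
rewrite maya_rcons; case: (eqVneq d c) => [dc|ndc]; first by subst; lia.
have [dc|] := eqVneq d (c + 1); last lia.
by move: h0; rewrite dc addrK; lia.
Qed.

Lemma addable_rcons a d c : is_tab a -> addable a d ->
  addable (rcons a d) c -> c != d /\
  (addable a c \/ (c = d + 1 \/ c = d - 1)).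
Proof.
move=> ta /andP[h0 h1] /andP[]; rewrite !maya_rcons => g0 g1.
have cd : c != d.
  by apply/eqP => cd; subst; move: g1; lia.
split=> //; have [->|n1] := eqVneq c (d + 1); first by auto.
have [->|n2] := eqVneq c (d - 1); first by auto.
left; rewrite /addable.
move: g0 g1; lia.
Qed.

Lemma addable_rcons_far a d c : addable a c ->
  c != d -> c != d + 1 -> c != d - 1 -> addable (rcons a d) c.
Proof. by rewrite /addable !maya_rcons; lia. Qed.

(** Neighbouring contents share a step of the boundary path, and it would have to be 1 for one of
    them and 0 for the other. *)
Lemma addable_neighbour a d c : addable a d -> addable a c ->
  c != d + 1 /\ c != d - 1.
Proof.
move=> /andP[h0 h1] /andP[g0 g1]; split; apply/eqP => cd; subst.
  by move: g0; rewrite addrK; lia.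
lia.
Qed.

(** Adding the box d gives the step shared by c and d the value that addability of c asks for. So
    the other step at c is the wrong one, and before the addition the two steps at c were 1, 0. *)
Lemma removable_neighbour a d c : is_tab a -> addable a d ->
  c = d + 1 \/ c = d - 1 -> ~~ addable (rcons a d) c -> removable a c.
Proof.
move=> ta /andP[h0 h1] cd; rewrite /addable /removable !maya_rcons.
have := maya01 c ta; have := maya01 (c - 1) ta.
by case: cd => cd; subst; rewrite ?addrK ?subrK; lia.
Qed.

Lemma removable_rcons a c : is_tab (rcons a c) -> removable (rcons a c) c.
Proof.
rewrite is_tab_rcons => /andP[_ /andP[h0 h1]].
by rewrite /removable !maya_rcons; lia.
Qed.

Lemma not_addable_last a d : is_tab (rcons a d) -> ~~ addable (rcons a d) d.
Proof. by move/removable_rcons; rewrite /removable /addable; lia. Qed.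

Lemma removable_prev a e c : is_tab (rcons a e) -> removable (rcons a e) c ->
  e != c -> [/\ removable a c, e != c + 1 & e != c - 1].
Proof.
rewrite is_tab_rcons => /andP[ta /andP[h0 h1]] /andP[].
rewrite !maya_rcons => g0 g1 ec.
have n1 : e != c + 1.
  apply/eqP => E; subst; move: h0; rewrite addrK => h0; move: g1; lia.
have n2 : e != c - 1 by apply/eqP => E; subst; lia.
by split=> //; rewrite /removable; lia.
Qed.

Lemma not_removable_nil c : ~~ removable [::] c.
Proof. by rewrite /removable /maya /=; lia. Qed.

Lemma tab_bound a c : is_tab (rcons a c) -> (`|c| <= size a)%N.
Proof.
elim/last_ind: a c => [|a d IH] c; rewrite is_tab_rcons => /andP[].
  by rewrite /addable /maya /= => _; lia.
move=> ta; move: (ta); rewrite is_tab_rcons => /andP[ta' ad] ac.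
rewrite size_rcons; have /IH bd := ta.
have [_ [/[dup] ac' _|cd]] := addable_rcons ta' ad ac; last lia.
by have := IH c; rewrite is_tab_rcons ta' ac' => /(_ isT); lia.
Qed.

Lemma tab_bound_mem a c : is_tab a -> c \in a -> (`|c| < size a)%N.
Proof.
elim/last_ind: a => // a d IH tad; have := tad; rewrite is_tab_rcons => /andP[ta _].
rewrite mem_rcons inE size_rcons => /orP[/eqP->|/(IH ta)]; last by lia.
by have := tab_bound tad; lia.
Qed.

Definition crange n : seq int := [seq i%:Z - n%:Z | i <- iota 0 (2 * n).+1].

Lemma mem_crange n c : (c \in crange n) = (`|c| <= n)%N.
Proof.
apply/mapP/idP => [ [ i ]|cn]; first by rewrite mem_iota => ? ->; lia.
by exists (absz (c + n%:Z)); rewrite ?mem_iota; lia.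
Qed.

Lemma crange_uniq n : uniq (crange n).
Proof. by rewrite map_inj_uniq ?iota_uniq // => i j; lia. Qed.

Definition addset n a := [seq c <- crange n | addable a c].

(** The bound [n] only makes the list of candidate contents finite; by [tab_bound] it excludes no
    tableau as long as m <= n + 1. *)
Fixpoint tabs n m : seq (seq int) :=
  if m is m'.+1 then [seq rcons a c | a <- tabs n m', c <- addset n a]
  else [:: [::]].

Lemma mem_tabs n m a : (m <= n.+1)%N ->
  (a \in tabs n m) = (size a == m) && is_tab a.
Proof.
elim: m a => [|m IH] a mn; first by rewrite inE; case: a.
apply/allpairsPdep/andP => [[a' [c [a'm]]]|[]].
  move: a'm; rewrite (IH a' (ltnW mn)) => /andP[/eqP sa ta].
  rewrite mem_filter => /andP[ac _] ->.
  by rewrite size_rcons sa is_tab_rcons ta ac.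
case/lastP: a => // a c; rewrite size_rcons eqSS => sa tac.
exists a, c; have := tac; rewrite is_tab_rcons => /andP[ta ac].
rewrite (IH a (ltnW mn)) sa ta mem_filter ac mem_crange; split=> //.
have := tab_bound tac; rewrite (eqP sa) => cm.
exact: leq_trans cm (mn : m <= n)%N.
Qed.

Lemma tabs_uniq n m : uniq (tabs n m).
Proof.
elim: m => //= m IH; apply: allpairs_uniq_dep => //.
  by move=> a _; rewrite filter_uniq // crange_uniq.
by move=> [a c] [b d] _ _ /= /eqP; rewrite eqseq_rcons => /andP[/eqP-> /eqP->].
Qed.

(** * Exchanging boxes in tableaux of the same shape *)

Definition swap i a : seq int :=
  set_nth 0 (set_nth 0 a i a`_i.+1) i.+1 a`_i.

(** With a bound on the contents, this is the condition under which the exchange operator [sigma] is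
    invertible ([gam_neq0]). Whether the sequences met along a path are tableaux is irrelevant for
    that. *)
Definition far_step a i :=
  [&& (i.+1 < size a)%N, a`_i != a`_i.+1, a`_i.+1 != a`_i + 1
    & a`_i.+1 != a`_i - 1].

Lemma size_swap i a : (i.+1 < size a)%N -> size (swap i a) = size a.
Proof. by move=> h; rewrite !size_set_nth; lia. Qed.

Lemma nth_swap i a j : (swap i a)`_j =
  if j == i.+1 then a`_i else if j == i then a`_i.+1 else a`_j.
Proof. by rewrite !nth_set_nth /= !nth_set_nth /=. Qed.

Lemma swapK i a : (i.+1 < size a)%N -> swap i (swap i a) = a.
Proof.
move=> h; apply: (@eq_from_nth _ 0); first by rewrite !size_swap ?size_swap.
move=> j _; rewrite !nth_swap !eqxx (ltn_eqF (ltnSn i)).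
by case: eqP => [->//|_]; case: eqP => [->//|_].
Qed.

Lemma swap_cat a c d s : swap (size a) (a ++ c :: d :: s) = a ++ d :: c :: s.
Proof.
apply: (@eq_from_nth _ 0); first by rewrite size_swap size_cat /= ?size_cat //=; lia.
move=> j _; rewrite nth_swap !nth_cat !ltnn !subnn /=.
have -> : ((size a).+1 < size a)%N = false by lia.
have -> : ((size a).+1 - size a)%N = 1%N by lia.
rewrite /=; case: (eqVneq j (size a).+1) => [->|n1].
  have -> : ((size a).+1 < size a)%N = false by lia.
  by have -> : ((size a).+1 - size a)%N = 1%N by lia.
case: (eqVneq j (size a)) => [->|n2]; first by rewrite ltnn subnn.
case: ltnP => // le_aj; have -> : (j - size a = (j - (size a).+2).+2)%N by lia.
by [].
Qed.

Lemma swapE a i : (i.+1 < size a)%N ->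
  a = take i a ++ a`_i :: a`_i.+1 :: drop i.+2 a.
Proof.
move=> h; rewrite -{1}(cat_take_drop i a) (drop_nth 0) 1?ltnW //.
by rewrite (drop_nth 0 h).
Qed.

Lemma perm_swap i a : (i.+1 < size a)%N -> perm_eq (swap i a) a.
Proof.
move=> h; have := swapE h; set u := take i a; set s := drop _ _ => Ea.
rewrite [in swap _ _]Ea; have -> : i = size u by rewrite size_takel //; lia.
rewrite swap_cat [X in perm_eq _ X]Ea perm_cat2l.
have -> : size u = i by rewrite size_takel //; lia.
exact: (permEl (perm_catCA [:: a`_i.+1] [:: a`_i] s)).
Qed.

Fixpoint far_path a (p : seq nat) :=
  if p is i :: p' then far_step a i && far_path (swap i a) p' else true.

Definition path_end a (p : seq nat) := foldl (fun b i => swap i b) a p.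

Lemma far_path_cat a p1 p2 :
  far_path a (p1 ++ p2) = far_path a p1 && far_path (path_end a p1) p2.
Proof. by elim: p1 a => //= i p1 IH a; rewrite IH andbA. Qed.

Lemma path_end_cat a p1 p2 :
  path_end a (p1 ++ p2) = path_end (path_end a p1) p2.
Proof. exact: foldl_cat. Qed.

Lemma path_end_perm a p : far_path a p -> perm_eq (path_end a p) a.
Proof.
elim: p a => //= i p IH a /andP[/andP[si _] /IH/perm_trans]; apply.
exact: perm_swap.
Qed.

Lemma far_step_cat a i s : far_step a i -> far_step (a ++ s) i.
Proof.
rewrite /far_step size_cat => /and4P[si ? ? ?].
by rewrite !nth_cat si (ltn_trans _ si) // ltn_addr //; apply/and4P.
Qed.

Lemma swap_catl a i s : (i.+1 < size a)%N -> swap i (a ++ s) = swap i a ++ s.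
Proof.
move=> si; apply: (@eq_from_nth _ 0).
  by rewrite size_swap ?size_cat ?size_swap // ltn_addr.
move=> j _; rewrite nth_swap !nth_cat si (ltn_trans _ si) //.
rewrite size_swap // nth_swap.
case: (eqVneq j i.+1) => [->|_]; first by rewrite si.
by case: (eqVneq j i) => [->|_]; first by rewrite ltnW.
Qed.

Lemma far_path_catl a p s : far_path a p ->
  far_path (a ++ s) p /\ path_end (a ++ s) p = path_end a p ++ s.
Proof.
elim: p a => //= i p IH a /andP[si /IH[fp pe]].
have lt_i : (i.+1 < size a)%N by case/andP: si.
by rewrite swap_catl // fp pe far_step_cat.
Qed.

(** If the last box e is not the box c, bring c to the end of the tableau without e, then exchange
    it with e. This last exchange is far: c is removable in the presence of e, so e cannot have a
    neighbouring content. *)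
Lemma removable_to_end a c : is_tab a -> removable a c ->
  exists b p, [/\ is_tab (rcons b c), far_path a p & path_end a p = rcons b c].
Proof.
elim/last_ind: a c => [|a e IH] c; first by rewrite (negPf (not_removable_nil c)).
move=> tae rc; have [ec|ec] := eqVneq e c.
  by exists a, [::]; rewrite -ec.
have [rac e1 e2] := removable_prev tae rc ec.
have := tae; rewrite is_tab_rcons => /andP[ta ae].
have [b [p [tbc fp pe]]] := IH c ta rac.
have [fp' pe'] := far_path_catl [:: e] fp.
have pab : perm_eq (rcons b c) a by rewrite -pe path_end_perm.
exists (rcons b e), (p ++ [:: size b]).
have Eb : rcons b c ++ [:: e] = b ++ [:: c; e] by rewrite -cats1 -catA.
rewrite -[rcons a e]cats1 !far_path_cat fp' pe' pe path_end_cat pe' pe Eb /=.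
rewrite swap_cat; split; last by rewrite -!cats1 -catA.
  have := tbc; rewrite is_tab_rcons => /andP[tb bc].
  rewrite -(addable_perm _ pab) in ae.
  have [_ [be|[ce|ce]]] := addable_rcons tb bc ae.
  - rewrite is_tab_rcons is_tab_rcons tb be /=.
    apply: addable_rcons_far => //; first by rewrite eq_sym.
      by rewrite -subr_eq eq_sym.
    by rewrite -(inj_eq (addIr 1)) subrK eq_sym.
  - by rewrite ce eqxx in e1.
  - by rewrite ce eqxx in e2.
have E1 m : (m.+1 < m)%N = false by clear; lia.
rewrite andbT /far_step size_cat /= !nth_cat ltnn subnn /= E1 /=.
by rewrite subSnn /= e1 e2 eq_sym ec addn2 ltnS leqnn.
Qed.

(** Removability depends only on the multiset of contents, that is on the shape. So the last box of
    [b] can be moved to the end of [a], and the remaining boxes are treated by induction. *)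
Lemma tab_connected a b : is_tab a -> is_tab b -> perm_eq a b ->
  exists2 p, far_path a p & path_end a p = b.
Proof.
elim/last_ind: b a => [|b c IH] a ta tbc pab.
  by exists [::]; rewrite //= (perm_nilP pab).
have : removable a c by rewrite (removable_perm _ pab) removable_rcons.
move=> /(removable_to_end ta)[a' [p [ta'c fp pe]]].
move: ta'c tbc; rewrite !is_tab_rcons => /andP[ta' _] /andP[tb _].
have pab' : perm_eq a' b.
  have := path_end_perm fp; rewrite pe => /perm_trans/(_ pab).
  by rewrite -!cats1 perm_cat2r.
have [p' fp' pe'] := IH _ ta' tb pab'.
have [fp'' pe''] := far_path_catl [:: c] fp'.
exists (p ++ p'); first by rewrite far_path_cat fp pe -cats1 fp''.
by rewrite path_end_cat pe -[rcons a' c]cats1 pe'' pe' cats1.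
Qed.

(** These choices are purely combinatorial: one representative per shape and one path per tableau
    serve for every q, which is what makes [average] continuous in q. *)
Lemma tab_paths n m : (m <= n.+1)%N ->
  exists (rep : seq int -> seq int) (pth : seq int -> seq nat),
    [/\ {in tabs n m, forall a, rep a \in tabs n m},
        {in tabs n m, forall a, far_path (rep a) (pth a)},
        {in tabs n m, forall a, path_end (rep a) (pth a) = a}
      & {in tabs n m &, forall a b, perm_eq a b -> rep a = rep b}].
Proof.
(* The filtered list depends only on the multiset of contents, hence so does its head; the default
   [a] is not reached for a tableau [a], which belongs to its own list. *)
move=> mn; pose rep a := head a (seq.filter (perm_eq a) (tabs n m)).
have repP a : a \in tabs n m -> rep a \in seq.filter (perm_eq a) (tabs n m).
  move=> aT; have : a \in seq.filter (perm_eq a) (tabs n m).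
    by rewrite mem_filter perm_refl.
  by rewrite /rep; case: (seq.filter _ _) => //= b s _; rewrite mem_head.
have pthP a : exists p, (a \in tabs n m) ==>
    far_path (rep a) p && (path_end (rep a) p == a).
  have [aT|] := boolP (a \in tabs n m); last by exists [::].
  have := repP a aT; rewrite mem_filter perm_sym (mem_tabs _ mn) => /and3P[pra _ tr].
  have := aT; rewrite (mem_tabs _ mn) => /andP[_ ta].
  by have [p fp pe] := tab_connected tr ta pra; exists p; rewrite fp pe eqxx.
exists rep, (fun a => xchoose (pthP a)); split=> [a aT|a aT|a aT|a b aT bT pab].
- by have := repP a aT; rewrite mem_filter => /andP[].
- by have /implyP/(_ aT)/andP[] := xchooseP (pthP a).
- by have /implyP/(_ aT)/andP[_ /eqP] := xchooseP (pthP a).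
have := repP a aT; have := repP b bT; rewrite /rep.
have -> : seq.filter (perm_eq a) (tabs n m) = seq.filter (perm_eq b) (tabs n m).
  by apply: eq_filter => c; rewrite (permPl pab).
by case: (seq.filter _ _).
Qed.

End ContentVectors.

Section Contents.
Variables (K : fieldType) (q : K).

(* The eigenvalue of a Jucys-Murphy element on a box of content c, normalized by
   [kap 0 = 0] so that it makes sense at q = 1, where it is c. *)
Definition kap (c : int) : K :=
  match c with
  | Posz n => \sum_(i < n) q ^+ (2 * i).+1
  | Negz n => - \sum_(i < n.+1) q ^- (2 * i).+1
  end.

(** The eigenvalue of the multiplicative Jucys-Murphy element 1 + (q - q^-1) J on a box of content
    c, where J has eigenvalue [kap c]; see [kap_pow]. *)
Definition qsq (c : int) : K := q ^ (2 * c).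

Hypothesis q0 : q != 0.

Lemma kapS c : kap (c + 1) = kap c + q ^ (2 * c + 1).
Proof.
case: c => [n|[|n]].
- have -> : n%:Z + 1 = n.+1 :> int by lia.
  rewrite /kap big_ord_recr /=; congr (_ + _).
  by have -> : (2 * n%:Z + 1 = (2 * n).+1 :> int) by lia.
- have -> : Negz 0 + 1 = Posz 0 by [].
  by rewrite /kap big_ord0 big_ord_recr big_ord0 /= add0r addNr.
have -> : Negz n.+1 + 1 = Negz n by lia.
rewrite /kap [in RHS]big_ord_recr opprD -addrA /=.
have -> : 2 * Negz n.+1 + 1 = - (2 * n.+1).+1%:Z by lia.
by rewrite -exprnN addNr addr0.
Qed.

Lemma kap0 : kap 0 = 0. Proof. exact: big_ord0. Qed.

Lemma kap_pow c : 1 + (q - q^-1) * kap c = qsq c.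
Proof.
rewrite /qsq.
have step d : 1 + (q - q^-1) * kap (d + 1) - q ^ (2 * (d + 1)) =
              1 + (q - q^-1) * kap d - q ^ (2 * d).
  rewrite kapS (_ : 2 * (d + 1) = 2 * d + 1 + 1); last by lia.
  rewrite !expfzDr // expr1z.
  by field.
apply/eqP; rewrite -subr_eq0; apply/eqP.
elim/int_rect: c => [|n IH|n IH].
- by rewrite kap0 mulr0 addr0 subrr.
- by rewrite (_ : n.+1%:Z = n%:Z + 1) ?step //; lia.
by rewrite -step (_ : - n.+1%:Z + 1 = - n%:Z) //; lia.
Qed.

End Contents.

(** * Jucys-Murphy elements and the projection onto commutants *)

Section PolynomialAction.
Variables (K : fieldType) (A : algType K).
Implicit Types (x y v w : A) (p : {poly K}).

(** The vectors are elements of [A] itself: working in the left regular module, decomposing the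
    vector 1 produces projections that are elements of [A]. *)
Definition pact y p v : A := horner_alg y p * v.

Lemma pactD y p1 p2 v : pact y (p1 + p2) v = pact y p1 v + pact y p2 v.
Proof. by rewrite /pact raddfD mulrDl. Qed.
Lemma pactDr y p v w : pact y p (v + w) = pact y p v + pact y p w.
Proof. by rewrite /pact mulrDr. Qed.
Lemma pactBr y p v w : pact y p (v - w) = pact y p v - pact y p w.
Proof. by rewrite /pact mulrBr. Qed.
Lemma pactZr y p c v : pact y p (c *: v) = c *: pact y p v.
Proof. by rewrite /pact scalerAr. Qed.
Lemma pactM y p1 p2 v : pact y (p1 * p2) v = pact y p1 (pact y p2 v).
Proof. by rewrite /pact rmorphM mulrA. Qed.
Lemma pactC y c v : pact y c%:P v = c *: v.
Proof. by rewrite /pact /= horner_algC mulr_algl. Qed.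
Lemma pactX y v : pact y 'X v = y * v.
Proof. by rewrite /pact /= horner_algX. Qed.
Lemma pactXC y c v : pact y ('X - c%:P) v = y * v - c *: v.
Proof. by rewrite /pact raddfB /= horner_algX horner_algC mulrBl mulr_algl. Qed.
Lemma pact1 y v : pact y 1 v = v.
Proof. by rewrite /pact rmorph1 mul1r. Qed.
Lemma pact0 y p : pact y p 0 = 0.
Proof. by rewrite /pact mulr0. Qed.
Lemma pactCA y p1 p2 v : pact y p1 (pact y p2 v) = pact y p2 (pact y p1 v).
Proof. by rewrite -!pactM mulrC. Qed.
Lemma pact_comm y p v x : x * y = y * x -> x * pact y p v = pact y p (x * v).
Proof.
move=> xy; elim/poly_ind: p v => [|p c IH] v.
  by rewrite /pact !raddf0 !mul0r mulr0.
by rewrite !pactD !pactM !pactX !pactC mulrDr IH !mulrA xy -scalerAr.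
Qed.

Lemma pact_eigen y p v c : y * v = c *: v -> pact y p v = p.[c] *: v.
Proof.
move=> yv; elim/poly_ind: p => [|p d IH].
  by rewrite /pact raddf0 mul0r horner0 scale0r.
rewrite pactD pactM pactX pactC yv pactZr IH hornerMXaddC scalerDl.
by rewrite scalerA [c * _]mulrC.
Qed.

(** Diagonalizability as an induction principle: a vector killed by a split polynomial with simple
    roots is a sum of eigenvectors. They are taken of the form p(y) v, so that they inherit from v
    its weights under operators commuting with y. *)
Lemma spectral_ind (I : eqType) (f : I -> K) y v (S : seq I) (Q : A -> Prop) :
  uniq S -> {in S &, injective f} ->
  Q 0 -> (forall u w, Q u -> Q w -> Q (u + w)) ->
  (forall c p, c \in S ->
     y * pact y p v = f c *: pact y p v -> Q (pact y p v)) ->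
  pact y (\prod_(c <- S) ('X - (f c)%:P)) v = 0 -> Q v.
Proof.
move=> uS fI Q0 QD Qe v0.
suff H p : pact y (\prod_(c <- S) ('X - (f c)%:P)) (pact y p v) = 0 ->
    Q (pact y p v).
  by rewrite -(pact1 y v); apply: H; rewrite pact1.
elim: S uS fI Qe {v0} p => [|c S IH] /= uS fI Qe p.
  by rewrite big_nil pact1 => ->.
have /andP[cS uS'] := uS.
rewrite big_cons pactM pactXC => /eqP; rewrite subr_eq0 => /eqP eig.
set w := pact y _ _ in eig.
(* The remaining factors act on the eigenvector [w] by the scalar [al]; subtracting al^-1 w
   therefore leaves a vector that these factors alone annihilate. *)
set al := (\prod_(e <- S) ('X - (f e)%:P)).[f c].
have al0 : al != 0.
  rewrite /al horner_prod; rewrite prodf_seq_neq0; apply/allP => e eS; apply/implyP => _.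
  rewrite hornerXsubC subr_eq0; apply/eqP => /fI; rewrite !inE eqxx eS orbT.
  by move=> /(_ isT isT) ce; rewrite ce eS in cS.
have Ew : al^-1 *: w = pact y (al^-1%:P * \prod_(c <- S) ('X - (f c)%:P) * p) v.
  by rewrite !pactM pactC.
have -> : pact y p v = (pact y p v - al^-1 *: w) + al^-1 *: w by rewrite subrK.
apply: QD.
  have E : pact y p v - al^-1 *: w =
      pact y (p - al^-1%:P * \prod_(c <- S) ('X - (f c)%:P) * p) v.
    by rewrite Ew -[in LHS]scaleN1r /pact raddfB /= mulrBl scaleN1r.
  rewrite E; apply: IH => //.
  - by move=> a b aS bS; apply: fI; rewrite inE ?aS ?bS orbT.
  - by move=> e p' eS; apply: Qe; rewrite inE eS orbT.
  rewrite -E pactBr -/w pactZr (pact_eigen _ eig) -/al scalerA mulVf //.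
  by rewrite scale1r subrr.
rewrite Ew; apply: (Qe c); first by rewrite inE eqxx.
by rewrite -Ew -scalerAr eig !scalerA mulrC.
Qed.

Lemma prod_eigen (I : eqType) (r : seq I) (P : pred I) (F : I -> A)
    (f : I -> K) v :
  (forall i, i \in r -> P i -> F i * v = f i *: v) ->
  (\prod_(i <- r | P i) F i) * v = (\prod_(i <- r | P i) f i) *: v.
Proof.
elim: r => [|i r IH] H; first by rewrite !big_nil mul1r scale1r.
have IH' := IH (fun j jr => H j (mem_behead (s := i :: r) jr)).
rewrite !big_cons; case: ifP => // Pi.
rewrite -mulrA IH' -scalerAr (H i) ?mem_head //.
by rewrite scalerA mulrC.
Qed.

End PolynomialAction.

Section HeckeAlgebra.
Variables (K : fieldType) (A : algType K) (q : K) (n : nat) (T : nat -> A).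
Hypothesis q0 : q != 0.
Hypothesis q2 : 1 + q ^+ 2 != 0.
Hypothesis kinj : forall c d : int,
  (`|c| <= n)%N -> (`|d| <= n)%N -> kap q c = kap q d -> c = d.

Local Notation nu := (q - q^-1).
Local Notation kap := (kap q).
Local Notation pp := (qsq q).

Hypothesis T_hecke : forall i, (i.+1 < n)%N -> T i * T i = 1 + nu *: T i.
Hypothesis T_braid : forall i, (i.+2 < n)%N ->
  T i * T i.+1 * T i = T i.+1 * T i * T i.+1.
Hypothesis T_far : forall i j, (i.+1 < j)%N -> (j.+1 < n)%N ->
  T i * T j = T j * T i.

Implicit Types (a b : seq int) (c d e : int) (v w x : A).

Lemma T_far_sym i j : (i.+1 < n)%N -> (j.+1 < n)%N -> (i.+1 < j)%N || (j.+1 < i)%N ->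
  T i * T j = T j * T i.
Proof. by move=> ni nj /orP[ij|ji]; [apply: T_far|rewrite (T_far ji ni)]. Qed.

(** For L_i = 1 + nu J_i the multiplicative recursion L_(i+1) = T_i L_i T_i becomes, by the Hecke
    relation and after division by nu, this one, which still makes sense when nu = 0. *)
Fixpoint jm i : A := if i is j.+1 then T j * jm j * T j + T j else 0.

Lemma T_jm j i : (j.+1 < n)%N -> (i < n)%N -> j != i -> j.+1 != i ->
  T j * jm i = jm i * T j.
Proof.
move=> nj; elim: i => [|i IH] ni ji ji1 /=; first by rewrite mulr0 mul0r.
have [ij|nij] := eqVneq i j.+1; last first.
  have TT : T j * T i = T i * T j by apply: T_far_sym => //; lia.
  have Tjm : T j * jm i = jm i * T j by apply: IH; rewrite 1?eq_sym; lia.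
  rewrite mulrDr mulrDl TT; congr (_ + _).
  by rewrite !mulrA TT -(mulrA (T i)) Tjm -!mulrA TT.
subst i; rewrite /= -/(jm j).
have bra := T_braid ni; have H := T_hecke nj.
have Ty : T j.+1 * jm j = jm j * T j.+1.
  have : forall k, (k <= j)%N -> T j.+1 * jm k = jm k * T j.+1.
    elim=> [|k IHk] kj /=; first by rewrite mulr0 mul0r.
    have TT : T j.+1 * T k = T k * T j.+1 by apply: T_far_sym => //; lia.
    have Tk := IHk (ltnW kj).
    rewrite mulrDr mulrDl TT; congr (_ + _).
    by rewrite !mulrA TT -(mulrA (T k)) Tk -!mulrA TT.
  exact.
set a := T j in bra H Ty *; set b := T j.+1 in bra Ty *; set y := jm j in Ty *.
rewrite !(mulrDr, mulrDl) -!addrA; congr (_ + _).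
  rewrite !mulrA bra -(mulrA _ b y) Ty.
  by rewrite -!mulrA; congr (_ * (_ * (_ * _))); rewrite !mulrA bra.
have E1 : a * (b * a * b) = b * a + nu *: (a * b * a).
  by rewrite -bra !mulrA H !mulrDl mul1r -!scalerAl.
have E2 : b * a * b * a = a * b + nu *: (a * b * a).
  by rewrite -bra -mulrA H mulrDr mulr1 -scalerAr.
by rewrite E1 E2 addrC addrA addrAC.
Qed.

Lemma jm_comm i j : (i < n)%N -> (j < n)%N -> jm i * jm j = jm j * jm i.
Proof.
wlog ij : i j / (i < j)%N.
  move=> H ni nj; case: (ltngtP i j) => [ij|ji|->//]; first exact: H.
  by rewrite (H j i).
move=> _; elim: i ij => [|i IH] ij nj /=; first by rewrite mul0r mulr0.
have TJ : T i * jm j = jm j * T i by apply: T_jm; lia.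
have JJ := IH (ltnW ij) nj.
by rewrite mulrDl mulrDr TJ -!mulrA TJ (mulrA (jm i)) JJ !mulrA TJ.
Qed.

Lemma jmS_T i : (i.+1 < n)%N ->
  jm i.+1 * T i = T i * jm i + (1 + nu *: jm i.+1).
Proof.
move=> ni /=; rewrite mulrDl -mulrA !T_hecke // mulrDr mulr1 -scalerAr.
by rewrite -addrA; congr (_ + _); rewrite addrCA -scalerDr.
Qed.

Lemma T_jmS i : (i.+1 < n)%N ->
  T i * jm i.+1 = jm i * T i + (1 + nu *: jm i.+1).
Proof.
move=> ni /=; rewrite mulrDr !mulrA !T_hecke // mulrDl mul1r -scalerAl.
by rewrite mulrDl -scalerAl -addrA; congr (_ + _); rewrite addrCA -scalerDr.
Qed.

(** * Weight vectors of the Jucys-Murphy elements *)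

Definition wt a v := forall i, (i < size a)%N -> jm i * v = kap a`_i *: v.

Lemma wt_cat a b v : wt (a ++ b) v -> wt a v.
Proof.
move=> H i ia; rewrite H ?nth_cat ?ia // size_cat.
exact: ltn_addr.
Qed.

Lemma wt_rcons a c v : wt (rcons a c) v <->
  wt a v /\ jm (size a) * v = kap c *: v.
Proof.
split=> [H|[H Hc] i].
  split; first by apply: (@wt_cat a [:: c]); rewrite cats1.
  by rewrite H ?size_rcons // nth_rcons ltnn eqxx.
rewrite size_rcons ltnS leq_eqVlt => /orP[/eqP->|ia].
  by rewrite nth_rcons ltnn eqxx.
by rewrite nth_rcons ia; apply: H.
Qed.

Lemma wt_add a v w : wt a v -> wt a w -> wt a (v + w).
Proof. by move=> av aw i ia; rewrite mulrDr av ?aw // scalerDr. Qed.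

Lemma wt_scale a (k : K) v : wt a v -> wt a (k *: v).
Proof. by move=> av i ia; rewrite -scalerAr av // !scalerA mulrC. Qed.

Lemma wt_comm a x v : (forall i, (i < size a)%N -> x * jm i = jm i * x) ->
  wt a v -> wt a (x * v).
Proof. by move=> H av i ia; rewrite mulrA -H // -mulrA av // scalerAr. Qed.

(* Maps vectors of weight [a] to vectors of weight [swap i a]; [gam i a] is the
   scalar by which [sigma i (swap i a) * sigma i a] acts on weight [a]. *)
Definition sigma i a : A :=
  (kap a`_i - kap a`_i.+1) *: T i + (pp a`_i.+1)%:A.

Definition gam i a : K :=
  pp a`_i * pp a`_i.+1 - (kap a`_i - kap a`_i.+1) ^+ 2.

Lemma sigmaE i a v :
  sigma i a * v = (kap a`_i - kap a`_i.+1) *: (T i * v) + pp a`_i.+1 *: v.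
Proof. by rewrite /sigma mulrDl -scalerAl mulr_algl. Qed.

Lemma nu_kap c : nu * kap c = pp c - 1.
Proof. by rewrite -kap_pow // addrAC subrr add0r. Qed.

Lemma wt_sigma i a v : (i.+1 < size a)%N -> (size a <= n)%N ->
  wt a v -> wt (swap i a) (sigma i a * v).
Proof.
move=> ia an av j; rewrite size_swap // => ja.
have ni : (i.+1 < n)%N by apply: leq_trans an.
have v0 := av i (ltnW ia); have v1 := av i.+1 ia.
rewrite sigmaE nth_swap mulrDr -!scalerAr.
set x := a`_i in v0 *; set y := a`_i.+1 in v1 *; set w := T i * v.
have E : (1 + nu *: jm i.+1) * v = pp y *: v.
  by rewrite mulrDl mul1r -scalerAl v1 scalerA -{1}[v]scale1r -scalerDl kap_pow.
case: (eqVneq j i.+1) => [->|ji1].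
  have -> : jm i.+1 * w = kap x *: w + pp y *: v.
    by rewrite mulrA jmS_T // mulrDl E -mulrA v0 -scalerAr.
  rewrite v1 !scalerDr !scalerA -addrA -scalerDl.
  by congr (_ *: _ + _ *: _); ring.
case: (eqVneq j i) => [->|ji].
  have -> : jm i * w = kap y *: w - pp y *: v.
    apply/eqP; rewrite eq_sym subr_eq -E [jm i * w]mulrA -mulrDl -T_jmS //.
    by rewrite -mulrA v1 scalerAr.
  rewrite v0 scalerBr scalerDr !scalerA -addrA -scaleNr -scalerDl.
  by congr (_ *: _ + _ *: _); ring.
rewrite [jm j * w]mulrA -T_jm ?(leq_trans ja) // 1?eq_sym // -mulrA av // -scalerAr.
by rewrite scalerDr !scalerA mulrC [pp y * _]mulrC.
Qed.

Lemma sigmaK i a v : (i.+1 < size a)%N -> (size a <= n)%N ->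
  sigma i (swap i a) * (sigma i a * v) = gam i a *: v.
Proof.
move=> ia an; have ni : (i.+1 < n)%N by apply: leq_trans an.
rewrite !sigmaE !nth_swap !eqxx (ltn_eqF (ltnSn i)) /gam.
set x := a`_i; set y := a`_i.+1.
set w := T i * v.
have -> : T i * ((kap x - kap y) *: w + pp y *: v) =
    (kap x - kap y) *: v + ((kap x - kap y) * nu + pp y) *: w.
  rewrite mulrDr -!scalerAr [T i * w]mulrA T_hecke // mulrDl mul1r -scalerAl.
  by rewrite -/w scalerDr scalerA -addrA -scalerDl.
rewrite !scalerDr !scalerA [LHS](AC (2*2) ((1*4)*(2*3))) /= -!scalerDl.
have -> : (kap y - kap x) * ((kap x - kap y) * nu + pp y) + pp x * (kap x - kap y) = 0.
  have -> : (kap x - kap y) * nu = pp x - pp y.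
    by rewrite mulrC mulrBr !nu_kap; ring.
  by ring.
by rewrite scale0r addr0; congr (_ *: _); ring.
Qed.

Lemma kap_succ c : kap (c + 1) = kap c + pp c * q.
Proof. by rewrite kapS // expfzDr // expr1z. Qed.

Lemma kap_pred c : kap (c - 1) = kap c - pp c / q.
Proof.
have := kapS q0 (c - 1); rewrite subrK => ->.
have -> : 2 * (c - 1) + 1 = 2 * c - 1 by lia.
by rewrite expfzDr // exprN1 addrK.
Qed.

Lemma pp_neq0 c : pp c != 0. Proof. exact: expfz_neq0. Qed.

(** In factored form the zeros become visible: the exchange degenerates only when the two contents
    are neighbours. *)
Lemma gamE i a : gam i a =
  - ((kap a`_i.+1 - kap (a`_i + 1)) * (kap a`_i.+1 - kap (a`_i - 1))).
Proof.
rewrite /gam kap_succ kap_pred; set x := a`_i; set y := a`_i.+1.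
have -> : pp y = 1 + nu * kap y by rewrite kap_pow.
have -> : pp x = 1 + nu * kap x by rewrite kap_pow.
by field.
Qed.

Lemma gam_neq0 i a : far_step a i -> (forall c, c \in a -> `|c| < n)%N ->
  gam i a != 0.
Proof.
move=> /and4P[ia _ y1 y2] an; rewrite gamE oppr_eq0 mulf_eq0 !subr_eq0.
have /an xn : a`_i \in a by rewrite mem_nth // ltnW.
have /an yn : a`_i.+1 \in a by rewrite mem_nth.
apply/norP; split; apply/eqP => /kinj E.
  by rewrite E ?eqxx // in y1; lia.
by rewrite E ?eqxx // in y2; lia.
Qed.

(** [up] carries vectors of weight [a] along a path of far exchanges to weight [path_end a p]; [dn]
    leads back, its factors 1 / [gam] making the two mutually inverse. *)
Fixpoint up a (p : seq nat) : A :=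
  if p is i :: p' then up (swap i a) p' * sigma i a else 1.

Fixpoint dn a (p : seq nat) : A :=
  if p is i :: p' then
    (gam i a)^-1 *: (sigma i (swap i a) * dn (swap i a) p') else 1.

Lemma mem_swap i a c : (i.+1 < size a)%N -> (c \in swap i a) = (c \in a).
Proof. by move=> ia; rewrite (perm_mem (perm_swap ia)). Qed.

Lemma far_path_size a p : far_path a p -> size (path_end a p) = size a.
Proof. by move/path_end_perm/perm_size. Qed.

Lemma wt_up a p v : far_path a p -> (size a <= n)%N -> wt a v ->
  wt (path_end a p) (up a p * v).
Proof.
elim: p a v => [|i p IH] a v /=; first by rewrite mul1r.
move=> /andP[/andP[ia _] fp] an av; rewrite -mulrA.
by apply: IH; rewrite ?size_swap //; apply: wt_sigma.
Qed.

Lemma upK a p v : far_path a p -> (size a <= n)%N ->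
  (forall c, c \in a -> `|c| < n)%N -> dn a p * (up a p * v) = v.
Proof.
elim: p a v => [|i p IH] a v /=; first by rewrite !mul1r.
move=> /andP[fi fp] an ab; have ia : (i.+1 < size a)%N by case/andP: fi.
rewrite -scalerAl -!mulrA IH ?size_swap // ?sigmaK //; last first.
  by move=> c; rewrite mem_swap //; apply: ab.
by rewrite scalerA mulVf ?scale1r // gam_neq0.
Qed.

Lemma gam_swap i a : (i.+1 < size a)%N -> gam i (swap i a) = gam i a.
Proof.
move=> ia; rewrite /gam !nth_swap !eqxx (ltn_eqF (ltnSn i)).
by congr (_ - _); [rewrite mulrC|rewrite -sqrrN opprB].
Qed.

Lemma wt_dn a p v : far_path a p -> (size a <= n)%N ->
  wt (path_end a p) v -> wt a (dn a p * v).
Proof.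
elim: p a v => [|i p IH] a v /=; first by rewrite mul1r.
move=> /andP[/andP[ia _] fp] an av; rewrite -scalerAl -mulrA.
apply: wt_scale; rewrite -{1}(swapK ia).
by apply: wt_sigma; rewrite ?size_swap //; apply: IH; rewrite ?size_swap.
Qed.

Lemma dnK a p v : far_path a p -> (size a <= n)%N ->
  (forall c, c \in a -> `|c| < n)%N -> up a p * (dn a p * v) = v.
Proof.
elim: p a v => [|i p IH] a v /=; first by rewrite !mul1r.
move=> /andP[fi fp] an ab; have ia : (i.+1 < size a)%N by case/andP: fi.
rewrite -scalerAl -!mulrA -scalerAr -scalerAr.
have -> : sigma i a = sigma i (swap i (swap i a)) by rewrite swapK.
rewrite sigmaK ?size_swap // gam_swap // -scalerAr scalerA.
rewrite mulVf ?gam_neq0 // scale1r IH ?size_swap //.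
by move=> c; rewrite mem_swap //; apply: ab.
Qed.

(* [admissible m] says that the restriction of a standard weight to the next
   strand only involves addable contents; it is proved by induction on [m]. *)
Definition addpoly a : {poly K} := \prod_(c <- addset n a) ('X - (kap c)%:P).

Definition admissible m := forall a x, size a = m -> is_tab a -> wt a x ->
  pact (jm m) (addpoly a) x = 0.

Lemma wt_pact a p x : (size a < n)%N -> wt a x ->
  wt a (pact (jm (size a)) p x).
Proof.
move=> an ax i ia; rewrite pact_comm ?ax ?pactZr //.
by rewrite jm_comm //; apply: ltn_trans an.
Qed.

Lemma admissible_eq0 m a c x : admissible m -> size a = m -> is_tab a ->
  (`|c| <= n)%N -> ~~ addable a c -> wt (rcons a c) x -> x = 0.
Proof.
move=> adm sa ta cn nac /wt_rcons[/(adm _ _ sa ta)]; rewrite sa => E xc.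
have := E; rewrite (pact_eigen _ xc) => /eqP.
rewrite scaler_eq0 => /orP[|/eqP//].
rewrite /addpoly horner_prod prodf_seq_eq0 => /hasP[e].
rewrite mem_filter mem_crange => /andP[ae en] /=.
rewrite hornerXsubC subr_eq0 => /eqP/kinj ce.
by rewrite ce // ae in nac.
Qed.

Lemma pp_succ c : pp (c + 1) = q ^+ 2 * pp c.
Proof.
rewrite /qsq (_ : 2 * (c + 1) = 2 * c + 1 + 1); last by lia.
by rewrite !expfzDr // expr1z -mulrA mulrC expr2.
Qed.

Lemma pp_neighbour c d : c = d + 1 \/ c = d - 1 -> pp d + pp c != 0.
Proof.
have H e : pp e + pp (e + 1) != 0.
  by rewrite pp_succ -[X in X + _]mul1r -mulrDl mulf_neq0 ?pp_neq0.
by case=> [->|->] //; rewrite addrC -{2}(subrK 1 d).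
Qed.

(** Exchanging c, d or d, c in the weight (b, c, d, c) yields a weight that starts with (b, d) or
    (b, c, c). Neither is admissible, so both [sigma] kill x, which means that T_i and T_(i+1) act
    on x by scalars al and be. The braid relation gives al be (al - be) x = 0, and al - be is a
    nonzero multiple of 1 + q^2. *)
Lemma not_removable_adjacent b c d x : ((size b).+2 < n)%N ->
  admissible (size b) -> admissible (size b).+1 ->
  is_tab (rcons b c) -> ~~ addable b d -> c = d + 1 \/ c = d - 1 ->
  (`|c| <= n)%N -> (`|d| <= n)%N ->
  wt (b ++ [:: c; d; c]) x -> x = 0.
Proof.
move=> bn adm0 adm1 tbc nbd cd cn dn bx.
set i := size b; set a := b ++ _ in bx.
have sa : size a = i.+3 by rewrite size_cat /= addn3.
have tb : is_tab b by move: tbc; rewrite is_tab_rcons => /andP[].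
have nth0 : a`_i = c by rewrite nth_cat ltnn subnn.
have nth1 : a`_i.+1 = d by rewrite nth_cat ltnNge leqnSn subSnn.
have nth2 : a`_i.+2 = c.
  by rewrite nth_cat ltnNge (leq_trans (leqnSn i)) // -add2n addnK.
have s0 : sigma i a * x = 0.
  apply: (admissible_eq0 adm0 (erefl _) tb dn nbd).
  have : wt (swap i a) (sigma i a * x) by apply: wt_sigma; rewrite ?sa.
  rewrite swap_cat -[b ++ _](cat_rcons d b [:: c; c]).
  exact: wt_cat.
have s1 : sigma i.+1 a * x = 0.
  apply: (admissible_eq0 adm1 (size_rcons b c) tbc cn (not_addable_last tbc)).
  have : wt (swap i.+1 a) (sigma i.+1 a * x) by apply: wt_sigma; rewrite ?sa.
  rewrite /a -cat_rcons -(size_rcons b c) swap_cat -[_ ++ [:: c; d]]cat_rcons.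
  exact: wt_cat.
move: s0 s1; rewrite !sigmaE nth0 nth1 nth2.
set de := kap c - kap d => /eqP; rewrite addr_eq0 => /eqP s0.
rewrite -[kap d - kap c]opprB -/de => /eqP; rewrite addrC scaleNr subr_eq0 => /eqP s1.
have de0 : de != 0.
  rewrite subr_eq0; apply/eqP => /kinj cd'; rewrite cd' // in cd; lia.
have Ti : T i * x = (- (pp d / de)) *: x.
  by rewrite -[LHS]scale1r -(mulVf de0) -scalerA s0 scalerN scalerA scaleNr mulrC.
have Ti1 : T i.+1 * x = (pp c / de) *: x.
  by rewrite -[LHS]scale1r -(mulVf de0) -(scalerA de^-1) -s1 scalerA mulrC.
have := T_braid bn => /(congr1 (fun y => y * x)) /eqP.
rewrite -!mulrA !(Ti, Ti1) -!scalerAr !(Ti, Ti1) -!scalerAr !(Ti, Ti1).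
rewrite !scalerA -subr_eq0 -scalerBl scaler_eq0 => /orP[|/eqP//].
set al := - _; set be := _ / de.
have -> : al * be * al - be * al * be = al * be * (al - be) by ring.
rewrite !mulf_eq0 oppr_eq0 !mulf_eq0 invr_eq0 !(negPf (pp_neq0 _)) (negPf de0) /=.
rewrite /al /be -opprD -mulrDl oppr_eq0 mulf_eq0 invr_eq0 (negPf de0) orbF.
by rewrite (negPf (pp_neighbour cd)).
Qed.

(** Moving g(y) past T leaves the divided difference of g at y and Y, times 1 + nu Y. Since y acts
    on x by [kap d], a root of g = h (X - kap d), this divided difference is just h(Y). *)
Lemma pact_T_jm i d h x : (i.+1 < n)%N -> jm i * x = kap d *: x ->
  pact (jm i) (h * ('X - (kap d)%:P)) (T i * x) =
  T i * pact (jm i.+1) (h * ('X - (kap d)%:P)) x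
  - pact (jm i.+1) h (x + nu *: (jm i.+1 * x)).
Proof.
move=> ni; set Y := jm i.+1; set y := jm i; set k := kap d.
have TY v : y * (T i * v) = T i * (Y * v) - (v + nu *: (Y * v)).
  rewrite mulrA [T i * (_ * v)]mulrA T_jmS // mulrDl -/y mulrDl mul1r.
  by rewrite -scalerAl addrK.
have yY v : y * (Y * v) = Y * (y * v) by rewrite !mulrA jm_comm // ltnW.
rewrite !pactM !pactXC => yx.
have -> : y * (T i * x) - k *: (T i * x) =
    T i * (Y * x - k *: x) - (x + nu *: (Y * x)).
  by rewrite TY mulrBr -scalerAr addrAC.
elim/poly_ind: h x yx => [|h c IH] s ys.
  by rewrite /pact !raddf0 !mul0r mulr0 subr0.
rewrite !pactD !pactM !pactX !pactC.
set u := _ - (s + _).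
have -> : y * u = T i * (Y * (Y * s) - k *: (Y * s)) - (Y * s + nu *: (Y * (Y * s))).
  have Yw : Y * (Y * s - k *: s) = Y * (Y * s) - k *: (Y * s).
    by rewrite mulrBr -scalerAr.
  have yz : y * (s + nu *: (Y * s)) = k *: s + (nu * k) *: (Y * s).
    by rewrite mulrDr -scalerAr yY ys -scalerAr scalerA.
  rewrite /u mulrBr TY yz Yw -addrA -opprD.
  by rewrite scalerBr !scalerA addrACA !subrK.
rewrite IH; last by rewrite yY ys scalerAr.
have Yz : Y * (s + nu *: (Y * s)) = Y * s + nu *: (Y * (Y * s)).
  by rewrite mulrDr -scalerAr.
have Yw : Y * (Y * s - k *: s) = Y * (Y * s) - k *: (Y * s).
  by rewrite mulrBr -scalerAr.
rewrite Yz Yw /u; set w := Y * s - k *: s; set z := s + _.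
clearbody w z; move: (pact _ _ _) (pact _ _ _) => P1 P2.
by rewrite mulrDr opprD addrACA scalerBr -scalerAr.
Qed.

(** For x of weight (a, d), the induction hypothesis applied to T_m x shows that the next eigenvalue
    has content d + 1, d - 1, or addable to [a] and different from d. The contents in this list that
    are not addable after d are excluded by [not_removable_adjacent]. *)
Lemma admissible_step m : (m.+1 < n)%N ->
  (forall k, (k <= m)%N -> admissible k) -> admissible m.+1.
Proof.
move=> mn IH a x; case/lastP: a => // a d; rewrite size_rcons => -[sa] tad xw.
have /wt_rcons[xa xd] := xw; rewrite sa in xd.
have := tad; rewrite is_tab_rcons => /andP[ta ad].
have dn : (`|d| <= m)%N by rewrite -sa; apply: tab_bound.
have d_in : d \in addset n a.
  by rewrite mem_filter ad mem_crange; move: dn mn; lia.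
have uadd : uniq (addset n a) by rewrite filter_uniq // crange_uniq.
set S := rem d (addset n a).
pose h := \prod_(c <- S) ('X - (kap c)%:P).
(* T_m commutes with the first m Jucys-Murphy elements, so T_m x still has weight [a], although it
   is no longer an eigenvector of [jm m]. *)
have g0 : pact (jm m) (h * ('X - (kap d)%:P)) (T m * x) = 0.
  have -> : h * ('X - (kap d)%:P) = addpoly a.
    by rewrite /addpoly (perm_big _ (perm_to_rem d_in)) big_cons mulrC.
  apply: IH => //; apply: wt_comm => // i; rewrite sa => im.
  by apply: T_jm => //; move: mn im; lia.
set Y := jm m.+1.
pose u := pact Y h x.
have ud : jm m * u = kap d *: u.
  by rewrite pact_comm ?xd ?pactZr //; apply: jm_comm => //; apply: ltnW.
have Tu : T m * (Y * u - kap d *: u) = u + nu *: (Y * u).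
  have := g0; rewrite pact_T_jm // => /eqP; rewrite subr_eq0 => /eqP.
  rewrite mulrC pactM pactXC -/u => ->.
  by rewrite pactDr pactZr -[Y * x]pactX pactCA pactX.
set p := pp d; have pk : 1 + nu * kap d = p by rewrite kap_pow.
have E1 : Y * u - kap d *: u = p *: (T m * u).
  have TYu : T m * (Y * u) = u + nu *: (Y * u) + kap d *: (T m * u).
    by rewrite -Tu mulrBr -scalerAr subrK.
  have := congr1 (fun v => T m * v) Tu.
  rewrite mulrA T_hecke // mulrDl mul1r -scalerAl Tu mulrDr -scalerAr TYu.
  move=> E; apply: (addIr (nu *: (u + nu *: (Y * u)))); rewrite E.
  rewrite [in LHS]scalerDr -pk scalerDl scale1r scalerA addrA.
  by rewrite addrAC.
have E2 : Y * (Y * u - kap d *: u) - kap d *: (Y * u - kap d *: u) =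
    p *: (u + nu *: (Y * u)).
  rewrite E1 -scalerAr scalerA mulrC -scalerA -scalerBr; congr (_ *: _).
  rewrite mulrA jmS_T // mulrDl -mulrA ud mulrDl mul1r -scalerAl -scalerAr.
  by rewrite addrAC subrr add0r.
(* E1 expresses T_m u through Y and u; substituting it in E2 leaves a quadratic equation for Y on u,
   whose roots are the eigenvalues of the two contents next to d. *)
have quad : pact Y (('X - (kap (d + 1))%:P) * ('X - (kap (d - 1))%:P)) u = 0.
  move: E2; rewrite pactM !pactXC kap_succ kap_pred -/p !mulrBr -!scalerAr.
  rewrite !scalerBr scalerDr !scalerA => /eqP; rewrite !subr_eq => /eqP ->.
  rewrite -!scaleNr [- (_ *: _ + _)]opprD -!scaleNr.
  rewrite [LHS](AC (2*2*1*1*2) ((1*4*8)*(2*3*5*6*7))) /= -!scalerDl.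
  rewrite [X in X *: u](_ : _ = 0).
    rewrite [X in _ + X *: _](_ : _ = 0) ?scale0r ?addr0 //.
    by field.
  transitivity (p * (1 + nu * kap d - p)); last by rewrite pk subrr mulr0.
  by field.
have tot : pact Y (\prod_(c <- [:: d + 1, d - 1 & S]) ('X - (kap c)%:P)) x = 0.
  by rewrite !big_cons mulrA pactM.
have Sin c : c \in S -> [/\ addable a c, (`|c| <= n)%N & c != d].
  by rewrite mem_rem_uniq // !inE mem_filter mem_crange => /and3P[-> -> ->].
have bnd c : c \in [:: d + 1, d - 1 & S] -> (`|c| <= n)%N.
  by rewrite !inE => /or3P[/eqP->|/eqP->|/Sin[]//]; move: dn mn; lia.
apply: (spectral_ind (Q := fun w => pact Y (addpoly (rcons a d)) w = 0) _ _ _ _ _ tot).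
- have nS e : e \in S -> e != d + 1 /\ e != d - 1.
    by move=> /Sin[ae _ _]; apply: addable_neighbour ad ae.
  rewrite /= !inE rem_uniq // andbT negb_or -andbA.
  apply/and3P; split; first by lia.
    by apply/negP => /nS[]; rewrite eqxx.
  by apply/negP => /nS[_]; rewrite eqxx.
- by move=> c e /bnd cn /bnd en; apply: kinj.
- by rewrite pact0.
- by move=> v w v0 w0; rewrite pactDr v0 w0 addr0.
move=> c g cS eig; set w := pact Y g x in eig *.
have wa : wt (rcons a d) w.
  by have := @wt_pact (rcons a d) g x; rewrite size_rcons sa; apply.
have [adc|nadc] := boolP (addable (rcons a d) c).
  have cin : c \in addset n (rcons a d) by rewrite mem_filter adc mem_crange bnd.
  by rewrite /addpoly (big_rem c cin) /= mulrC pactM pactXC eig subrr pact0.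
suff -> : w = 0 by rewrite pact0.
(* An addable content away from d stays addable, so the offending c is a neighbour of d and is
   removable in [a]. Bringing that box to the end of [a] changes the weight to (b, c, d, c). *)
have cd : c = d + 1 \/ c = d - 1.
  move: cS; rewrite !inE => /or3P[/eqP|/eqP|/Sin[ac _ cd]]; [by left|by right|].
  have [c1 c2] := addable_neighbour ad ac.
  by rewrite addable_rcons_far in nadc.
have rac := removable_neighbour ta ad cd nadc.
have [b [pth [tbc fp pe]]] := removable_to_end ta rac.
have [fp' pe'] := far_path_catl [:: d; c] fp.
have wac : wt (a ++ [:: d; c]) w.
  by rewrite -cat_rcons cats1; apply/wt_rcons; split => //; rewrite size_rcons sa.
have sac : size (a ++ [:: d; c]) = m.+2 by rewrite size_cat sa addn2.
have sb : (size b).+1 = m.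
  by rewrite -sa -(far_path_size fp) pe size_rcons.
rewrite -(upK w fp') ?sac //; last first.
  move=> e; rewrite mem_cat !inE => /or3P[ea|/eqP->|/eqP->].
  - have := tab_bound_mem ta ea; rewrite sa; move: mn; clear; lia.
  - by move: dn mn; clear; lia.
  - by case: cd => ->; move: dn mn; clear; lia.
have : wt (path_end (a ++ [:: d; c]) pth) (up (a ++ [:: d; c]) pth * w).
  by apply: wt_up => //; rewrite sac.
rewrite pe' pe cat_rcons => /not_removable_adjacent -> //; rewrite ?mulr0 ?sb //.
- by apply: IH; rewrite -sb.
- exact: IH.
- have pab : perm_eq (rcons b c) a by rewrite -pe path_end_perm.
  have := tbc; rewrite is_tab_rcons => /andP[_ bc].
  apply/negP => bd; have [] := addable_neighbour bd bc.
  by case: cd => ->; rewrite eqxx.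
- exact: bnd.
by move: dn mn; clear; lia.
Qed.

Lemma admissible_all m : (m < n)%N -> admissible m.
Proof.
elim/ltn_ind: m => -[|m] IH mn.
  move=> a x /size0nil-> _ _; rewrite /addpoly.
  have z_in : 0 \in addset n [::] by rewrite mem_filter mem_crange.
  by rewrite (big_rem 0 z_in) /= mulrC pactM pactXC mul0r big_ord0 scale0r subrr pact0.
apply: admissible_step => // k km; apply: IH => //.
exact: leq_ltn_trans km (ltnW mn).
Qed.

(** Each step splits a vector of weight [a] by the next Jucys-Murphy element; admissibility bounds
    its spectrum by the addable contents, so that only tableaux appear. *)
Lemma tabs_decomposition m : (m <= n)%N -> exists2 g : seq int -> A,
  1 = \sum_(a <- tabs n m) g a & forall a, a \in tabs n m -> wt a (g a).
Proof.
pose Q m x := exists2 g : seq int -> A,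
  x = \sum_(a <- tabs n m) g a & forall a, a \in tabs n m -> wt a (g a).
have Q0 k : Q k 0.
  exists (fun=> 0); first by rewrite big1.
  by move=> a _ i _; rewrite mulr0 scaler0.
have QD k v w : Q k v -> Q k w -> Q k (v + w).
  move=> [f -> fw] [g -> gw]; exists (fun a => f a + g a).
    by rewrite big_split.
  by move=> a aT; apply: wt_add; [apply: fw|apply: gw].
have Q1 k a w : a \in tabs n k -> wt a w -> Q k w.
  move=> aT aw; exists (fun b => if b == a then w else 0).
    rewrite (bigD1_seq a aT (tabs_uniq n k)) /= eqxx big1 ?addr0 //.
    by move=> b /negPf->.
  by move=> b _; case: eqP => [->//|_] i _; rewrite mulr0 scaler0.
elim: m => [|m IH] mn; first by apply: (Q1 0%N [::]) => //; rewrite inE.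
have [g -> gw] := IH (ltnW mn).
change (Q m.+1 (\sum_(a <- tabs n m) g a)).
rewrite big_seq; elim/big_rec: _ => [|a x aT Qx]; first exact: Q0.
apply: (QD _ _ _ _ Qx); move: (gw a aT); move: (g a) => v av.
have := aT; rewrite mem_tabs 1?ltnW 1?ltnW // => /andP[/eqP sa ta].
apply: (spectral_ind (Q := Q m.+1) (f := kap) (S := addset n a) (y := jm m)).
- by rewrite filter_uniq // crange_uniq.
- move=> c e; rewrite !mem_filter !mem_crange => /andP[_ cn] /andP[_ en].
  exact: kinj.
- exact: Q0.
- exact: QD.
- move=> c p cS eig; apply: (Q1 m.+1 (rcons a c)).
    by apply/allpairsPdep; exists a, c; rewrite aT.
  apply/wt_rcons; rewrite sa; split=> //.
  by rewrite -sa; apply: wt_pact => //; rewrite sa.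
- exact: (admissible_all mn).
Qed.

(** The nodes are all contents of absolute value at most n instead of the actual spectrum, so the
    formula does not depend on the representation and is continuous in q wherever [kap] separates
    these contents. *)
Definition lag i c : A := \prod_(e <- crange n | e != c)
  ((kap c - kap e)^-1 *: (jm i - (kap e)%:A)).

Definition pw a : A := \prod_(i <- iota 0 (size a)) lag i a`_i.

Lemma lag_eigen i c d v : (`|d| <= n)%N -> jm i * v = kap d *: v ->
  lag i c * v = (c == d)%:R *: v.
Proof.
move=> dn vd.
rewrite (@prod_eigen _ _ _ _ _ _ (fun e => (kap c - kap e)^-1 * (kap d - kap e))).
  congr (_ *: _); case: eqVneq => [->|cd].
    rewrite big_seq_cond big1 // => e /andP[]; rewrite mem_crange => en ed.
    by rewrite mulVf // subr_eq0; apply: contra ed => /eqP/kinj->.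
  by rewrite (big_rem d) ?mem_crange //= eq_sym cd subrr mulr0 mul0r.
move=> e _ ec; rewrite -scalerAl mulrBl vd mulr_algl -scalerBl scalerA.
by [].
Qed.

Lemma pw_wt a b v : size a = size b -> (forall c, c \in b -> `|c| <= n)%N ->
  wt b v -> pw a * v = (a == b)%:R *: v.
Proof.
move=> sab bn bv.
rewrite /pw (@prod_eigen _ _ _ _ _ _ (fun i => (a`_i == b`_i)%:R)).
  congr (_ *: _); case: eqVneq => [->|ab].
    by rewrite big1 // => i _; rewrite eqxx.
  apply/eqP; rewrite prodf_seq_eq0 /=.
  have : ~~ all (fun i => a`_i == b`_i) (iota 0 (size a)).
    apply: contra ab => /allP H; apply/eqP/(eq_from_nth (x0 := 0) sab) => i ia.
    by apply/eqP/H; rewrite mem_iota.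
  rewrite -has_predC; apply: sub_has => i /= /negPf->.
  by rewrite eqxx.
move=> i; rewrite mem_iota add0n => /andP[_ ia] _.
have ib : (i < size b)%N by rewrite -sab.
by apply: lag_eigen (bv i ib); apply/bn/mem_nth.
Qed.

Lemma tabs_bound m a c : (m <= n)%N -> a \in tabs n m -> c \in a -> (`|c| < m)%N.
Proof.
by move=> mn; rewrite (mem_tabs _ (leqW mn)) => /andP[/eqP<- ta]; apply: tab_bound_mem.
Qed.

Lemma tabs_size m a : (m <= n)%N -> a \in tabs n m -> size a = m.
Proof. by move=> mn; rewrite (mem_tabs _ (leqW mn)) => /andP[/eqP]. Qed.

Lemma pw_tabs m a v : (m <= n)%N -> a \in tabs n m -> wt a v -> pw a * v = v.
Proof.
move=> mn aT av; rewrite (pw_wt _ _ av) ?eqxx ?scale1r // => c.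
by move/(tabs_bound mn aT)/ltnW/leq_trans; apply.
Qed.

(** Multiplying the decomposition of 1 by [pw a] on the left retains exactly the component of weight
    [a]; hence [pw a] is that component. *)
Lemma wt_pw m a : (m <= n)%N -> a \in tabs n m -> wt a (pw a).
Proof.
move=> mn aT; have [g g1 gw] := tabs_decomposition mn.
suff -> : pw a = g a by apply: gw.
rewrite -[LHS]mulr1 g1 mulr_sumr (bigD1_seq a aT (tabs_uniq n m)) /=.
rewrite (pw_tabs mn aT (gw a aT)) big_seq_cond big1 ?addr0 // => b /andP[bT ba].
rewrite (pw_wt _ _ (gw b bT)) ?(tabs_size mn aT) ?(tabs_size mn bT) //.
  by rewrite eq_sym (negPf ba) scale0r.
by move=> c /(tabs_bound mn bT)/ltnW/leq_trans; apply.
Qed.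

Lemma sum_pw m : (m <= n)%N -> \sum_(a <- tabs n m) pw a = 1.
Proof.
move=> mn; have [g g1 gw] := tabs_decomposition mn.
rewrite g1 big_seq [RHS]big_seq; apply: eq_bigr => a aT.
rewrite -[LHS]mulr1 g1 mulr_sumr (bigD1_seq a aT (tabs_uniq n m)) /=.
rewrite (pw_tabs mn aT (gw a aT)) big_seq_cond big1 ?addr0 // => b /andP[bT ba].
rewrite (pw_wt _ _ (gw b bT)) ?(tabs_size mn aT) ?(tabs_size mn bT) //.
  by rewrite eq_sym (negPf ba) scale0r.
by move=> c /(tabs_bound mn bT)/ltnW/leq_trans; apply.
Qed.

Lemma pw_comm x a : (forall i, (i < size a)%N -> x * jm i = jm i * x) ->
  x * pw a = pw a * x.
Proof.
move=> H; rewrite /pw big_seq; apply: commr_prod => i.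
rewrite mem_iota add0n => /H xi.
rewrite /lag; apply: commr_prod => e _; rewrite /GRing.comm -scalerAl -scalerAr.
by rewrite mulrBl mulrBr xi mulr_algl mulr_algr.
Qed.

Lemma pw_mul m a b : (m <= n)%N -> a \in tabs n m -> b \in tabs n m ->
  pw a * pw b = (a == b)%:R *: pw b.
Proof.
move=> mn aT bT; apply: pw_wt; last exact: wt_pw bT.
  by rewrite (tabs_size mn aT) (tabs_size mn bT).
by move=> c /(tabs_bound mn bT)/ltnW/leq_trans; apply.
Qed.

Lemma pw_rcons a c : pw (rcons a c) = pw a * lag (size a) c.
Proof.
rewrite /pw size_rcons -[(size a).+1]addn1 iotaD big_cat /= big_seq1 add0n.
rewrite nth_rcons ltnn eqxx; congr (_ * _); rewrite big_seq [RHS]big_seq.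
by apply: eq_bigr => i; rewrite mem_iota add0n nth_rcons => /andP[_ ->].
Qed.

(** * The tower of Hecke algebras *)

Inductive halg m : A -> Prop :=
  | halgC k : halg m k%:A
  | halgT i of (i < m)%N : halg m (T i)
  | halgD x y of halg m x & halg m y : halg m (x + y)
  | halgM x y of halg m x & halg m y : halg m (x * y).

(** With H_m the algebra generated by the T_i for i < m, this is H_m + H_m T_m H_m, which turns out
    to be all of H_(m+1): a single occurrence of T_m suffices. *)
Inductive hbimod m : A -> Prop :=
  | hbimodI x of halg m x : hbimod m x
  | hbimodT x y of halg m x & halg m y : hbimod m (x * T m * y)
  | hbimodD x y of hbimod m x & hbimod m y : hbimod m (x + y).

Lemma halg1 m : halg m 1. Proof. by rewrite -[1]scale1r; apply: halgC. Qed.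

Lemma halgZ m (k : K) x : halg m x -> halg m (k *: x).
Proof. by move=> mx; rewrite -mulr_algl; apply: halgM => //; apply: halgC. Qed.

Lemma halgW m k x : (m <= k)%N -> halg m x -> halg k x.
Proof.
move=> mk; elim=> [c|i im|y z _ Hy _ Hz|y z _ Hy _ Hz].
- exact: halgC.
- by apply: halgT; apply: leq_trans mk.
- exact: halgD.
- exact: halgM.
Qed.

Lemma halg0 x : halg 0 x -> exists k, x = k%:A.
Proof.
elim=> [k|//|y z _ [k ->] _ [l ->]|y z _ [k ->] _ [l ->]].
- by exists k.
- by exists (k + l); rewrite scalerDl.
- by exists (k * l); rewrite mulr_algl scalerA.
Qed.

Lemma hbimodMl m x y : halg m x -> hbimod m y -> hbimod m (x * y).
Proof.
move=> mx; elim=> [z mz|z t mz mt|z t _ Hz _ Ht].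
- by apply: hbimodI; apply: halgM.
- by rewrite !mulrA; apply: hbimodT => //; apply: halgM.
- by rewrite mulrDr; apply: hbimodD.
Qed.

Lemma halg_comm_T m x i : halg m x -> (m < i)%N -> (i.+1 < n)%N ->
  T i * x = x * T i.
Proof.
move=> mx mi ni; elim: mx => [k|j jm_|y z _ Hy _ Hz|y z _ Hy _ Hz].
- by rewrite mulr_algl mulr_algr.
- by rewrite -(T_far (leq_ltn_trans jm_ mi) ni).
- by rewrite mulrDr mulrDl Hy Hz.
- by rewrite mulrA Hy -!mulrA Hz.
Qed.

Lemma halg_comm_jm m x i : halg m x -> (m < i)%N -> (i < n)%N ->
  x * jm i = jm i * x.
Proof.
move=> mx mi ni; elim: mx => [k|j jm_|y z _ Hy _ Hz|y z _ Hy _ Hz].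
- by rewrite mulr_algl mulr_algr.
- by apply: T_jm => //; move: jm_ mi ni; clear; lia.
- by rewrite mulrDr mulrDl Hy Hz.
- by rewrite mulrA -Hy -!mulrA Hz.
Qed.

(** Write x in H_(m-1) + H_(m-1) T_(m-1) H_(m-1). Since T_m commutes with H_(m-1), only T_m T_m and
    T_m T_(m-1) T_m remain; the Hecke and braid relations reduce them to at most one T_m. *)
Lemma T_hbimod_T m : (m.+1 < n)%N ->
  (forall k x, m = k.+1 -> halg m x -> hbimod k x) ->
  forall x, halg m x -> hbimod m (T m * x * T m).
Proof.
move=> mn IH.
have TT : hbimod m (T m * T m).
  rewrite T_hecke // addrC -mulr_algr -[T m]mul1r.
  apply: hbimodD; first by apply: hbimodT; [apply: halg1|apply: halgC].
  by apply: hbimodI; apply: halg1.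
case: m mn IH TT => [|m] mn IH TT x mx.
  by have [k ->] := halg0 mx; rewrite mulr_algr -scalerAl -mulr_algl;
    apply: hbimodMl TT; apply: halgC.
have := IH m x (erefl _) mx; elim=> [y my|y z my mz|y z _ Hy _ Hz].
- rewrite (halg_comm_T my) // -mulrA; apply: hbimodMl TT.
  by apply: halgW my.
- have Tm : halg m.+1 (T m) by apply: halgT.
  have -> : T m.+1 * (y * T m * z) * T m.+1 = y * T m * T m.+1 * (T m * z).
    rewrite !mulrA (halg_comm_T my) // -(mulrA _ z) -(halg_comm_T mz) //.
    by rewrite -!mulrA; congr (y * _); rewrite !mulrA -T_braid.
  by apply: hbimodT; apply: halgM => //; [apply: halgW my|apply: halgW mz].
- by rewrite mulrDr mulrDl; apply: hbimodD.
Qed.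

Lemma halg_hbimod m x : (m.+1 < n)%N -> halg m.+1 x -> hbimod m x.
Proof.
elim/ltn_ind: m x => m IHm x mn mx.
have TT := T_hbimod_T mn (fun k y km my => IHm k (eq_leq (esym km)) y
  (ltn_trans (eq_leq (esym (congr1 succn km))) mn)
  (eq_ind m (fun j => halg j y) my _ km)).
suff H y : hbimod m y -> hbimod m (x * y).
  by rewrite -[x]mulr1; apply/H/hbimodI/halg1.
elim: mx y => [k|i im|u v _ Hu _ Hv|u v _ Hu _ Hv] y.
- by move=> my; apply: hbimodMl my; apply: halgC.
- move: im; rewrite ltnS leq_eqVlt => /orP[/eqP->|im] my; last first.
    by apply: hbimodMl my; apply: halgT.
  elim: my => [z mz|z t mz mt|z t _ Hz _ Ht].
  + by rewrite -[T m]mul1r; apply: hbimodT => //; apply: halg1.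
  + rewrite !mulrA; elim: (TT z mz) => [w mw|w1 w2 m1 m2|w1 w2 _ H1 _ H2].
    * by apply/hbimodI/halgM.
    * by rewrite -mulrA; apply: hbimodT => //; apply: halgM.
    * by rewrite mulrDl; apply: hbimodD.
  + by rewrite mulrDr; apply: hbimodD.
- by move=> my; rewrite mulrDl; apply: hbimodD; [apply: Hu|apply: Hv].
- by move=> my; rewrite -mulrA; apply/Hu/Hv.
Qed.

Lemma halg_jm m i : (i <= m)%N -> halg m (jm i).
Proof.
elim: i => [|i IH] im /=; first by rewrite -(scale0r 1); apply: halgC.
have Ti : halg m (T i) by apply: halgT.
by apply: halgD => //; do !apply: halgM => //; apply/IH/ltnW.
Qed.

Lemma halg_prod m (I : Type) (r : seq I) (P : pred I) (F : I -> A) :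
  (forall i, P i -> halg m (F i)) -> halg m (\prod_(i <- r | P i) F i).
Proof.
move=> H; elim/big_rec: _ => [|i x /H]; first exact: halg1.
exact: halgM.
Qed.

Lemma halg_pw m a : (size a <= m.+1)%N -> halg m (pw a).
Proof.
move=> am; rewrite /pw big_seq; apply: halg_prod => i.
rewrite mem_iota add0n => /andP[_ ia]; apply: halg_prod => e _.
apply: halgZ; rewrite -scaleN1r; apply: halgD.
  by apply: halg_jm; rewrite -ltnS; apply: leq_trans am.
by apply/halgZ/halgC.
Qed.

Lemma is_tab_cat a b : is_tab (a ++ b) -> is_tab a.
Proof.
elim/last_ind: b => [|b c IH]; first by rewrite cats0.
by rewrite -rcons_cat is_tab_rcons => /andP[/IH].
Qed.

Lemma tab_adjacent a i : is_tab a -> (i.+1 < size a)%N -> a`_i != a`_i.+1.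
Proof.
move=> ta ia; move: ta; rewrite {1}(swapE ia) -cat_rcons -cat_rcons => /is_tab_cat.
rewrite is_tab_rcons => /andP[/not_addable_last nad ad].
by apply: contra nad => /eqP {2}->.
Qed.

(** Young's seminormal form: T_i is a combination of 1 and [sigma i b], which send weight b to the
    weights b and [swap i b]. The denominator is nonzero because consecutive boxes of a tableau have
    distinct contents. *)
Lemma pw_T_pw m a b i : (m <= n)%N -> (i.+1 < m)%N ->
  a \in tabs n m -> b \in tabs n m ->
  pw a * T i * pw b = ((kap b`_i - kap b`_i.+1)^-1 * (a == swap i b)%:R) *: 
     (sigma i b * pw b)
   - ((kap b`_i - kap b`_i.+1)^-1 * pp b`_i.+1 * (a == b)%:R) *: pw b.
Proof.
move=> mn im aT bT; have sb := tabs_size mn bT; have sa := tabs_size mn aT.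
have bb c : c \in b -> (`|c| <= n)%N.
  by move/(tabs_bound mn bT)/ltnW/leq_trans; apply.
set de := kap _ - kap _.
have de0 : de != 0.
  have := bT; rewrite (mem_tabs _ (leqW mn)) => /andP[_ tb].
  rewrite subr_eq0; apply/eqP => /kinj E; have := @tab_adjacent b i tb.
  by rewrite E ?eqxx ?sb ?bb // ?mem_nth ?sb // ?(ltnW im) // => /(_ im).
have -> : pw a * T i * pw b = de^-1 *: (pw a * (sigma i b * pw b)) - 
    (de^-1 * pp b`_i.+1) *: (pw a * pw b).
  rewrite sigmaE -/de mulrDr -!scalerAr scalerDr !scalerA mulVf // scale1r addrK.
  by rewrite mulrA.
have -> : pw a * pw b = (a == b)%:R *: pw b by apply: pw_mul bT.
rewrite (@pw_wt a (swap i b)) ?size_swap ?sb ?scalerA //.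
  by move=> c; rewrite mem_swap ?sb //; apply: bb.
by apply: wt_sigma; rewrite ?sb //; apply: wt_pw bT.
Qed.

Lemma pw_T_perm m a b i : (m <= n)%N -> (i.+1 < m)%N ->
  a \in tabs n m -> b \in tabs n m -> ~~ perm_eq a b -> pw a * T i * pw b = 0.
Proof.
move=> mn im aT bT nab; have sb := tabs_size mn bT.
rewrite (pw_T_pw mn) //.
have /negPf-> : a != b by apply: contra nab => /eqP->.
have /negPf-> : a != swap i b.
  by apply: contra nab => /eqP->; rewrite perm_swap ?sb.
by rewrite !mulr0 !scale0r subrr.
Qed.

Lemma pw_T_scalar m a i : (m <= n)%N -> (i.+1 < m)%N ->
  a \in tabs n m -> exists k, pw a * T i * pw a = k *: pw a.
Proof.
move=> mn im aT; have sa := tabs_size mn aT.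
rewrite (pw_T_pw mn) //.
have /negPf-> : a != swap i a.
  have := aT; rewrite (mem_tabs _ (leqW mn)) => /andP[_ ta].
  have := @tab_adjacent a i ta; rewrite sa => /(_ im); apply: contra => /eqP E.
  by rewrite {1}E nth_swap eqxx (ltn_eqF (ltnSn i)).
by rewrite mulr0 scale0r sub0r -scaleNr; eexists.
Qed.

(** Generators do not change the shape by the seminormal form; for a product, insert the sum of all
    [pw] between the factors. *)
Lemma pw_halg_perm m x a b : (m.+1 <= n)%N -> halg m x ->
  a \in tabs n m.+1 -> b \in tabs n m.+1 -> ~~ perm_eq a b ->
  pw a * x * pw b = 0.
Proof.
move=> mn mx; elim: mx a b => [k|i im|y z _ Hy _ Hz|y z _ Hy _ Hz] a b aT bT nab.
- rewrite mulr_algr -scalerAl (pw_mul mn) //.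
  have /negPf-> : a != b by apply: contra nab => /eqP->.
  by rewrite scale0r scaler0.
- exact: (pw_T_perm mn).
- by rewrite mulrDr mulrDl Hy // Hz // addr0.
- rewrite mulrA -[_ * y]mulr1 -(sum_pw mn) mulr_sumr !mulr_suml big_seq big1 //.
  move=> c cT; have [ac|nac] := boolP (perm_eq a c); last by rewrite Hy ?mul0r.
  rewrite -!mulrA [pw c * _]mulrA Hz ?mulr0 //.
  by apply: contra nab; apply: perm_trans.
Qed.

Lemma pw_prefix m a c : (m.+1 <= n)%N -> rcons a c \in tabs n m.+1 ->
  pw a * pw (rcons a c) = pw (rcons a c) /\
  pw (rcons a c) * pw a = pw (rcons a c).
Proof.
move=> mn acT; have sa : size a = m.
  by have := tabs_size mn acT; rewrite size_rcons => -[].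
have aT : a \in tabs n m.
  have := acT; rewrite (mem_tabs _ (leqW mn)) is_tab_rcons => /and3P[_ ta _].
  by rewrite mem_tabs ?sa ?eqxx // leqW // ltnW.
have E : pw a * pw (rcons a c) = pw (rcons a c).
  apply: (pw_tabs (ltnW mn) aT).
  by have /wt_rcons[] := wt_pw mn acT.
split=> //; rewrite -{2}E; apply/esym/pw_comm => i; rewrite size_rcons => ic.
apply/esym; rewrite pw_comm // => j ja; apply: jm_comm.
  by apply: leq_trans ic _; rewrite sa.
by apply: leq_trans ja _; rewrite sa ltnW.
Qed.

Lemma tabs_rcons_perm m a b c d : (m.+1 <= n)%N ->
  rcons a c \in tabs n m.+1 -> rcons b d \in tabs n m.+1 ->
  perm_eq (rcons a c) (rcons b d) -> a = b -> c = d.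
Proof.
move=> _ _ _ ab E; move: ab; rewrite E -!cats1 perm_cat2l => /perm_mem/(_ c).
by rewrite !inE eqxx => /esym/eqP.
Qed.

(** T_m commutes with the projection attached to the first m boxes, and two tableaux of the same
    shape with the same first m boxes coincide. *)
Lemma pw_T_last m a b : (m.+2 <= n)%N ->
  a \in tabs n m.+1 -> b \in tabs n m.+1 -> perm_eq a b -> a != b ->
  pw a * T m * pw b = 0.
Proof.
move=> mn; have mn1 := ltnW mn; have mn2 := ltnW mn1.
case/lastP: a => [|a c]; first by move=> /(tabs_size mn1).
case/lastP: b => [|b d]; first by move=> _ /(tabs_size mn1).
move=> aT bT pab nab.
have [E1 E2] := pw_prefix mn1 aT; have [E3 E4] := pw_prefix mn1 bT.
have sa : size a = m by have := tabs_size mn1 aT; rewrite size_rcons => -[].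
have sb : size b = m by have := tabs_size mn1 bT; rewrite size_rcons => -[].
have pT g f : rcons g f \in tabs n m.+1 -> g \in tabs n m.
  rewrite (mem_tabs _ (leqW mn1)) is_tab_rcons size_rcons eqSS => /and3P[se te _].
  by rewrite (mem_tabs _ (leqW mn2)) se te.
have ab : a != b.
  by apply: contra nab => /eqP ab; rewrite (tabs_rcons_perm mn1 aT bT pab ab) ab.
rewrite -E2 -E3 -!mulrA [T m * _]mulrA.
have -> : T m * pw b = pw b * T m.
  by apply: pw_comm => i; rewrite sb => im; apply: T_jm => //; move: im mn; clear; lia.
rewrite -!mulrA [pw a * _]mulrA (pw_mul mn2 (pT _ _ aT) (pT _ _ bT)) (negPf ab).
by rewrite scale0r mul0r mulr0.
Qed.

Lemma lag_comm i c x : x * jm i = jm i * x -> x * lag i c = lag i c * x.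
Proof.
move=> xi; apply: commr_prod => e _; rewrite /GRing.comm -scalerAl -scalerAr.
by rewrite mulrBl mulrBr xi mulr_algl mulr_algr.
Qed.

Definition scalar_at a x := exists k, pw a * x * pw a = k *: pw a.

Lemma scalar_atD a x y : scalar_at a x -> scalar_at a y -> scalar_at a (x + y).
Proof.
by move=> [k Ek] [l El]; exists (k + l); rewrite mulrDr mulrDl Ek El scalerDl.
Qed.

Lemma scalar_at_sum a (I : eqType) (r : seq I) (P : pred I) (F : I -> A) :
  (forall i, i \in r -> P i -> scalar_at a (F i)) ->
  scalar_at a (\sum_(i <- r | P i) F i).
Proof.
move=> H; rewrite big_seq_cond; elim/big_rec: _ => [|i x /andP[ir Pi]].
  by exists 0; rewrite mulr0 mul0r scale0r.
by apply: scalar_atD; apply: H.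
Qed.

(** Multiplicity one. By induction along the tower: elements of H_m are scalar already between the
    projections of the truncated tableau, and y T_m z is reduced to this case by resolving the
    identity on both sides of T_m. *)
Lemma pw_halg_scalar m x a : (m.+1 <= n)%N -> halg m x ->
  a \in tabs n m.+1 -> scalar_at a x.
Proof.
elim: m x a => [|m IH] x a mn mx aT.
  have [k ->] := halg0 mx; exists k.
  by rewrite mulr_algr -scalerAl (pw_mul mn) // eqxx scale1r.
have mn1 := ltnW mn.
case/lastP: a aT => [|a c] aT; first by have := tabs_size mn aT.
have [E1 E2] := pw_prefix mn aT.
have aT' : a \in tabs n m.+1.
  have := aT; rewrite (mem_tabs _ (leqW mn)) is_tab_rcons size_rcons eqSS.
  by move=> /and3P[se te _]; rewrite (mem_tabs _ (leqW mn1)) se te.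
have ac : addable a c.
  by have := aT; rewrite (mem_tabs _ (leqW mn)) is_tab_rcons => /and3P[].
have sa := tabs_size mn1 aT'.
have idem : pw (rcons a c) * pw (rcons a c) = pw (rcons a c).
  by rewrite (pw_mul mn aT aT) eqxx scale1r.
have small y : halg m y -> scalar_at (rcons a c) y.
  move=> my; have [k Ek] := IH y a mn1 my aT'; exists k.
  have -> : pw (rcons a c) * y * pw (rcons a c) =
      pw (rcons a c) * (pw a * y * pw a) * pw (rcons a c).
    by rewrite !mulrA E2 -(mulrA _ (pw a) (pw (rcons a c))) E1.
  by rewrite Ek -scalerAr -scalerAl E2 idem.
elim: (halg_hbimod mn mx) => [y my|y z my mz|y z _ Hy _ Hz]; first exact: small.
  (* The terms that survive have b = d of the same shape as [a]: elements of H_m preserve shapes,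
     and T_m has no entry between distinct tableaux of this shape. *)
  have split_sum : y * T m * z = \sum_(d <- tabs n m.+1) \sum_(b <- tabs n m.+1)
      y * (pw b * T m * pw d) * z.
    transitivity (y * 1 * T m * 1 * z); first by rewrite !mulr1.
    rewrite -(sum_pw mn1) mulr_sumr !mulr_suml; apply: eq_bigr => d _.
    by rewrite mulr_sumr !mulr_suml; apply: eq_bigr => b _; rewrite !mulrA.
  rewrite split_sum; apply: scalar_at_sum => d dT _; apply: scalar_at_sum => b bT _.
  have zero u : u = 0 -> scalar_at (rcons a c) u.
    by move=> ->; exists 0; rewrite mulr0 mul0r scale0r.
  have [pab|nab] := boolP (perm_eq a b); last first.
    exists 0; rewrite scale0r -{1}E2 -!mulrA (mulrA (pw a)) (mulrA (pw a * y)).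
    by rewrite (pw_halg_perm mn1 my) // !(mulr0, mul0r).
  have [pda|nda] := boolP (perm_eq d a); last first.
    exists 0; rewrite scale0r -{2}E1 !mulrA -(mulrA _ z) -(mulrA _ (pw d)).
    by rewrite (mulrA (pw d)) (pw_halg_perm mn1 mz) // !(mulr0, mul0r).
  have [<-|nbd] := eqVneq b d; last first.
    apply: zero; rewrite pw_T_last ?mulr0 ?mul0r // perm_sym.
    exact: perm_trans pda pab.
  have bcT : rcons b c \in tabs n m.+2.
    have := bT; rewrite (mem_tabs _ (leqW mn1)) => /andP[sb tb].
    by rewrite (mem_tabs _ (leqW mn)) size_rcons eqSS sb is_tab_rcons tb
      -(addable_perm _ pab).
  have [k Ek] := pw_T_scalar mn (ltnSn m.+1) bcT.
  have sb := tabs_size mn1 bT.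
  (* L commutes with H_m, so the factor L of the outer projections can be moved inwards until it
     completes both [pw b] to [pw (rcons b c)]. There T_m acts by the scalar k, and what is left is
     y pw_b z in H_m. *)
  set L := lag m.+1 c.
  have Ea : pw (rcons a c) = pw a * L by rewrite pw_rcons sa.
  have Eb : pw (rcons b c) = pw b * L by rewrite pw_rcons sb.
  have LC u : halg m u -> u * L = L * u.
    by move=> mu; apply/lag_comm/(halg_comm_jm mu).
  have mb : halg m (pw b) by apply: halg_pw; rewrite sb.
  have ma : halg m (pw a) by apply: halg_pw; rewrite sa.
  have [l El] := IH (y * pw b * z) a mn1 (halgM (halgM my mb) mz) aT'.
  have Ea' : pw (rcons a c) = L * pw a by rewrite Ea LC.
  have T_in : halg m.+1 (T m) by apply: halgT.
  exists (k * l).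
  have -> : pw (rcons a c) * (y * (pw b * T m * pw b) * z) * pw (rcons a c) =
      pw a * y * (pw (rcons b c) * T m * pw (rcons b c)) * z * pw a.
    rewrite Eb {1}Ea Ea' -!mulrA; congr (pw a * _).
    rewrite (mulrA L y) -(LC y my) -mulrA; congr (y * _).
    rewrite (mulrA L (pw b)) -(LC _ mb) -mulrA; congr (pw b * (L * (T m * _))).
    by rewrite (mulrA z) LC // -mulrA.
  rewrite Ek -scalerAr -!scalerAl; rewrite -scalerA; congr (_ *: _).
  have -> : pw a * y * pw (rcons b c) * z * pw a = pw a * (y * pw b * z) * pw a * pw (rcons a c).
    rewrite Eb -[_ * pw a * pw _]mulrA E1 Ea' -!mulrA (mulrA z L) (LC z mz).
    by rewrite -!mulrA.
  by rewrite El -scalerAl E1.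
exact: scalar_atD.
Qed.

Lemma halg_up m a p : far_path a p -> (size a <= m.+1)%N -> halg m (up a p).
Proof.
elim: p a => [|i p IH] a /=; first by move=> _ _; apply: halg1.
move=> /andP[/andP[ia _] fp] am; apply: halgM; first by apply: IH; rewrite ?size_swap.
apply: halgD; last exact: halgC.
by apply/halgZ/halgT; rewrite -ltnS; apply: leq_trans am.
Qed.

Lemma halg_dn m a p : far_path a p -> (size a <= m.+1)%N -> halg m (dn a p).
Proof.
elim: p a => [|i p IH] a /=; first by move=> _ _; apply: halg1.
move=> /andP[/andP[ia _] fp] am; apply/halgZ/halgM; last first.
  by apply: IH; rewrite ?size_swap.
apply: halgD; last exact: halgC.
by apply/halgZ/halgT; rewrite -ltnS; apply: leq_trans am.
Qed.

(** * Matrix units and averaging *)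

Section Averaging.
Variables (rep : seq int -> seq int) (pth : seq int -> seq nat).
Hypothesis rep_tabs : {in tabs n n, forall a, rep a \in tabs n n}.
Hypothesis pth_far : {in tabs n n, forall a, far_path (rep a) (pth a)}.
Hypothesis pth_end : {in tabs n n, forall a, path_end (rep a) (pth a) = a}.
Hypothesis rep_perm : {in tabs n n &, forall a b, perm_eq a b -> rep a = rep b}.

Definition unitl a : A := up (rep a) (pth a) * pw (rep a).
Definition unitr a : A := dn (rep a) (pth a) * pw a.
(* [unitl a] and [unitr a] are matrix units relating the tableau [a] to a fixed
   tableau [rep a] of the same shape. *)
Definition average (X : A) : A := \sum_(a <- tabs n n) unitl a * X * unitr a.

Lemma average_sum (I : finType) (c : I -> K) (X : I -> A) :
  average (\sum_i c i *: X i) = \sum_i c i *: average (X i).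
Proof.
rewrite /average; under eq_bigr do rewrite mulr_sumr mulr_suml.
rewrite exchange_big; apply: eq_bigr => i _ /=; rewrite scaler_sumr.
by apply: eq_bigr => a _; rewrite -scalerAr -scalerAl.
Qed.

Lemma rep_size a : a \in tabs n n -> (size (rep a) <= n)%N.
Proof. by move/rep_tabs/(tabs_size (leqnn n))->. Qed.

Lemma pw_unitl a : a \in tabs n n -> pw a * unitl a = unitl a.
Proof.
move=> aT; apply: (pw_tabs (leqnn n) aT); rewrite -{1}(pth_end aT).
by apply: wt_up; [apply: pth_far|apply: rep_size|apply/(wt_pw (leqnn n))/rep_tabs].
Qed.

Lemma pw_unitr a : a \in tabs n n -> pw (rep a) * unitr a = unitr a.
Proof.
move=> aT; apply: (pw_tabs (leqnn n) (rep_tabs aT)).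
apply: wt_dn; [exact: pth_far|exact: rep_size|rewrite pth_end //].
exact: wt_pw (leqnn n) aT.
Qed.

Lemma pw_idem a : a \in tabs n n -> pw a * pw a = pw a.
Proof. by move=> aT; rewrite (pw_mul (leqnn n) aT aT) eqxx scale1r. Qed.

Lemma unitl_pw a : a \in tabs n n -> unitl a * pw (rep a) = unitl a.
Proof. by move=> aT; rewrite /unitl -mulrA pw_idem // rep_tabs. Qed.

Lemma unitr_pw a : a \in tabs n n -> unitr a * pw a = unitr a.
Proof. by move=> aT; rewrite /unitr -mulrA pw_idem. Qed.

Lemma unitlr a : a \in tabs n n -> unitl a * unitr a = pw a.
Proof.
move=> aT; rewrite {1}/unitl -mulrA pw_unitr // /unitr dnK //.
- exact: pth_far.
- exact: rep_size.
- by move=> c; apply: tabs_bound => //; apply: rep_tabs.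
Qed.

(** By multiplicity one unitr_b T_i unitl_a is a multiple k of [pw (rep a)]. The same k describes
    the left action of T_i on the [unitl] and its right action on the [unitr], and this is why
    [average] commutes with T_i. *)
Lemma unit_T a b i : (i.+1 < n)%N -> a \in tabs n n -> b \in tabs n n ->
  exists k, pw b * T i * unitl a = k *: unitl b /\
            unitr b * T i * pw a = k *: unitr a.
Proof.
move=> ni aT bT; have [pba|nba] := boolP (perm_eq b a); last first.
  have z := pw_T_perm (leqnn n) ni bT aT nba; exists 0; rewrite !scale0r.
  split; first by rewrite -(pw_unitl aT) mulrA z mul0r.
  transitivity (unitr b * (pw b * T i * pw a)); last by rewrite z mulr0.
  by rewrite !mulrA unitr_pw.
have rab : rep b = rep a := rep_perm bT aT pba.
have [m nE] : exists m, n = m.+1 by case: (n) ni => // m _; exists m.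
have h : halg m (unitr b * T i * unitl a).
  have sz (s : seq int) : s \in tabs n n -> (size s <= m.+1)%N.
    by move=> cT; rewrite (tabs_size (leqnn n) cT) nE.
  apply: halgM; first apply: halgM.
  - by apply: halgM; [apply: halg_dn; rewrite ?pth_far ?sz ?rep_tabs|apply/halg_pw/sz].
  - by apply: halgT; rewrite -ltnS -nE.
  by apply: halgM; [apply: halg_up; rewrite ?pth_far ?sz ?rep_tabs|
     apply/halg_pw/sz/rep_tabs].
have rT : rep a \in tabs n m.+1 by rewrite -nE rep_tabs.
have [k] := pw_halg_scalar (eq_leq (esym nE)) h rT.
have rb : pw (rep a) * unitr b = unitr b by rewrite -rab pw_unitr.
rewrite -(mulrA _ _ (pw (rep a))) -(mulrA _ (unitl a)) unitl_pw //.
rewrite (mulrA _ _ (unitl a)) (mulrA (pw (rep a)) (unitr b)) rb => E.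
exists k; split.
  rewrite -(unitlr bT) -(mulrA _ (T i)) -(mulrA (unitl b)) (mulrA (unitr b)) E.
  by rewrite -scalerAr -rab unitl_pw.
by rewrite -(unitlr aT) (mulrA _ (unitl a)) E -scalerAl pw_unitr.
Qed.

Lemma average_comm X i : (i.+1 < n)%N -> T i * average X = average X * T i.
Proof.
move=> ni; rewrite /average mulr_sumr mulr_suml.
transitivity (\sum_(a <- tabs n n) \sum_(b <- tabs n n)
    pw b * T i * unitl a * X * unitr a).
  apply: eq_bigr => a _; rewrite -[LHS]mul1r -(sum_pw (leqnn n)) mulr_suml.
  by apply: eq_bigr => b _; rewrite !mulrA.
transitivity (\sum_(b <- tabs n n) \sum_(a <- tabs n n)
    unitl b * X * (unitr b * T i * pw a)); last first.
  apply: eq_bigr => a _; rewrite -[RHS]mulr1 -(sum_pw (leqnn n)) mulr_sumr.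
  by apply: eq_bigr => b _; rewrite !mulrA.
rewrite exchange_big /= big_seq [RHS]big_seq; apply: eq_bigr => b bT.
rewrite big_seq [RHS]big_seq; apply: eq_bigr => a aT.
have [k [-> ->]] := unit_T ni aT bT.
by rewrite -!scalerAl -scalerAr.
Qed.

Lemma average_id X : (forall i, (i.+1 < n)%N -> T i * X = X * T i) ->
  average X = X.
Proof.
move=> XT; have XH m x : (m < n)%N -> halg m x -> x * X = X * x.
  move=> mn; elim=> [k|i im|y z _ Hy _ Hz|y z _ Hy _ Hz].
  - by rewrite mulr_algl mulr_algr.
  - by apply: XT; apply: leq_ltn_trans mn.
  - by rewrite mulrDl mulrDr Hy Hz.
  - by rewrite -mulrA Hz mulrA Hy mulrA.
rewrite /average -[RHS]mulr1 -(sum_pw (leqnn n)) mulr_sumr big_seq [RHS]big_seq.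
apply: eq_bigr => a aT; rewrite -(unitlr aT) mulrA; congr (_ * _).
(* The algebra on n strands is [halg n.-1], which has no meaning for n = 0; there the empty tableau
   is the only one and its path is empty. *)
case: (posnP n) => [n0|n_gt0].
  move: aT; rewrite /unitl; move: (rep_tabs) (pth_far); rewrite n0 => rT pf aT.
  have /eqP r0 : rep a == [::] by move: (rT a aT); rewrite inE.
  have := pf a aT; rewrite r0; case: (pth a) => //= _.
  by rewrite /pw /= big_nil mulr1 mul1r mulr1.
apply: (XH n.-1); first by rewrite ltn_predL.
apply: halgM; last by apply: halg_pw; rewrite prednK // rep_size.
by apply: halg_up; rewrite ?pth_far // prednK // rep_size.
Qed.

End Averaging.
End HeckeAlgebra.

(** * From linear forms on words to intertwiners *)

Section LocalOperators.
Variables (K : fieldType) (I : finType).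
Implicit Types (rho : I -> I -> I -> I -> K) (phi : seq I -> K) (s r : seq I).

Definition act2 rho (G : I -> I -> K) x y : K :=
  \sum_(p : I * I) rho x y p.1 p.2 * G p.1 p.2.

(** The operator acts on functions of words, in the letters i and i + 1; on words too short for that
    it is the identity. *)
Fixpoint lop rho i phi s : K :=
  match i, s with
  | 0%N, x :: y :: r => act2 rho (fun a b => phi (a :: b :: r)) x y
  | j.+1, x :: r => lop rho j (fun w => phi (x :: w)) r
  | _, _ => phi s
  end.

Lemma eq_act2 rho G G' x y : G =2 G' -> act2 rho G x y = act2 rho G' x y.
Proof. by move=> E; apply: eq_bigr => p _; rewrite E. Qed.

Lemma act2_sum rho (F : finType) (c : F -> K) (G : F -> I -> I -> K) x y :
  act2 rho (fun a b => \sum_f c f * G f a b) x y =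
  \sum_f c f * act2 rho (G f) x y.
Proof.
rewrite /act2; under eq_bigr do rewrite mulr_sumr.
rewrite exchange_big /=; apply: eq_bigr => f _; rewrite mulr_sumr.
by apply: eq_bigr => p _; rewrite mulrCA.
Qed.

Lemma eq_lop rho i phi psi s : (forall w, size w = size s -> phi w = psi w) ->
  lop rho i phi s = lop rho i psi s.
Proof.
elim: i s phi psi => [|i IH] [|x s] phi psi E /=; try exact: E.
  by case: s E => [|y s] E; [apply: E|apply: eq_act2 => a b; apply: E].
by apply: IH => w sw; apply: E; rewrite /= sw.
Qed.

Lemma lop_sum rho i (F : finType) (c : F -> K) (phi : F -> seq I -> K) s :
  lop rho i (fun w => \sum_f c f * phi f w) s =
  \sum_f c f * lop rho i (phi f) s.
Proof.
elim: i s phi => [|i IH] [|x s] phi //=.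
by case: s => [|y s] //; rewrite act2_sum.
Qed.

Lemma lop_act2 rho rho' i (phi : I -> I -> seq I -> K) x y s :
  lop rho i (fun w => act2 rho' (fun a b => phi a b w) x y) s =
  act2 rho' (fun a b => lop rho i (phi a b) s) x y.
Proof.
exact: (lop_sum rho i (fun p : I * I => rho' x y p.1 p.2)
  (fun p w => phi p.1 p.2 w)).
Qed.

Lemma lop_far rho i j phi s : (i.+1 < j)%N -> (j.+1 < size s)%N ->
  lop rho i (lop rho j phi) s = lop rho j (lop rho i phi) s.
Proof.
elim: i j s phi => [|i IH] [|j] [|x s] phi //= ij js; last exact: IH.
case: j ij js => // j _; case: s => [|y s] //= _.
by rewrite lop_act2.
Qed.

Definition hecke_kernel (nu : K) rho := forall x y c d,
  \sum_(p : I * I) rho x y p.1 p.2 * rho p.1 p.2 c d =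
  ((x == c) && (y == d))%:R + nu * rho x y c d.

Lemma act2_delta (G : I -> I -> K) x y :
  \sum_(p : I * I) ((x == p.1) && (y == p.2))%:R * G p.1 p.2 = G x y.
Proof.
rewrite (bigD1 (x, y)) //= !eqxx mul1r big1 ?addr0 // => -[a b] /=.
by rewrite xpair_eqE ![_ == x]eq_sym ![_ == y]eq_sym => /negPf->; rewrite mul0r.
Qed.

Lemma lop_hecke nu rho i phi s : hecke_kernel nu rho -> (i.+1 < size s)%N ->
  lop rho i (lop rho i phi) s = phi s + nu * lop rho i phi s.
Proof.
move=> H; elim: i s phi => [|i IH] [|x s] phi //= si; last exact: (IH s).
case: s si => //= y s _; rewrite /act2; under eq_bigr do rewrite mulr_sumr.
rewrite exchange_big /=.
under eq_bigr => p _ do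
  (under eq_bigr do rewrite mulrA; rewrite -mulr_suml H mulrDl -mulrA).
rewrite big_split /= (act2_delta (fun a b => phi [:: a, b & s])) mulr_sumr.
by congr (_ + _); apply: eq_bigr => p _; rewrite mulrA.
Qed.

Definition braid_kernel rho := forall (G : I -> I -> I -> K) x y z,
  act2 rho (fun a b => act2 rho (fun c d => act2 rho (fun e f => G e f d) a c) b z) x y =
  act2 rho (fun a b => act2 rho (fun c d => act2 rho (fun e f => G c e f) d b) x a) y z.

Lemma lop_braid rho i phi s : braid_kernel rho -> (i.+2 < size s)%N ->
  lop rho i (lop rho i.+1 (lop rho i phi)) s =
  lop rho i.+1 (lop rho i (lop rho i.+1 phi)) s.
Proof.
move=> H; elim: i s phi => [|i IH] [|x s] phi //= si; last exact: (IH s).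
by case: s si => //= y [|z s] //= _; exact: H.
Qed.

End LocalOperators.

Section Transform.
Variables (K : fieldType) (I : finType) (rho : I -> I -> I -> I -> K).
Hypothesis rho_braid : braid_kernel rho.
Hypothesis rho_skew : forall Y : I -> I -> K,
  (forall y b, \sum_(p : I * I) rho p.1 y p.2 b * Y p.1 p.2 = 0) ->
  forall x a, Y x a = 0.

Local Notation ract := (act2 rho).

(* Transports the index [x] to the right through the word [r], one R-matrix at a
   time. *)
Fixpoint carry (phi : seq I -> I -> K) x (r : seq I) : K :=
  if r is y :: r' then ract (fun a b => carry (fun w => phi (a :: w)) b r') x y
  else phi [::] x.

Lemma eq_carry phi psi x r : (forall w b, size w = size r -> phi w b = psi w b) ->
  carry phi x r = carry psi x r.
Proof.
elim: r x phi psi => [|y r IH] x phi psi E /=; first exact: E.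
by apply: eq_act2 => a b; apply: IH => w c sw; apply: E; rewrite /= sw.
Qed.

Lemma carry_sum (F : finType) (c : F -> K) (phi : F -> seq I -> I -> K) x r :
  carry (fun w b => \sum_f c f * phi f w b) x r = \sum_f c f * carry (phi f) x r.
Proof.
elim: r x phi => [|y r IH] x phi //=.
by rewrite -act2_sum; apply: eq_act2 => a b; rewrite IH.
Qed.

Lemma carry_act2 rho' (phi : I -> I -> seq I -> I -> K) u v x r :
  carry (fun w b => act2 rho' (fun a c => phi a c w b) u v) x r =
  act2 rho' (fun a c => carry (phi a c) x r) u v.
Proof.
exact: (carry_sum (fun p : I * I => rho' u v p.1 p.2)
  (fun p w b => phi p.1 p.2 w b)).
Qed.

(** The third Reidemeister move: a crossing of two letters of the word slides through the
    transported strand. *)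
Lemma lop_carry i phi x r : (i.+1 < size r)%N ->
  lop rho i (carry phi x) r =
  carry (fun w b => lop rho i (fun w' => phi w' b) w) x r.
Proof.
elim: i x r phi => [|i IH] x [|y r] phi //= ir.
  case: r ir => //= z r _.
  under [RHS]eq_act2 => a b do under eq_act2 => c d do rewrite carry_act2.
  by rewrite rho_braid.
rewrite lop_act2; apply: eq_act2 => a b; exact: IH.
Qed.

Lemma lop_param rho' j (phi : seq I -> seq I -> I -> K) x r t :
  lop rho' j (fun t' => carry (phi t') x r) t =
  carry (fun w b => lop rho' j (fun t' => phi t' w b) t) x r.
Proof.
elim: r x phi => [|y r IH] x phi //=.
by rewrite lop_act2; apply: eq_act2 => a b; rewrite IH.
Qed.

(** Skew-invertibility makes the partial transpose of R injective. It is used once per letter: Y'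
    absorbs the first crossing, vanishes by induction on the rest of the word, and then Y vanishes
    by [rho_skew]. *)
Lemma carry_inj k (Y : I -> seq I -> K) :
  (forall r z, size r = k ->
     \sum_x carry (fun w b => Y x w * (b == z)%:R) x r = 0) ->
  forall x w, size w = k -> Y x w = 0.
Proof.
elim: k Y => [|k IH] Y H x w.
  move=> /size0nil->; have := H [::] x (erefl _) => /=.
  rewrite (bigD1 x) //= eqxx mulr1 big1 ?addr0 // => y /negPf->.
  by rewrite mulr0.
case: w => //= a w [sw].
pose Y' y b w' := \sum_(p : I * I) rho p.1 y p.2 b * Y p.1 (p.2 :: w').
have Y'0 y b w' : size w' = k -> Y' y b w' = 0.
  apply: (IH (Y' y)) => r z sr.
  have := H (y :: r) z; rewrite /= sr => /(_ (erefl _)) H0; apply: etrans H0.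
  rewrite /act2 /Y'.
  under eq_bigr => b' _ do under eq_carry => v c _ do
    (rewrite mulr_suml; under eq_bigr do rewrite -mulrA).
  under eq_bigr => b' _ do rewrite carry_sum.
  rewrite [RHS]pair_big /= [LHS]exchange_big [LHS]pair_big /=.
  rewrite (reindex (fun u : I * (I * I) => ((u.1, u.2.1), u.2.2))) //=.
  by exists (fun u : (I * I) * I => (u.1.1, (u.1.2, u.2))) => [[? [? ?]]|[[? ?] ?]].
by have := rho_skew (Y := fun x a => Y x (a :: w)); apply=> y b; apply: Y'0.
Qed.

Lemma eq_lop_param rho' j (phi psi : seq I -> K) s : phi =1 psi ->
  lop rho' j phi s = lop rho' j psi s.
Proof. by move=> E; apply: eq_lop => w _; apply: E. Qed.

(* The intertwiner attached to the linear form [f]; [t] is read from right to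
   left. *)
Fixpoint transform k (f : seq (I * I) -> K) (s t : seq I) : K :=
  match k, s, t with
  | 0%N, _, _ => f [::]
  | k'.+1, x0 :: r, z :: t' => \sum_x
      carry (fun w b => transform k' (fun u => f ((x0, x) :: u)) w t' *
        (b == z)%:R) x r
  | _, _, _ => 0
  end.

Lemma eq_transform k f g s t : (forall u, size u = k -> f u = g u) ->
  transform k f s t = transform k g s t.
Proof.
elim: k f g s t => [|k IH] f g [|x s] [|z t] //= E; try exact: E.
apply: eq_bigr => y _; apply: eq_carry => w b _; congr (_ * _).
by apply: IH => u su; apply: E; rewrite /= su.
Qed.

Lemma transform_sum k (F : finType) (c : F -> K) (f : F -> seq (I * I) -> K) s t :
  transform k (fun u => \sum_i c i * f i u) s t = \sum_i c i * transform k (f i) s t.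
Proof.
elim: k f s t => [|k IH] f [|x s] [|z t] //=; try by rewrite big1 // => i _; rewrite mulr0.
under [RHS]eq_bigr do rewrite mulr_sumr.
rewrite exchange_big /=; apply: eq_bigr => y _; rewrite -carry_sum.
apply: eq_carry => w b _; rewrite IH mulr_suml.
by apply: eq_bigr => i _; rewrite mulrA.
Qed.

Lemma transform0 k s t : transform k (fun=> 0) s t = 0.
Proof.
have := @transform_sum k 'I_0 (fun=> 0) (fun _ _ => 0) s t.
rewrite [RHS]big_ord0 => E; apply: etrans E; apply: eq_transform => u _.
by rewrite big_ord0.
Qed.

Lemma transform_inj k f : (forall s t, size s = k -> size t = k ->
  transform k f s t = 0) -> forall u, size u = k -> f u = 0.
Proof.
elim: k f => [|k IH] f H u; first by move/size0nil->; apply: (H [::] [::]).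
case: u => // -[x0 x] u [su].
apply: (IH (fun u => f ((x0, x) :: u))) su => s t ss st.
apply: (@carry_inj k (fun x w => transform k (fun u => f ((x0, x) :: u)) w t)) => //.
by move=> r z sr; apply: (H (x0 :: r) (z :: t)); rewrite /= ?sr ?st.
Qed.

(** The value, on the quadratic part of the defining relation with free indices i, j, r, s, of the
    linear form with value f a b on the product of the letters a and b. *)
Definition rel_form (f : I * I -> I * I -> K) i j r s : K :=
  ract (fun k l => \sum_m \sum_p rho m l p s * f (k, m) (p, r)) i j
  - \sum_a ract (fun b c => \sum_d rho d c r s * f (i, a) (b, d)) a j.

Definition annihilates k (f : seq (I * I) -> K) := forall u v i j r s,
  (size u + size v).+2 = k -> rel_form (fun a b => f (u ++ [:: a, b & v])) i j r s = 0.

(** The transposed matrix with both pairs of indices reversed, because the second word of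
    [transform] is read backwards and the operator acts on the other side. *)
Definition flip_kernel : I -> I -> I -> I -> K := fun x y a b => rho b a y x.

Definition twisted_commute k (Z : seq I -> seq I -> K) :=
  forall i s t, (i.+1 < k)%N -> size s = k -> size t = k ->
  lop rho i (fun s' => Z s' t) s = lop flip_kernel i (Z s) t.

Lemma annihilatesS k f : annihilates k.+1 f <->
  (forall l, annihilates k (fun u => f (l :: u))) /\
  (forall v i j r s, (size v).+2 = k.+1 ->
     rel_form (fun a b => f [:: a, b & v]) i j r s = 0).
Proof.
split=> [H|[H1 H2] [|l u] v i j r s].
  split=> [l u v i j r s sk|v i j r s sk]; last exact: (H [::]).
  by apply: (H (l :: u)); rewrite /= -sk.
- exact: H2.
- by case=> sk; apply: H1.
Qed.

Lemma transform_lopS k f i x0 r z t : (i.+1 < k)%N -> size r = k -> size t = k ->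
  lop rho i.+1 (fun s => transform k.+1 f s (z :: t)) (x0 :: r) -
  lop flip_kernel i.+1 (transform k.+1 f (x0 :: r)) (z :: t) =
  \sum_x carry (fun w b =>
    (lop rho i (fun s => transform k (fun u => f ((x0, x) :: u)) s t) w -
     lop flip_kernel i (transform k (fun u => f ((x0, x) :: u)) w) t) *
    (b == z)%:R) x r.
Proof.
move=> ik sr st.
have sum1 (F : I -> K) : \sum_x F x = \sum_x 1 * F x.
  by apply: eq_bigr => x _; rewrite mul1r.
have carryB phi psi x : carry (fun w b => phi w b - psi w b) x r =
    carry phi x r - carry psi x r.
  have := @carry_sum bool (fun e => (-1) ^+ e) (fun e => if e then psi else phi) x r.
  rewrite big_bool /= expr1 expr0 mulN1r mul1r addrC => <-.
  by apply: eq_carry => w b _; rewrite big_bool /= expr1 expr0 mulN1r mul1r addrC.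
rewrite /=; under eq_lop_param => w do rewrite sum1.
rewrite lop_sum; under [X in _ - X]eq_lop_param => w do rewrite sum1.
rewrite lop_sum -sumrB; apply: eq_bigr => x _; rewrite !mul1r.
rewrite lop_carry ?sr // lop_param -carryB; apply: eq_carry => w b _.
have lopM (rho' : I -> I -> I -> I -> K) phi c v :
      lop rho' i (fun w => phi w * c) v = lop rho' i phi v * c.
  have := @lop_sum K I rho' i 'I_1 (fun=> c) (fun=> phi) v.
  rewrite big_ord1 mulrC => <-; apply: eq_lop_param => w'.
  by rewrite big_ord1 mulrC.
by rewrite !lopM mulrBl.
Qed.

(** Two strands through the same word: first b, then y through what b has left behind. *)
Definition dcarry (h : seq I -> I -> I -> K) y b r :=
  carry (fun w b' => carry (fun w' b'' => h w' b'' b') y w) b r.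

Lemma eq_dcarry h h' y b r : (forall w c d, size w = size r -> h w c d = h' w c d) ->
  dcarry h y b r = dcarry h' y b r.
Proof.
by move=> E; apply: eq_carry => w d sw; apply: eq_carry => w' c sw'; apply: E;
  rewrite sw'.
Qed.

Lemma dcarry_sum (F : finType) (c : F -> K) (h : F -> seq I -> I -> I -> K) y b r :
  dcarry (fun w b c' => \sum_f c f * h f w b c') y b r =
  \sum_f c f * dcarry (h f) y b r.
Proof.
rewrite -carry_sum; apply: eq_carry => w d _; exact: carry_sum.
Qed.

Lemma dcarry_act2 rho' (h : I -> I -> seq I -> I -> I -> K) u v y b r :
  dcarry (fun w c d => act2 rho' (fun a a' => h a a' w c d) u v) y b r =
  act2 rho' (fun a a' => dcarry (h a a') y b r) u v.
Proof.
exact: (dcarry_sum (fun p : I * I => rho' u v p.1 p.2)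
  (fun p w c d => h p.1 p.2 w c d)).
Qed.

Lemma dcarry_cons h y b z r : dcarry h y b (z :: r) =
  ract (fun c d => ract (fun e f => dcarry (fun w => h (e :: w)) f d r) y c) b z.
Proof. by apply: eq_act2 => c d; apply: carry_act2. Qed.

(** By the braid relation the two transported strands may cross each other before or after passing
    the word. *)
Lemma dcarry_last h y b r :
  dcarry (fun w c d => ract (h w) c d) y b r =
  ract (fun y' b' => dcarry h y' b' r) y b.
Proof.
elim: r y b h => [|z r IH] y b h //.
rewrite dcarry_cons; under eq_act2 => c d do under eq_act2 => e f do rewrite IH.
rewrite -(rho_braid (fun e f g => dcarry (fun w => h (e :: w)) f g r)).
by apply: eq_act2 => c d; rewrite dcarry_cons.
Qed.

Lemma transform_dcarry k f x0 j r t1 t2 t :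
  transform k.+2 f [:: x0, j & r] [:: t1, t2 & t] =
  \sum_x ract (fun a b => \sum_y dcarry (fun w c d =>
    transform k (fun u => f [:: (x0, x), (a, y) & u]) w t
      * (c == t2)%:R * (d == t1)%:R) y b r) x j.
Proof.
apply: eq_bigr => x _; apply: eq_act2 => a b /=.
transitivity (\sum_y 1 * dcarry (fun w c d =>
    transform k (fun u => f [:: (x0, x), (a, y) & u]) w t
      * (c == t2)%:R * (d == t1)%:R) y b r); last first.
  by apply: eq_bigr => y _; rewrite mul1r.
rewrite -carry_sum; apply: eq_carry => w d _; rewrite mulr_suml.
apply: eq_bigr => y _; rewrite mul1r -[RHS]mul1r.
have := carry_sum (fun _ : 'I_1 => (d == t1)%:R)
  (fun _ w' c => transform k (fun u => f [:: (x0, x), (a, y) & u]) w' t * (c == t2)%:R) y w.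
rewrite big_ord1 mul1r mulrC => <-; apply: eq_carry => w' c _.
by rewrite big_ord1 mulrC.
Qed.

Lemma rel_form_sum (F : finType) (c : F -> K) (f : F -> I * I -> I * I -> K) i j r s :
  rel_form (fun a b => \sum_e c e * f e a b) i j r s =
  \sum_e c e * rel_form (f e) i j r s.
Proof.
rewrite /rel_form; under [RHS]eq_bigr do rewrite mulrBr.
rewrite sumrB; congr (_ - _).
  rewrite -act2_sum; apply: eq_act2 => k l.
  under [RHS]eq_bigr do rewrite mulr_sumr.
  rewrite [RHS]exchange_big; apply: eq_bigr => m _ /=.
  under [RHS]eq_bigr do rewrite mulr_sumr.
  rewrite [RHS]exchange_big; apply: eq_bigr => p _ /=.
  by rewrite mulr_sumr; apply: eq_bigr => e _; rewrite mulrCA.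
under [RHS]eq_bigr do rewrite mulr_sumr.
rewrite [RHS]exchange_big; apply: eq_bigr => a _ /=.
rewrite -act2_sum; apply: eq_act2 => b b'.
under [RHS]eq_bigr do rewrite mulr_sumr.
rewrite [RHS]exchange_big; apply: eq_bigr => d _ /=.
by rewrite mulr_sumr; apply: eq_bigr => e _; rewrite mulrCA.
Qed.

Definition rel_transform k f i j y b w t :=
  transform k (fun v => rel_form (fun l1 l2 => f [:: l1, l2 & v]) i j y b) w t.

Lemma eq_rel_form f g i j r s : f =2 g -> rel_form f i j r s = rel_form g i j r s.
Proof.
move=> E; congr (_ - _).
  by apply: eq_act2 => k l; apply: eq_bigr => m _; apply: eq_bigr => p _; rewrite E.
by apply: eq_bigr => a _; apply: eq_act2 => b c; apply: eq_bigr => d _; rewrite E.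
Qed.

Definition rel_coef i j r s (e : (I * I) * (I * I)) : K :=
  rel_form (fun a b => (e == (a, b))%:R) i j r s.

Lemma rel_formE f i j r s :
  rel_form f i j r s = \sum_e rel_coef i j r s e * f e.1 e.2.
Proof.
under [RHS]eq_bigr do rewrite mulrC.
rewrite -rel_form_sum; apply: eq_rel_form => a b.
rewrite (bigD1 (a, b)) //= eqxx mulr1 big1 ?addr0 // => e /negPf->.
by rewrite mulr0.
Qed.

Lemma act2_sum1 rho' (F : finType) (G : F -> I -> I -> K) x y :
  act2 rho' (fun a b => \sum_f G f a b) x y = \sum_f act2 rho' (G f) x y.
Proof.
transitivity (\sum_f 1 * act2 rho' (G f) x y).
  by rewrite -act2_sum; apply: eq_act2 => a b; apply: eq_bigr => e _; rewrite mul1r.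
by apply: eq_bigr => e _; rewrite mul1r.
Qed.

Lemma act2_act2 rho1 rho2 (G : I -> I -> I -> I -> K) x y z w :
  act2 rho1 (fun a b => act2 rho2 (G a b) z w) x y =
  act2 rho2 (fun c d => act2 rho1 (fun a b => G a b c d) x y) z w.
Proof. exact: (act2_sum rho1 (fun p : I * I => rho2 z w p.1 p.2)
  (fun p a b => G a b p.1 p.2)). Qed.

(** Each quadratic term of the relation contains two copies of R. One is the crossing already
    present in [transform], the other is the acting operator; on the side of the second word it is
    first brought back through the word by [dcarry_last]. *)
Lemma transform_lop0 k f i j r t1 t2 t :
  lop rho 0 (fun s => transform k.+2 f s [:: t1, t2 & t]) [:: i, j & r] -
  lop flip_kernel 0 (transform k.+2 f [:: i, j & r]) [:: t1, t2 & t] =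
  \sum_b \sum_y dcarry (fun w c d => rel_transform k f i j y b w t
    * (c == t2)%:R * (d == t1)%:R) y b r.
Proof.
pose V l1 l2 t1 t2 y b := dcarry (fun w c d =>
    transform k (fun u => f [:: l1, l2 & u]) w t * (c == t2)%:R * (d == t1)%:R) y b r.
pose W y b := rel_form (fun l1 l2 => V l1 l2 t1 t2 y b) i j y b.
transitivity (\sum_b \sum_y W y b); last first.
  apply: eq_bigr => b _; apply: eq_bigr => y _.
  rewrite /W rel_formE -dcarry_sum; apply: eq_dcarry => w c d _.
  rewrite /rel_transform.
  have -> : transform k (fun v => rel_form (fun l1 l2 => f [:: l1, l2 & v]) i j y b) w t
    = \sum_e rel_coef i j y b e * transform k (fun v => f [:: e.1, e.2 & v]) w t.
    by rewrite -transform_sum; apply: eq_transform => v _; apply: rel_formE.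
  by rewrite !mulr_suml; apply: eq_bigr => e _; rewrite !mulrA.
have Vflip l1 l2 y b : act2 flip_kernel (fun c d => V l1 l2 c d y b) t1 t2 =
    ract (fun y' b' => V l1 l2 t1 t2 y' b') y b.
  rewrite -dcarry_act2 -dcarry_last; apply: eq_dcarry => w c d _.
  transitivity (transform k (fun u => f [:: l1, l2 & u]) w t * rho c d t2 t1).
    rewrite /act2 (bigD1 (d, c)) //= /flip_kernel !eqxx !mulr1 mulrC.
    rewrite big1 ?addr0 // => -[a a'] /=; rewrite xpair_eqE negb_and.
    by case/orP; rewrite eq_sym => /negPf->; rewrite !(mulr0, mul0r).
  rewrite /act2 (bigD1 (t2, t1)) //= !eqxx !mulr1 mulrC.
  rewrite big1 ?addr0 // => -[a a'] /=; rewrite xpair_eqE negb_and.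
  by case/orP => /negPf->; rewrite !(mulr0, mul0r).
have TE x0 j' u1 u2 : transform k.+2 f [:: x0, j' & r] [:: u1, u2 & t] =
    \sum_x ract (fun a b => \sum_y V (x0, x) (a, y) u1 u2 y b) x j'.
  exact: transform_dcarry.
rewrite (_ : lop rho 0 _ _ = ract (fun a b =>
  transform k.+2 f [:: a, b & r] [:: t1, t2 & t]) i j) //.
rewrite (_ : lop flip_kernel 0 _ _ = act2 flip_kernel (fun a b =>
  transform k.+2 f [:: i, j & r] [:: a, b & t]) t1 t2) //.
under eq_act2 => a b do rewrite TE.
under [X in _ - X]eq_act2 => a b do rewrite TE.
rewrite /W /rel_form; under [RHS]eq_bigr do rewrite sumrB.
rewrite sumrB; congr (_ - _).
  under [RHS]eq_bigr do rewrite -act2_sum1.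
  rewrite -act2_sum1; apply: eq_act2 => i' j'.
  under [RHS]eq_bigr do rewrite exchange_big /=.
  rewrite [RHS]exchange_big /=; apply: eq_bigr => m _.
  under [RHS]eq_bigr do rewrite exchange_big /=.
  rewrite [RHS]exchange_big /= pair_big /=; apply: eq_bigr => -[p b] _ /=.
  by rewrite mulr_sumr.
rewrite act2_sum1; under [RHS]eq_bigr do rewrite exchange_big /=.
rewrite [RHS]exchange_big /=; apply: eq_bigr => x _.
under [RHS]eq_bigr do rewrite -act2_sum1.
rewrite -act2_sum1 act2_act2; apply: eq_act2 => a b.
rewrite act2_sum1; under [RHS]eq_bigr do rewrite exchange_big /=.
rewrite [RHS]exchange_big /=; apply: eq_bigr => y _.
by rewrite Vflip /act2 [RHS]exchange_big pair_big.
Qed.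

(** The commutator in position 0 is a double transport of the relation, and in later positions a
    transport of the commutator for the form with its first letter fixed. Transport is injective, so
    commutators and relations vanish together. *)
Theorem transform_commute k f :
  annihilates k f <-> twisted_commute k (transform k f).
Proof.
elim: k f => [|k IH] f; first by split=> // _ u v i j r s.
split=> [/annihilatesS[H1 H2] i s t ik|H].
  case: s => // x0 r; case=> sr; case: t => // z t; case=> st.
  apply/eqP; rewrite -subr_eq0; apply/eqP.
  case: i ik => [|i] ik.
    case: k IH H1 H2 ik sr st => // k IH H1 H2 _.
    case: r => // j r; case=> sr; case: t => // t2 t; case=> st.
    rewrite [LHS]transform_lop0 big1 // => b _; rewrite big1 // => y _.
    (* Zero is written as an empty combination, so that linearity of [dcarry] yields its value on
       the zero function. *)
    have -> : 0 = \sum_(e : 'I_0) 0 * dcarry (fun _ _ _ => 0) y b r by rewrite big_ord0.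
    rewrite -dcarry_sum; apply: eq_dcarry => w c d _.
    rewrite big_ord0 /rel_transform (eq_transform (g := fun=> 0)) ?transform0 ?mul0r //.
    by move=> v sv; apply: H2; rewrite sv.
  have ik' : (i.+1 < k)%N := ik.
  rewrite [LHS](transform_lopS _ _ _ ik') // big1 // => x _.
  have -> : 0 = \sum_(e : 'I_0) 0 * carry (fun _ _ => 0) x r by rewrite big_ord0.
  rewrite -carry_sum; apply: eq_carry => w b sw.
  rewrite big_ord0; have /IH := H1 (x0, x) => ->; rewrite ?sw //.
  by rewrite subrr mul0r.
apply/annihilatesS; split=> [[x0 x]|v i j y b [sv]].
  apply/IH => i s t ik ss st; apply/eqP; rewrite -subr_eq0; apply/eqP.
  apply: (@carry_inj k (fun x s => lop rho i (fun s' => transform k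
     (fun u => f ((x0, x) :: u)) s' t) s - lop flip_kernel i
     (transform k (fun u => f ((x0, x) :: u)) s) t)) => // r z sr.
  rewrite -transform_lopS //; apply/eqP; rewrite subr_eq0; apply/eqP.
  by apply: H; rewrite //= ?sr ?st.
case: k IH H sv => // k _ H [sv].
have rel0 w t : size w = k -> size t = k -> rel_transform k f i j y b w t = 0.
  (* The two transported indices are released one at a time: injectivity of the transport is used
     for y, then for b. *)
  move=> sw st; apply: (@carry_inj k (fun y w => rel_transform k f i j y b w t)) => //.
  move=> r2 t2 sr2; pose Y b r2 := \sum_x carry (fun w0 c =>
    rel_transform k f i j x b w0 t * (c == t2)%:R) x r2.
  apply: (@carry_inj k Y) => // r t1 sr.
  transitivity (\sum_b \sum_y dcarry (fun w c d => rel_transform k f i j y b w t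
    * (c == t2)%:R * (d == t1)%:R) y b r).
    apply: eq_bigr => b' _; transitivity (\sum_y 1 * dcarry (fun w c d =>
      rel_transform k f i j y b' w t * (c == t2)%:R * (d == t1)%:R) y b' r); last first.
      by apply: eq_bigr => x _; rewrite mul1r.
    rewrite -carry_sum; apply: eq_carry => w' d _; rewrite mulr_suml.
    apply: eq_bigr => x _; rewrite mul1r mulrC.
    have := carry_sum (fun _ : 'I_1 => (d == t1)%:R)
      (fun _ w' c => rel_transform k f i j x b' w' t * (c == t2)%:R) x w'.
    rewrite big_ord1 => <-; apply: eq_carry => w'' c _.
    by rewrite big_ord1 mulrC.
  rewrite -transform_lop0; apply/eqP; rewrite subr_eq0; apply/eqP.
  by apply: H; rewrite //= ?sr ?st.
have := @transform_inj k (fun v => rel_form (fun a b => f [:: a, b & v]) i j y b).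
by apply=> // s t ss st; apply: rel0.
Qed.

End Transform.

(** * Continuity and semicontinuity of the rank *)

Section ContinuityAt.
Variables (K : numFieldType) (q0 : K).

Definition cts_at (f : K -> K) := f q @[q --> q0] --> f q0.

Definition cts_mx m n (M : K -> 'M[K]_(m, n)) :=
  forall i j, cts_at (fun q => M q i j).

Lemma cts_cst c : cts_at (fun=> c).
Proof. by apply: cvg_cst; apply: nbhs_filter. Qed.

Lemma cts_id : cts_at id.
Proof. exact: cvg_id. Qed.

Lemma cts_add f g : cts_at f -> cts_at g -> cts_at (fun q => f q + g q).
Proof. by move=> cf cg; apply: (cvgD cf cg). Qed.

Lemma cts_opp f : cts_at f -> cts_at (fun q => - f q).
Proof. by move=> cf; apply: (cvgN cf). Qed.

Lemma cts_mul f g : cts_at f -> cts_at g -> cts_at (fun q => f q * g q).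
Proof. by move=> cf cg; apply: (cvgM cf cg). Qed.

Lemma cts_inv f : cts_at f -> f q0 != 0 -> cts_at (fun q => (f q)^-1).
Proof. by move=> cf f0; apply: (cvgV f0 cf). Qed.

Lemma cts_sum (I : Type) (r : seq I) (P : pred I) (F : I -> K -> K) :
  (forall i, P i -> cts_at (F i)) -> cts_at (fun q => \sum_(i <- r | P i) F i q).
Proof.
move=> H; elim: r => [|i r IH].
  rewrite /cts_at; under eq_fun do rewrite big_nil.
  by rewrite big_nil; apply: cts_cst.
rewrite /cts_at; under eq_fun do rewrite big_cons.
by rewrite big_cons; case: ifP => // /H Fi; apply: cts_add.
Qed.

Lemma cts_prod (I : Type) (r : seq I) (P : pred I) (F : I -> K -> K) :
  (forall i, P i -> cts_at (F i)) -> cts_at (fun q => \prod_(i <- r | P i) F i q).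
Proof.
move=> H; elim: r => [|i r IH].
  rewrite /cts_at; under eq_fun do rewrite big_nil.
  by rewrite big_nil; apply: cts_cst.
rewrite /cts_at; under eq_fun do rewrite big_cons.
by rewrite big_cons; case: ifP => // /H Fi; apply: cts_mul.
Qed.

Lemma cts_exp n f : cts_at f -> cts_at (fun q => f q ^+ n).
Proof.
move=> cf; elim: n => [|n IH]; first exact: cts_cst.
by rewrite /cts_at exprS; under eq_fun do rewrite exprS; apply: cts_mul.
Qed.

Lemma eq_cts f g : f =1 g -> cts_at f -> cts_at g.
Proof. by move=> /funext->. Qed.

Lemma eq_cts_mx m n (M M' : K -> 'M[K]_(m, n)) : M =1 M' -> cts_mx M -> cts_mx M'.
Proof. by move=> /funext->. Qed.

Lemma cts_mx_cst m n (M : 'M[K]_(m, n)) : cts_mx (fun=> M).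
Proof. by move=> i j; apply: cts_cst. Qed.

Lemma cts_mx_add m n (M M' : K -> 'M[K]_(m, n)) :
  cts_mx M -> cts_mx M' -> cts_mx (fun q => M q + M' q).
Proof.
move=> cM cM' i j; apply: (eq_cts _ (cts_add (cM i j) (cM' i j))) => q.
by rewrite mxE.
Qed.

Lemma cts_mx_scale m n f (M : K -> 'M[K]_(m, n)) :
  cts_at f -> cts_mx M -> cts_mx (fun q => f q *: M q).
Proof.
move=> cf cM i j; apply: (eq_cts _ (cts_mul cf (cM i j))) => q.
by rewrite mxE.
Qed.

Lemma cts_mulmx m n p (M : K -> 'M[K]_(m, n)) (M' : K -> 'M[K]_(n, p)) :
  cts_mx M -> cts_mx M' -> cts_mx (fun q => M q *m M' q).
Proof.
move=> cM cM' i j; apply: (@eq_cts (fun q => \sum_k M q i k * M' q k j)).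
  by move=> q; rewrite mxE.
by apply: cts_sum => k _; apply: cts_mul.
Qed.

Lemma cts_det n (M : K -> 'M[K]_n) : cts_mx M -> cts_at (fun q => \det (M q)).
Proof.
move=> cM; apply: cts_sum => s _; apply: cts_mul; first exact: cts_cst.
by apply: cts_prod => i _; apply: cM.
Qed.

Lemma cts_near_neq0 f : cts_at f -> f q0 != 0 -> \forall q \near q0, f q != 0.
Proof. by move=> cf f0; apply: (cvgr_neq0 _ cf). Qed.

(** Gaussian elimination at q0 gives fixed B and C with B M(q0) C = 1 of size r. The determinant of
    B M(q) C is continuous, so it stays nonzero nearby and keeps the rank at least r. *)
Lemma rank_lsc m n (M : K -> 'M[K]_(m, n)) : cts_mx M ->
  \forall q \near q0, (\rank (M q0) <= \rank (M q))%N.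
Proof.
move=> cM; set A := M q0; set r := \rank A.
pose B : 'M[K]_(r, m) := pid_mx r *m invmx (col_ebase A).
pose C : 'M[K]_(n, r) := invmx (row_ebase A) *m pid_mx r.
have BAC : B *m A *m C = 1%:M.
  rewrite /B /C -{2}(mulmx_ebase A) -!mulmxA mulKVmx ?row_ebase_unit //.
  rewrite mulKmx ?col_ebase_unit // !pid_mx_id ?rank_leq_row ?rank_leq_col //.
  by rewrite pid_mx_1.
have cD : cts_at (fun q => \det (B *m M q *m C)).
  apply: cts_det; apply: cts_mulmx; last exact: cts_mx_cst.
  by apply: cts_mulmx => //; apply: cts_mx_cst.
have := cts_near_neq0 cD; rewrite -/A BAC det1 oner_eq0 => /(_ isT).
apply: filterS => q; rewrite -unitfE -unitmxE => /mxrank_unit <-.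
by apply: leq_trans (mxrankM_maxl _ _) _; apply: mxrankM_maxr.
Qed.

End ContinuityAt.

(** The part of genericity that matters in degree n. It consists of finitely many inequations, hence
    is open ([near_good]), and it holds at q = 1. *)
Definition good (K : fieldType) n (q : K) := [/\ q != 0, 1 + q ^+ 2 != 0 &
  forall c d : int, (`|c| <= n)%N -> (`|d| <= n)%N -> kap q c = kap q d -> c = d].

Section Good.
Variable (K : numFieldType).
Implicit Types (q : K) (n : nat).

(** If two contents have the same eigenvalue, q^(2(c - d)) = 1 with an exponent of absolute value at
    most 4n; if q^2 = -1, then q^4 = 1. The bound 4(n + 1) covers both, also for n = 0. *)
Lemma good_expr n q : q != 0 ->
  (forall m, (0 < m <= 4 * n.+1)%N -> q ^+ m != 1) -> good n q.
Proof.
move=> q0 nroot; split=> //.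
  apply/eqP => /eqP; rewrite addrC addr_eq0 => /eqP q2.
  have /nroot/eqP[] : (0 < 4 <= 4 * n.+1)%N by lia.
  by rewrite (exprM q 2 2) q2 sqrrN expr1n.
move=> c d cn dn Ek.
have : q ^ (2 * c) = q ^ (2 * d) by rewrite -[LHS]kap_pow // -[RHS]kap_pow // Ek.
wlog cd : c d cn dn {Ek} / (d <= c).
  move=> H; case: (lerP d c) => [|/ltW] cd Ecd; first exact: H.
  by apply/esym/H.
move=> /(congr1 (fun x => x * q ^ (- (2 * d)))); rewrite -!expfzDr // subrr expr0z.
have -> : 2 * c - 2 * d = Posz (2 * absz (c - d))%N by lia.
move=> /eqP; case: (posnP (absz (c - d))) => [cd0 _|cd_gt0]; first by lia.
by apply: contraTeq => _; apply: nroot; lia.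
Qed.

Lemma good1 n : good n (1 : K).
Proof.
have H : injective (kap (1 : K)).
  suff E c : kap (1 : K) c = c%:~R by move=> c d; rewrite !E => /intr_inj.
  case: c => m; rewrite /kap.
    under eq_bigr do rewrite expr1n.
    by rewrite sumr_const card_ord.
  under eq_bigr do rewrite expr1n invr1.
  by rewrite sumr_const card_ord NegzE mulrNz.
by split; rewrite ?oner_neq0 ?expr1n -?natrD ?pnatr_eq0 //; move=> c d _ _; apply: H.
Qed.

Lemma good_generic n q : q != 0 -> generic q -> good n q.
Proof.
move=> q0 [->|ngq]; first exact: good1.
by apply: good_expr => // m /andP[/ngq + _]; rewrite unity_rootE.
Qed.

Lemma cts_kap q0 c : q0 != 0 -> cts_at q0 (fun q => kap q c).
Proof.
move=> q00; case: c => m.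
  by apply: cts_sum => i _; apply: cts_exp; apply: cts_id.
apply/cts_opp/cts_sum => i _; apply: cts_inv; last exact: expf_neq0.
by apply: cts_exp; apply: cts_id.
Qed.

Lemma near_all (T : eqType) (F : set_system K) (s : seq T) (P : T -> K -> Prop) :
  Filter F -> (forall x, x \in s -> \forall q \near F, P x q) ->
  \forall q \near F, forall x, x \in s -> P x q.
Proof.
move=> FF; elim: s => [|x s IH] H; first by apply: filterE.
have Hx := H x (mem_head x s).
have Hs : \forall q \near F, forall y, y \in s -> P y q.
  by apply: IH => y ys; apply: H; rewrite inE ys orbT.
apply: filterS (filterI Hx Hs) => q [Px Ps] y.
by rewrite inE => /orP[/eqP->//|/Ps].
Qed.

Lemma near_good n q0 : good n q0 -> \forall q \near q0, good n q.
Proof.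
move=> [q00 q20 kinj].
have H1 : \forall q \near q0, q != 0 by apply: (cts_near_neq0 (@cts_id _ _)).
have H2 : \forall q \near q0, 1 + q ^+ 2 != 0.
  apply: (@cts_near_neq0 _ _ (fun q => 1 + q ^+ 2)) => //.
  by apply: cts_add; [apply: cts_cst|apply: cts_exp; apply: cts_id].
pose s := [seq (c, d) | c <- crange n, d <- crange n].
have H3 : \forall q \near q0, forall p, p \in s -> p.1 != p.2 -> kap q p.1 - kap q p.2 != 0.
  apply: (@near_all _ (nbhs q0) s (fun p q => p.1 != p.2 ->
    kap q p.1 - kap q p.2 != 0) (nbhs_filter q0)).
  move=> -[c d] /allpairsP[[c' d'] /= [cn dn [-> ->]]].
  have [->|cd] := eqVneq c' d'; first exact: nearW.
  have : \forall q \near q0, kap q c' - kap q d' != 0.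
    apply: (@cts_near_neq0 _ _ (fun q => kap q c' - kap q d')).
      by apply: cts_add; [|apply: cts_opp]; apply: cts_kap.
    rewrite subr_eq0; apply: contra cd => /eqP/kinj->//; by rewrite -mem_crange.
  by apply: filterS => q.
apply: filterS (filterI H1 (filterI H2 H3)) => q [q1 [q2 q3]]; split=> // c d cn dn E.
apply/eqP/negPn/negP => cd.
have cdS : (c, d) \in s by apply/allpairsP; exists (c, d); rewrite /= !mem_crange.
by have := q3 (c, d) cdS cd; rewrite /= E subrr eqxx.
Qed.

End Good.

Section ContinuityOfAverage.
Variables (K : numFieldType) (q0 : K) (p n : nat) (T : K -> nat -> 'M[K]_p.+1).
Hypothesis q0_good : good n q0.
Hypothesis T_cts : forall i, cts_mx q0 (fun q => T q i).

Let q00 : q0 != 0. Proof. by case: q0_good. Qed.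

Lemma cts_mx_mul (M M' : K -> 'M[K]_p.+1) : cts_mx q0 M -> cts_mx q0 M' ->
  cts_mx q0 (fun q => M q * M' q).
Proof. exact: cts_mulmx. Qed.

Lemma cts_mx_sum m l (I : Type) (r : seq I) (P : pred I) (F : I -> K -> 'M[K]_(m, l)) :
  (forall i, P i -> cts_mx q0 (F i)) -> cts_mx q0 (fun q => \sum_(i <- r | P i) F i q).
Proof.
move=> H; elim: r => [|i r IH].
  apply: (@eq_cts_mx _ q0 _ _ (fun=> 0)) => [q|]; last exact: cts_mx_cst.
  by rewrite big_nil.
have [Pi|nPi] := boolP (P i).
  by apply: (eq_cts_mx _ (cts_mx_add (H i Pi) IH)) => q; rewrite big_cons Pi.
by apply: (eq_cts_mx _ IH) => q; rewrite big_cons (negPf nPi).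
Qed.

Lemma cts_mx_prod (I : Type) (r : seq I) (P : pred I) (F : I -> K -> 'M[K]_p.+1) :
  (forall i, P i -> cts_mx q0 (F i)) -> cts_mx q0 (fun q => \prod_(i <- r | P i) F i q).
Proof.
move=> H; elim: r => [|i r IH].
  apply: (@eq_cts_mx _ q0 _ _ (fun=> 1)) => [q|]; last exact: cts_mx_cst.
  by rewrite big_nil.
have [Pi|nPi] := boolP (P i).
  by apply: (eq_cts_mx _ (cts_mx_mul (H i Pi) IH)) => q; rewrite big_cons Pi.
by apply: (eq_cts_mx _ IH) => q; rewrite big_cons (negPf nPi).
Qed.

Lemma cts_qsq c : cts_at q0 (fun q => qsq q c).
Proof.
rewrite /qsq; case: (2 * c) => m; first by apply: cts_exp; apply: cts_id.
apply: cts_inv; last exact: expf_neq0.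
by apply: cts_exp; apply: cts_id.
Qed.

Lemma cts_jm i : cts_mx q0 (fun q => jm (T q) i).
Proof.
elim: i => [|i IH]; first exact: cts_mx_cst.
by apply: cts_mx_add => //; apply: cts_mx_mul => //; apply: cts_mx_mul.
Qed.

Lemma cts_lag i c : (`|c| <= n)%N -> cts_mx q0 (fun q => lag q n (T q) i c).
Proof.
move=> cn; rewrite /lag.
apply: (eq_cts_mx (M := fun q => \prod_(e <- crange n | (e != c) && (`|e| <= n)%N)
  ((kap q c - kap q e)^-1 *: (jm (T q) i - (kap q e)%:A)))).
  move=> q; rewrite big_seq_cond [RHS]big_seq_cond; apply: eq_bigl => e.
  by rewrite mem_crange; case: (_ <= n)%N; rewrite ?andbT ?andbF.
apply: cts_mx_prod => e /andP[ec en]; have [_ _ kinj] := q0_good.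
apply: cts_mx_scale.
  apply: cts_inv; first by apply: cts_add; [|apply: cts_opp]; apply: cts_kap.
  by rewrite subr_eq0; apply: contra ec => /eqP/kinj->.
apply: cts_mx_add; first exact: cts_jm.
apply: (@eq_cts_mx _ q0 _ _ (fun q => (- kap q e) *: (1 : 'M[K]_p.+1))) => [q|].
  by rewrite scaleNr.
by apply: cts_mx_scale; [apply/cts_opp/cts_kap|apply: cts_mx_cst].
Qed.

Lemma cts_pw a : (forall c, c \in a -> `|c| <= n)%N -> cts_mx q0 (fun q => pw q n (T q) a).
Proof.
move=> an; rewrite /pw.
apply: (eq_cts_mx (M := fun q => \prod_(i <- iota 0 (size a) | (i < size a)%N)
  lag q n (T q) i a`_i)).
  move=> q; rewrite big_seq_cond [RHS]big_seq; apply: eq_bigl => i.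
  by rewrite mem_iota add0n /= andbb.
by apply: cts_mx_prod => i ia; apply/cts_lag/an/mem_nth.
Qed.

Lemma cts_sigma i a : cts_mx q0 (fun q => sigma q (T q) i a).
Proof.
apply: cts_mx_add; apply: cts_mx_scale => //; last exact: cts_mx_cst.
  by apply: cts_add; [|apply: cts_opp]; apply: cts_kap.
exact: cts_qsq.
Qed.

Lemma cts_up a s : cts_mx q0 (fun q => up q (T q) a s).
Proof.
elim: s a => [|i s IH] a; first exact: cts_mx_cst.
by apply: cts_mx_mul; [apply: IH|apply: cts_sigma].
Qed.

Lemma cts_dn a s : far_path a s -> (forall c, c \in a -> `|c| < n)%N ->
  cts_mx q0 (fun q => dn q (T q) a s).
Proof.
elim: s a => [|i s IH] a /=; first by move=> _ _; apply: cts_mx_cst.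
move=> /andP[fi fs] an; have ia : (i.+1 < size a)%N by case/andP: fi.
have [_ q20 kinj] := q0_good.
apply: cts_mx_scale; last first.
  apply: cts_mx_mul; first exact: cts_sigma.
  by apply: IH => // c; rewrite mem_swap //; apply: an.
apply: cts_inv; last exact: (gam_neq0 q00 q20 kinj fi an).
apply: cts_add; first by apply: cts_mul; apply: cts_qsq.
by apply/cts_opp/cts_exp; apply: cts_add; [|apply: cts_opp]; apply: cts_kap.
Qed.

(** The only denominators are powers of q, differences [kap c - kap e] of distinct contents, and the
    [gam] of far exchanges, all nonzero at a good point. *)
Lemma cts_average (rep : seq int -> seq int) (pth : seq int -> seq nat) X :
  {in tabs n n, forall a, rep a \in tabs n n} ->
  {in tabs n n, forall a, far_path (rep a) (pth a)} ->
  cts_mx q0 (fun q => average q n (T q) rep pth X).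
Proof.
move=> rT pf.
have bnd a : a \in tabs n n -> forall c, c \in a -> (`|c| < n)%N.
  by move=> aT c ca; apply: (tabs_bound (leqnn n) aT ca).
apply: (eq_cts_mx (M := fun q => \sum_(a <- tabs n n | a \in tabs n n)
   unitl q n (T q) rep pth a * X * unitr q n (T q) rep pth a)).
  by move=> q; rewrite /average [RHS]big_seq.
apply: cts_mx_sum => a aT; apply: cts_mx_mul; first apply: cts_mx_mul.
- apply: cts_mx_mul; first exact: cts_up.
  by apply: cts_pw => c /(bnd _ (rT _ aT))/ltnW.
- exact: cts_mx_cst.
apply: cts_mx_mul; first by apply: cts_dn; [apply: pf|apply/bnd/rT].
by apply: cts_pw => c /(bnd _ aT)/ltnW.
Qed.

End ContinuityOfAverage.

(** * Intertwiners attached to a Hecke symmetry *)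

Section RMatrix.
Variables (K : fieldType) (N : nat) (q : K) (R : 'M[K]_(N * N)).
Hypothesis R_hecke : hecke_symmetry q R.
Hypothesis R_skew : skew_invertible R.

(** R acts on functions of its lower indices, that is by multiplying row vectors from the right
    ([row_op12]); [flip_kernel] then corresponds to column vectors ([col_op12]). *)
Definition rkernel (x y a b : 'I_N) : K := coef R a b x y.

Lemma sum_mxtens m n (F : 'I_(m * n) -> K) :
  \sum_k F k = \sum_(p : 'I_m * 'I_n) F (mxtens_index p).
Proof.
rewrite (reindex (@mxtens_index m n)) //.
exists (@mxtens_unindex m n) => k _; [exact: mxtens_indexK|exact: mxtens_unindexK].
Qed.

Lemma hecke_sqr : R *m R = 1%:M + (q - q^-1) *: R.
Proof.
case: R_hecke => q0 _ _; rewrite mulmxDr !mulmxBl mul_scalar_mx mul_mx_scalar.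
rewrite -scalar_mxM mulfV // => E; apply/eqP; rewrite -subr_eq0 -E; apply/eqP.
by rewrite scalerBl opprD opprB [LHS](AC (1*(1*2)) ((1*4)*(3*2))).
Qed.

Lemma rkernel_hecke : hecke_kernel (q - q^-1) rkernel.
Proof.
move=> x y c d; have := congr1 (fun M : 'M[K]_(N * N) =>
  M (mxtens_index (c, d)) (mxtens_index (x, y))) hecke_sqr.
rewrite mxE sum_mxtens !mxE => E; transitivity (\sum_(p : 'I_N * 'I_N)
  R (mxtens_index (c, d)) (mxtens_index p) * R (mxtens_index p) (mxtens_index (x, y))).
  by apply: eq_bigr => -[a b] _; rewrite mulrC.
rewrite E; congr (_%:R + _).
by rewrite (inj_eq (can_inj (@mxtens_indexK _ _))) xpair_eqE ![c == _]eq_sym ![d == _]eq_sym.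
Qed.

Lemma flip_rkernel_hecke : hecke_kernel (q - q^-1) (flip_kernel rkernel).
Proof.
move=> x y c d; rewrite /flip_kernel.
rewrite andbC [x == c]eq_sym [y == d]eq_sym -(rkernel_hecke d c y x).
rewrite (reindex_inj (h := fun p => (p.2, p.1))) /=; last first.
  by move=> [? ?] [? ?] [-> ->].
by apply: eq_bigr => p _; rewrite mulrC.
Qed.

Definition idx3 (x y z : 'I_N) : 'I_(N * N * N) := mxtens_index (mxtens_index (x, y), z).

Lemma op12E a b c x y z :
  op12 R (idx3 a b c) (idx3 x y z) = coef R a b x y * (c == z)%:R.
Proof. by rewrite /op12 tensmxE mxE. Qed.

Lemma op23E a b c x y z :
  op23 R (idx3 a b c) (idx3 x y z) = (a == x)%:R * coef R b c y z.
Proof.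
rewrite /op23 castmxE.
have E u v w : cast_ord (esym (mulnA N N N)) (idx3 u v w) =
    mxtens_index (u, mxtens_index (v, w)).
  by apply: val_inj; rewrite /= mulnDl -mulnA addnA.
by rewrite !E tensmxE mxE.
Qed.

Lemma sum_idx3 (F : 'I_(N * N * N) -> K) :
  \sum_k F k = \sum_x \sum_y \sum_z F (idx3 x y z).
Proof.
transitivity (\sum_u \sum_z F (mxtens_index (u, z))).
  by rewrite sum_mxtens pair_big; apply: eq_bigr => -[].
rewrite sum_mxtens [RHS]pair_big /=; apply: eq_bigr => -[x y] _ /=.
by [].
Qed.

Lemma act2E rho (G : 'I_N -> 'I_N -> K) x y :
  act2 rho G x y = \sum_a \sum_b rho x y a b * G a b.
Proof. by rewrite /act2 pair_big. Qed.

Lemma row_op12 (g : 'rV[K]_(N * N * N)) x y z :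
  (g *m op12 R) 0 (idx3 x y z) =
  act2 rkernel (fun a b => g 0 (idx3 a b z)) x y.
Proof.
rewrite mxE sum_idx3 act2E; apply: eq_bigr => a _; apply: eq_bigr => b _.
rewrite (bigD1 z) //= op12E eqxx mulr1 mulrC big1 ?addr0 // => c /negPf cz.
by rewrite op12E cz !mulr0.
Qed.

Lemma row_op23 (g : 'rV[K]_(N * N * N)) x y z :
  (g *m op23 R) 0 (idx3 x y z) =
  act2 rkernel (fun a b => g 0 (idx3 x a b)) y z.
Proof.
rewrite mxE sum_idx3 act2E (bigD1 x) //= [X in _ + X]big1 ?addr0 => [|c /negPf cx].
  apply: eq_bigr => a _; apply: eq_bigr => b _.
  by rewrite op23E eqxx mul1r mulrC.
by rewrite big1 // => a _; rewrite big1 // => b _; rewrite op23E cx mul0r mulr0.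
Qed.

Lemma col_op12 (h : 'cV[K]_(N * N * N)) x y z :
  (op12 R *m h) (idx3 z y x) 0 =
  act2 (flip_kernel rkernel) (fun a b => h (idx3 b a x) 0) y z.
Proof.
rewrite mxE sum_idx3 act2E exchange_big; apply: eq_bigr => a _; apply: eq_bigr => b _.
rewrite (bigD1 x) //= op12E eqxx mulr1 big1 ?addr0 // => c /negPf cx.
by rewrite op12E eq_sym cx mulr0 mul0r.
Qed.

Lemma col_op23 (h : 'cV[K]_(N * N * N)) x y z :
  (op23 R *m h) (idx3 z y x) 0 =
  act2 (flip_kernel rkernel) (fun a b => h (idx3 z b a) 0) x y.
Proof.
rewrite mxE sum_idx3 act2E (bigD1 z) //= [X in _ + X]big1 ?addr0 => [|c /negPf cx].
  rewrite exchange_big; apply: eq_bigr => a _; apply: eq_bigr => b _.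
  by rewrite op23E eqxx mul1r.
by rewrite big1 // => a _; rewrite big1 // => b _; rewrite op23E eq_sym cx !mul0r.
Qed.

Definition unidx3 (u : 'I_(N * N * N)) : 'I_N * 'I_N * 'I_N :=
  (mxtens_unindex (mxtens_unindex u).1, (mxtens_unindex u).2).

Lemma unidx3K x y z : unidx3 (idx3 x y z) = (x, y, z).
Proof. by rewrite /unidx3 !mxtens_indexK. Qed.

Lemma rkernel_braid : braid_kernel rkernel.
Proof.
move=> G x y z; case: R_hecke => _ _ br _.
pose g : 'rV[K]_(N * N * N) :=
  \row_u G (unidx3 u).1.1 (unidx3 u).1.2 (unidx3 u).2.
have gE a b c : g 0 (idx3 a b c) = G a b c by rewrite mxE unidx3K.
have := congr1 (fun M => (g *m M) 0 (idx3 x y z)) br; rewrite !mulmxA.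
rewrite row_op12 row_op23; under eq_act2 => a b do rewrite row_op23.
under [RHS]eq_act2 => a b do rewrite row_op12.
move=> E; etransitivity; last (etransitivity; first exact: E).
  apply: eq_act2 => a b; apply: eq_act2 => c d; rewrite row_op12.
  by apply: eq_act2 => e f; rewrite gE.
apply: eq_act2 => a b; apply: eq_act2 => c d; rewrite row_op23.
by apply: eq_act2 => e f; rewrite gE.
Qed.

Lemma flip_rkernel_braid : braid_kernel (flip_kernel rkernel).
Proof.
move=> G x y z; case: R_hecke => _ _ br _.
pose h : 'cV[K]_(N * N * N) :=
  \col_u G (unidx3 u).2 (unidx3 u).1.2 (unidx3 u).1.1.
have hE a b c : h (idx3 c b a) 0 = G a b c by rewrite mxE unidx3K.
have := congr1 (fun M => (M *m h) (idx3 z y x) 0) br; rewrite -!mulmxA.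
rewrite col_op12 col_op23; under eq_act2 => a b do rewrite col_op23.
under [RHS]eq_act2 => a b do rewrite col_op12.
move=> /esym E; etransitivity; last (etransitivity; first exact: E).
  apply: eq_act2 => a b; apply: eq_act2 => c d; rewrite col_op23.
  by apply: eq_act2 => e f; rewrite hE.
apply: eq_act2 => a b; apply: eq_act2 => c d; rewrite col_op12.
by apply: eq_act2 => e f; rewrite hE.
Qed.

Lemma rkernel_skew (Y : 'I_N -> 'I_N -> K) :
  (forall y b, \sum_(p : 'I_N * 'I_N) rkernel p.1 y p.2 b * Y p.1 p.2 = 0) ->
  forall x a, Y x a = 0.
Proof.
move=> H x a; case: R_skew => Psi PsiP.
transitivity (\sum_b \sum_y \sum_(p : 'I_N * 'I_N)
    rkernel p.1 y p.2 b * Y p.1 p.2 * coef Psi y x b a); last first.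
  by rewrite big1 // => b _; rewrite big1 // => y _; rewrite -mulr_suml H mul0r.
under eq_bigr do rewrite exchange_big /=.
rewrite exchange_big /= (bigD1 (x, a)) //= [X in _ + X]big1 ?addr0.
  under eq_bigr do under eq_bigr do rewrite mulrAC.
  under eq_bigr do rewrite -mulr_suml.
  by rewrite -mulr_suml (PsiP a x a x).1 !eqxx mul1r.
move=> -[x' a']; rewrite xpair_eqE => /negPf ne /=.
under eq_bigr do under eq_bigr do rewrite mulrAC.
under eq_bigr do rewrite -mulr_suml.
by rewrite -mulr_suml (PsiP a' x' a x).1 andbC [x == _]eq_sym ne mul0r.
Qed.

End RMatrix.

Section Intertwiners.
Variables (K : fieldType) (q : K) (n : nat).
Variables (rep : seq int -> seq int) (pth : seq int -> seq nat).

(* Intertwiners are the off-diagonal blocks of the commutant of a direct sum. *)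
Definition block_rep d (T1 T2 : nat -> 'M[K]_d.+1) i : 'M[K]_((d + d.+1).+1) :=
  block_mx (T1 i) 0 0 (T2 i).

(** Size 0 is treated apart because the ring structure on square matrices, in which [average] is
    computed, requires a positive size. *)
Definition intertwine d : (nat -> 'M[K]_d) -> (nat -> 'M[K]_d) -> 'M[K]_d -> 'M[K]_d :=
  match d with
  | 0%N => fun _ _ Z => Z
  | d'.+1 => fun T1 T2 Z =>
      @ursubmx K d'.+1 d'.+1 d'.+1 d'.+1 (average q n (block_rep T1 T2) rep pth
        (@block_mx K d'.+1 d'.+1 d'.+1 d'.+1 0 Z 0 0))
  end.

Definition hecke_rep d (T : nat -> 'M[K]_d) := [/\
  forall i, (i.+1 < n)%N -> T i *m T i = 1%:M + (q - q^-1) *: T i,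
  forall i, (i.+2 < n)%N -> T i *m T i.+1 *m T i = T i.+1 *m T i *m T i.+1
  & forall i j, (i.+1 < j)%N -> (j.+1 < n)%N -> T i *m T j = T j *m T i].

Hypothesis q_good : good n q.
Hypothesis rep_tabs : {in tabs n n, forall a, rep a \in tabs n n}.
Hypothesis pth_far : {in tabs n n, forall a, far_path (rep a) (pth a)}.
Hypothesis pth_end : {in tabs n n, forall a, path_end (rep a) (pth a) = a}.
Hypothesis rep_perm : {in tabs n n &, forall a b, perm_eq a b -> rep a = rep b}.

Lemma block_rep_hecke d (T1 T2 : nat -> 'M[K]_d.+1) :
  hecke_rep T1 -> hecke_rep T2 -> hecke_rep (block_rep T1 T2).
Proof.
have mb (a1 a2 b1 b2 : 'M[K]_d.+1) : @block_mx K d.+1 d.+1 d.+1 d.+1 a1 0 0 a2 *m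
    @block_mx K d.+1 d.+1 d.+1 d.+1 b1 0 0 b2 =
    @block_mx K d.+1 d.+1 d.+1 d.+1 (a1 *m b1) 0 0 (a2 *m b2).
  by rewrite mulmx_block !mulmx0 !mul0mx !addr0 !add0r.
case=> h1 b1 f1 [h2 b2 f2]; split=> [i ni|i ni|i j ij nj]; rewrite /block_rep.
- rewrite mb h1 // h2 // (@scale_block_mx _ d.+1 d.+1 d.+1 d.+1) !scaler0.
  have -> : 1%:M = @block_mx K d.+1 d.+1 d.+1 d.+1 1%:M 0 0 1%:M :> 'M[K]_((d + d.+1).+1).
    exact: (@scalar_mx_block K d.+1 d.+1 1).
  by rewrite (@add_block_mx _ d.+1 d.+1 d.+1 d.+1) !addr0.
- by rewrite !mb b1 // b2.
- by rewrite !mb f1 // f2.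
Qed.

Lemma mul_block_rep d (a b c e a' b' c' e' : 'M[K]_d.+1) :
  (@block_mx K d.+1 d.+1 d.+1 d.+1 a b c e : 'M[K]_((d + d.+1).+1)) *
    @block_mx K d.+1 d.+1 d.+1 d.+1 a' b' c' e' =
  @block_mx K d.+1 d.+1 d.+1 d.+1 (a *m a' + b *m c') (a *m b' + b *m e')
    (c *m a' + e *m c') (c *m b' + e *m e').
Proof.
exact: (@mulmx_block K d.+1 d.+1 d.+1 d.+1 d.+1 d.+1 a b c e a' b' c' e').
Qed.

Lemma intertwine_comm d (T1 T2 : nat -> 'M[K]_d) Z i :
  hecke_rep T1 -> hecke_rep T2 -> (i.+1 < n)%N ->
  T1 i *m intertwine T1 T2 Z = intertwine T1 T2 Z *m T2 i.
Proof.
case: d T1 T2 Z => [|d] T1 T2 Z H1 H2 ni; first by rewrite [LHS]flatmx0 [RHS]flatmx0.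
have [h b f] := block_rep_hecke H1 H2; have [q0 q2 kinj] := q_good.
have := average_comm q0 q2 kinj h b f rep_tabs pth_far pth_end rep_perm
  (@block_mx K d.+1 d.+1 d.+1 d.+1 0 Z 0 0) ni.
rewrite /intertwine; set X := average _ _ _ _ _ _.
rewrite -[X](@submxK _ d.+1 d.+1 d.+1 d.+1) => E.
have := congr1 (@ursubmx K d.+1 d.+1 d.+1 d.+1) E.
rewrite /block_rep !mul_block_rep.
by rewrite !block_mxKur !mul0mx !mulmx0 addr0 add0r.
Qed.

Lemma intertwine_id d (T1 T2 : nat -> 'M[K]_d) Z :
  hecke_rep T1 -> hecke_rep T2 ->
  (forall i, (i.+1 < n)%N -> T1 i *m Z = Z *m T2 i) -> intertwine T1 T2 Z = Z.
Proof.
case: d T1 T2 Z => [|d] T1 T2 Z H1 H2 HZ //.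
have [h b f] := block_rep_hecke H1 H2; have [q0 q2 kinj] := q_good.
rewrite /intertwine.
rewrite (average_id q0 q2 kinj h b f rep_tabs pth_far pth_end) ?block_mxKur // => i ni.
rewrite /block_rep !mul_block_rep HZ //.
by rewrite !mul0mx !mulmx0 !addr0 !add0r.
Qed.

Lemma intertwine_sum d (T1 T2 : nat -> 'M[K]_d) (I : finType) (c : I -> K) (Z : I -> 'M[K]_d) :
  intertwine T1 T2 (\sum_i c i *: Z i) = \sum_i c i *: intertwine T1 T2 (Z i).
Proof.
case: d T1 T2 Z => [|d] T1 T2 Z //=.
have blockE (Y : 'M[K]_d.+1) : @block_mx K d.+1 d.+1 d.+1 d.+1 0 Y 0 0 =
    @col_mx K d.+1 d.+1 _ 1%:M 0 *m Y *m @row_mx K _ d.+1 d.+1 0 1%:M.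
  by rewrite mul_col_mx mul_col_row mul1mx mulmx1 !mul0mx mulmx0.
have -> : @block_mx K d.+1 d.+1 d.+1 d.+1 0 (\sum_i c i *: Z i) 0 0 =
    \sum_i c i *: @block_mx K d.+1 d.+1 d.+1 d.+1 0 (Z i) 0 0.
  rewrite blockE mulmx_sumr mulmx_suml; apply: eq_bigr => i _.
  by rewrite blockE -scalemxAr -scalemxAl.
rewrite [average _ _ _ _ _ _](average_sum q n (block_rep T1 T2) rep pth).
apply/matrixP => x y; rewrite summxE 2!mxE summxE.
by apply: eq_bigr => i _; rewrite !mxE.
Qed.

End Intertwiners.

Section TensorMatrices.
Variables (K : fieldType) (I : finType) (k : nat).
Local Notation d := #|{: k.-tuple I}|.

Definition tup (s : 'I_d) : seq I := tval (enum_val s).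

Lemma size_tup s : size (tup s) = k. Proof. by rewrite size_tuple. Qed.

Lemma tupP (w : seq I) : size w = k -> exists s : 'I_d, w = tup s.
Proof.
move=> /eqP sw; exists (enum_rank (Tuple sw)).
by rewrite /tup enum_rankK.
Qed.

Lemma tup_inj : injective tup.
Proof. by move=> s t /val_inj/enum_val_inj. Qed.

Lemma sum_tup_delta (phi : seq I -> K) w : size w = k ->
  \sum_t phi (tup t) * (w == tup t)%:R = phi w.
Proof.
move=> /tupP[s ->]; rewrite (bigD1 s) //= eqxx mulr1 big1 ?addr0 // => t ts.
by rewrite (inj_eq tup_inj) eq_sym (negPf ts) mulr0.
Qed.

Variable rho : I -> I -> I -> I -> K.

Definition lop_mx i : 'M[K]_d :=
  \matrix_(s, t) lop rho i (fun w => (w == tup t)%:R) (tup s).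

Lemma lop_mxE i (phi : seq I -> K) s :
  \sum_t lop_mx i s t * phi (tup t) = lop rho i phi (tup s).
Proof.
under eq_bigr do rewrite mxE mulrC.
rewrite -lop_sum; apply: eq_lop => w; rewrite size_tup => sw.
exact: sum_tup_delta.
Qed.

Lemma hecke_rep_lop_mx q : hecke_kernel (q - q^-1) rho -> braid_kernel rho ->
  hecke_rep q k lop_mx.
Proof.
move=> Hh Hb; split=> [i ni|i ni|i j ij nj]; apply/matrixP => s t.
- rewrite mxE; under eq_bigr => u _ do rewrite [lop_mx i u t]mxE.
  rewrite (lop_mxE i (lop rho i (fun w => (w == tup t)%:R))).
  rewrite (lop_hecke _ Hh) ?size_tup // !mxE (inj_eq tup_inj).
  by [].
- have E a b c s' t' : (lop_mx a *m lop_mx b *m lop_mx c) s' t' =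
    lop rho a (lop rho b (lop rho c (fun w => (w == tup t')%:R))) (tup s').
    rewrite -mulmxA mxE.
    transitivity (\sum_j lop_mx a s' j * lop rho b (lop rho c (fun w => (w == tup t')%:R)) (tup j)).
      apply: eq_bigr => u _; congr (_ * _); rewrite mxE -lop_mxE.
      by apply: eq_bigr => v _; rewrite [lop_mx c v t']mxE.
    by rewrite lop_mxE.
  by rewrite !E (lop_braid _ Hb) ?size_tup.
have E a b s' t' : (lop_mx a *m lop_mx b) s' t' =
    lop rho a (lop rho b (fun w => (w == tup t')%:R)) (tup s').
  rewrite mxE -lop_mxE; apply: eq_bigr => u _.
  by rewrite [lop_mx b u t']mxE.
by rewrite !E lop_far ?size_tup.
Qed.

Lemma hecke_rep_trmx q d' (T : nat -> 'M[K]_d') :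
  hecke_rep q k T -> hecke_rep q k (fun i => (T i)^T).
Proof.
case=> h b f; split=> [i ni|i ni|i j ij nj].
- by rewrite -trmx_mul h // linearD linearZ /= trmx1.
- by rewrite -!trmx_mul !mulmxA b.
- by rewrite -!trmx_mul (f i j).
Qed.

End TensorMatrices.

(** X is invertible. The hypotheses say that F fixes the X-image of the annihilator of the rows of G
    and that its image lies there; so rank F is the dimension of this annihilator, n1 - rank G. *)
Lemma rank_projector (K : fieldType) (n1 n2 g : nat) (X : 'M[K]_(n1, n2))
    (G : 'M[K]_(g, n1)) (F : 'M[K]_n2) :
  n1 = n2 -> row_free X ->
  (forall f : 'rV_n1, f *m G^T = 0 -> f *m X *m F = f *m X) ->
  (forall (f : 'rV_n1) (z : 'rV_n2), z *m F = f *m X -> f *m G^T = 0) ->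
  (\rank F + \rank G)%N = n1.
Proof.
move=> n12 fX H1 H2.
have fullX : row_full X by rewrite /row_full (eqP fX) n12.
have [Y YX] := row_fullP fullX.
have rG : \rank (kermx G^T) = (n1 - \rank G)%N by rewrite mxrank_ker mxrank_tr.
have le1 : (\rank (kermx G^T) <= \rank F)%N.
  rewrite -(mxrankMfree (kermx G^T) fX); apply: mxrankS.
  apply/row_subP => i; rewrite row_mul.
  have /H1 <- : row i (kermx G^T) *m G^T = 0 by rewrite -row_mul mulmx_ker row0.
  exact: submxMl.
have le2 : (\rank F <= \rank (kermx G^T))%N.
  have -> : F = F *m Y *m X by rewrite -mulmxA YX mulmx1.
  rewrite mxrankMfree //; apply: mxrankS; apply/sub_kermxP; apply/row_matrixP => i.
  rewrite row0 row_mul; apply: (H2 _ (delta_mx 0 i)).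
  by rewrite -rowE -row_mul -mulmxA YX mulmx1.
have leG : (\rank G <= n1)%N by apply: rank_leq_col.
by apply/eqP; rewrite -(eqn_sub2rE _ leG) ?leq_addl // addnK eqn_leq -rG le1 le2.
Qed.

Section WordRank.
Variables (K : fieldType) (I : finType) (k : nat) (q : K).
Variables (rep : seq int -> seq int) (pth : seq int -> seq nat).
Variable rho : I -> I -> I -> I -> K.
Local Notation d := #|{: k.-tuple I}|.
Local Notation n1 := #|{: k.-tuple (I * I)}|.

Definition wfun (f : 'rV[K]_n1) (w : seq (I * I)) : K := \sum_t f 0 t * (w == tup t)%:R.

Definition kmx (Z : seq I -> seq I -> K) : 'M[K]_d := \matrix_(s, t) Z (tup s) (tup t).

Definition transform_mx : 'M[K]_(n1, d * d) :=
  \matrix_t mxvec (kmx (transform rho k (fun w => (w == tup t)%:R))).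

Definition intertwine_mx : 'M[K]_(d * d) :=
  \matrix_z mxvec (intertwine q k rep pth (lop_mx k rho)
    (fun i => (lop_mx k (flip_kernel rho) i)^T) (vec_mx (delta_mx 0 z))).

Lemma wfun_tup f t : wfun f (tup t) = f 0 t.
Proof.
rewrite /wfun (bigD1 t) //= eqxx mulr1 big1 ?addr0 // => u ut.
by rewrite (inj_eq (@tup_inj _ _)) eq_sym (negPf ut) mulr0.
Qed.

Lemma mul_transform_mx f : f *m transform_mx = mxvec (kmx (transform rho k (wfun f))).
Proof.
apply/rowP => j; case/mxvec_indexP: j => s t; rewrite mxvecE !mxE transform_sum.
by apply: eq_bigr => u _; rewrite mxE mxvecE mxE.
Qed.

Lemma mul_intertwine_mx z : z *m intertwine_mx =
  mxvec (intertwine q k rep pth (lop_mx k rho)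
    (fun i => (lop_mx k (flip_kernel rho) i)^T) (vec_mx z)).
Proof.
rewrite [in RHS](row_sum_delta z) linear_sum /=.
under [in RHS]eq_bigr do rewrite linearZ /=.
rewrite intertwine_sum mulmx_sum_row linear_sum /=.
by apply: eq_bigr => i _; rewrite rowK linearZ.
Qed.

Lemma twisted_commute_mx Z : twisted_commute rho k Z <->
  forall i, (i.+1 < k)%N ->
    lop_mx k rho i *m kmx Z = kmx Z *m (lop_mx k (flip_kernel rho) i)^T.
Proof.
have L i s t : (lop_mx k rho i *m kmx Z) s t = lop rho i (fun s' => Z s' (tup t)) (tup s).
  rewrite mxE -lop_mxE; apply: eq_bigr => u _.
  by rewrite [kmx Z u t]mxE.
have Rr i s t : (kmx Z *m (lop_mx k (flip_kernel rho) i)^T) s t =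
    lop (flip_kernel rho) i (Z (tup s)) (tup t).
  rewrite mxE -lop_mxE; apply: eq_bigr => u _.
  by rewrite mulrC mxE [kmx Z s u]mxE.
split=> H i.
  by move=> ik; apply/matrixP => s t; rewrite L Rr H ?size_tup.
by move=> s t ik /tupP[s' ->] /tupP[t' ->]; rewrite -L -Rr H.
Qed.

Hypothesis q_good : good k q.
Hypothesis rep_tabs : {in tabs k k, forall a, rep a \in tabs k k}.
Hypothesis pth_far : {in tabs k k, forall a, far_path (rep a) (pth a)}.
Hypothesis pth_end : {in tabs k k, forall a, path_end (rep a) (pth a) = a}.
Hypothesis rep_perm : {in tabs k k &, forall a b, perm_eq a b -> rep a = rep b}.
Hypothesis rho_braid : braid_kernel rho.
Hypothesis flip_braid : braid_kernel (flip_kernel rho).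
Hypothesis rho_hecke : hecke_kernel (q - q^-1) rho.
Hypothesis flip_hecke : hecke_kernel (q - q^-1) (flip_kernel rho).
Hypothesis rho_skew : forall Y : I -> I -> K,
  (forall y b, \sum_(p : I * I) rho p.1 y p.2 b * Y p.1 p.2 = 0) -> forall x a, Y x a = 0.

Lemma rank_intertwine_mx g (G : 'M[K]_(g, n1)) :
  (forall f : 'rV_n1, f *m G^T = 0 <-> annihilates rho k (wfun f)) ->
  (\rank intertwine_mx + \rank G)%N = n1.
Proof.
move=> GP.
have H1 : hecke_rep q k (lop_mx k rho) by apply: hecke_rep_lop_mx.
have H2 : hecke_rep q k (fun i => (lop_mx k (flip_kernel rho) i)^T).
  by apply: hecke_rep_trmx; apply: hecke_rep_lop_mx.
apply: (@rank_projector _ _ _ _ transform_mx).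
(* A word of k index pairs amounts to two words of k indices; the dimensions agree, so the injective
   transform is bijective. *)
- by rewrite !card_tuple card_prod expnMn.
- apply: inj_row_free => f; rewrite mul_transform_mx => /eqP; rewrite mxvec_eq0 => /eqP E.
  apply/rowP => t; rewrite mxE -wfun_tup.
  apply: (@transform_inj _ _ rho rho_skew k); last exact: size_tup.
  move=> s' t' /tupP[s ->] /tupP[u ->]; move/matrixP/(_ s u): E.
  by rewrite !mxE.
- move=> f /GP /(transform_commute rho_braid rho_skew) /twisted_commute_mx E.
  rewrite mul_transform_mx mul_intertwine_mx mxvecK.
  by rewrite intertwine_id.
move=> f z; rewrite mul_transform_mx mul_intertwine_mx => /(can_inj mxvecK) E.
apply/GP/(transform_commute rho_braid rho_skew)/twisted_commute_mx => i ik.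
rewrite -E; exact: (intertwine_comm q_good rep_tabs pth_far pth_end rep_perm).
Qed.

End WordRank.

(** * Relations in the free algebra *)

Section Words.
Variables (K : fieldType) (N : nat).
Local Notation L := ('I_N * 'I_N)%type.
Local Notation FA := (freealg K N).

(* Locked: otherwise failed unification unfolds the product of [freealg]. *)
Fact mono_key : unit. Proof. exact: tt. Qed.
Definition mono (s : seq L) : FA := locked_with mono_key (mkmalgU (FMonom s) 1).

Lemma monoE s : mono s = mkmalgU (FMonom s) 1.
Proof. by rewrite /mono unlock. Qed.

Definition cf (x : FA) (s : seq L) : K := mcoeff (FMonom s) x.

Lemma cf_word x (w : word N) : mcoeff w x = cf x w.
Proof. by rewrite /cf fmK. Qed.

Lemma cf_inj x y : cf x =1 cf y -> x = y.
Proof. by move=> E; apply/malgP => w; rewrite !cf_word. Qed.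

Lemma cf0 s : cf 0 s = 0. Proof. exact: mcoeff0. Qed.

Lemma cfD x y s : cf (x + y) s = cf x s + cf y s.
Proof. exact: mcoeffD. Qed.

Lemma cfN x s : cf (- x) s = - cf x s.
Proof. exact: mcoeffN. Qed.

Lemma cfZ (c : K) x s : cf (c *: x) s = c * cf x s.
Proof. exact: mcoeffZ. Qed.

Lemma cf_sum (I : Type) (r : seq I) (P : pred I) (F : I -> FA) s :
  cf (\sum_(i <- r | P i) F i) s = \sum_(i <- r | P i) cf (F i) s.
Proof.
elim/big_rec2: _ => [|i y x _ <-]; first exact: cf0.
exact: cfD.
Qed.

Lemma cf_mono s t : cf (mono s) t = (s == t)%:R.
Proof. by rewrite /cf monoE mcoeffU. Qed.

Lemma monoM s t : mono s * mono t = mono (s ++ t).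
Proof.
rewrite !monoE.
transitivity (fgmul (mkmalgU (FMonom s) (1 : K)) (mkmalgU (FMonom t) 1)); first by [].
by rewrite fgmulUU mulr1 /mmul /= fmmulE.
Qed.

Lemma mono_nil : mono [::] = 1.
Proof. by rewrite monoE -fmoneE. Qed.

Lemma letterE i j : letter K i j = mono [:: (i, j)].
Proof. by rewrite monoE /letter fmuE. Qed.

Lemma freealgE (x : FA) :
  x = \sum_(w <- finmap.enum_fset (msupp x)) cf x (fmonom_val w) *: mono (fmonom_val w).
Proof.
apply/malgP => w; rewrite !cf_word cf_sum -[LHS]cf_word [in LHS](monalgE x).
rewrite (@raddf_sum _ _ (mcoeff w)); apply: eq_bigr => v _.
rewrite [LHS]/= cfZ cf_mono mcoeffU -cf_word mulr_natr; congr (_ *+ _).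
Qed.

Lemma freealg_ind (P : FA -> Prop) :
  (forall s, P (mono s)) -> (forall (c : K) x y, P x -> P y -> P (c *: x + y)) -> P 0 ->
  forall x, P x.
Proof.
move=> Pm PD P0 x; rewrite [x]freealgE; elim/big_rec: _ => // w y _ Py.
exact: PD.
Qed.

Section Lin.
Variables (V : lmodType K) (h : seq L -> V).

(** The linear extension of a function on words; when h is multiplicative it is the universal
    property of the free algebra ([wlin_mul]). *)
Definition wlin (x : FA) : V :=
  \sum_(w <- finmap.enum_fset (msupp x)) cf x (fmonom_val w) *: h (fmonom_val w).

Lemma wlinEw (d : seq (word N)) x : uniq d ->
  (forall w, cf x (fmonom_val w) != 0 -> w \in d) ->
  wlin x = \sum_(w <- d) cf x (fmonom_val w) *: h (fmonom_val w).
Proof.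
move=> ud dP; rewrite /wlin.
have wz w : (w \in finmap.enum_fset (msupp x)) = (cf x (fmonom_val w) != 0).
  by rewrite -cf_word mcoeff_neq0.
rewrite [RHS](bigID (fun w => w \in finmap.enum_fset (msupp x))) /=.
rewrite [X in _ + X]big1 ?addr0; last first.
  by move=> w; rewrite wz negbK => /eqP->; rewrite scale0r.
rewrite -[RHS]big_filter; apply: perm_big; apply: uniq_perm.
- exact: finmap.fset_uniq.
- by rewrite filter_uniq.
move=> w; rewrite mem_filter wz; case: (eqVneq (cf x (fmonom_val w)) 0) => //= H.
by apply/esym/dP.
Qed.

Lemma wlin_is_linear : linear wlin.
Proof.
move=> c x y; pose d := undup (finmap.enum_fset (msupp x) ++ finmap.enum_fset (msupp y)).
have dP z : (forall w, cf z (fmonom_val w) != 0 -> cf x (fmonom_val w) != 0 \/ cf y (fmonom_val w) != 0) ->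
    wlin z = \sum_(w <- d) cf z (fmonom_val w) *: h (fmonom_val w).
  move=> H; apply: wlinEw; first exact: undup_uniq.
  move=> w /H; rewrite mem_undup mem_cat -!cf_word !mcoeff_neq0.
  by case=> ->; rewrite ?orbT.
rewrite !dP; try by move=> w ?; first [by left | by right].
  rewrite scaler_sumr -big_split; apply: eq_bigr => w _.
  by rewrite cfD cfZ scalerDl scalerA.
move=> w; rewrite cfD cfZ; have [->|] := eqVneq (cf x (fmonom_val w)) 0; last by left.
by rewrite mulr0 add0r; right.
Qed.

HB.instance Definition _ := GRing.isLinear.Build K FA V *:%R wlin wlin_is_linear.

Lemma wlinP (c : K) x y : wlin (c *: x + y) = c *: wlin x + wlin y.
Proof. exact: wlin_is_linear. Qed.

Lemma wlin_mono s : wlin (mono s) = h s.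
Proof.
rewrite (@wlinEw [:: FMonom s]) //.
  by rewrite big_seq1 cf_mono eqxx scale1r.
move=> w; rewrite cf_mono inE; have [sw _|_] := eqVneq s (fmonom_val w).
  by rewrite sw fmK.
by rewrite eqxx.
Qed.

End Lin.

Lemma wlin_mul (B : algType K) (h : seq L -> B) : h [::] = 1 ->
  (forall s t, h (s ++ t) = h s * h t) ->
  forall x y, wlin h (x * y) = wlin h x * wlin h y.
Proof.
move=> h1 hM; apply: freealg_ind => [s|c x x' Hx Hx' y|y].
- apply: freealg_ind => [t|c y y' Hy Hy'|].
  + by rewrite monoM !wlin_mono hM.
  + rewrite mulrDr -scalerAr 2!(wlinP h) mulrDr -scalerAr.
    by congr (_ *: _ + _); [exact: Hy|exact: Hy'].
  + by rewrite mulr0 !(linear0 (wlin h)) mulr0.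
- rewrite mulrDl -scalerAl 2!(wlinP h) mulrDl -scalerAl.
  by congr (_ *: _ + _); [exact: Hx|exact: Hx'].
by rewrite mul0r !(linear0 (wlin h)) mul0r.
Qed.

Lemma of_degree_leP n (x : FA) : of_degree_le n x <-> forall s, cf x s != 0 -> (size s <= n)%N.
Proof.
split=> H; last by move=> w; rewrite cf_word => /H.
by move=> s /(H (FMonom s)); rewrite /fdeg.
Qed.

Lemma of_degreeP n (x : FA) : of_degree n x <-> forall s, cf x s != 0 -> size s = n.
Proof.
split=> H; last by move=> w; rewrite cf_word => /H.
by move=> s /(H (FMonom s)); rewrite /fdeg.
Qed.

Lemma of_degree_le0 n : of_degree_le n (0 : FA).
Proof. by apply/of_degree_leP => s; rewrite cf0 eqxx. Qed.

Lemma of_degree_leD n (c : K) (x y : FA) : of_degree_le n x -> of_degree_le n y -> of_degree_le n (c *: x + y).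
Proof.
move=> /of_degree_leP Hx /of_degree_leP Hy; apply/of_degree_leP => s; rewrite cfD cfZ.
by have [->|/Hx//] := eqVneq (cf x s) 0; rewrite mulr0 add0r; apply: Hy.
Qed.

Lemma of_degree0 n : of_degree n (0 : FA).
Proof. by apply/of_degreeP => s; rewrite cf0 eqxx. Qed.

Lemma of_degreeD n (c : K) (x y : FA) : of_degree n x -> of_degree n y -> of_degree n (c *: x + y).
Proof.
move=> /of_degreeP Hx /of_degreeP Hy; apply/of_degreeP => s; rewrite cfD cfZ.
by have [->|/Hx//] := eqVneq (cf x s) 0; rewrite mulr0 add0r; apply: Hy.
Qed.

Lemma of_degree_mono s : of_degree (size s) (mono s).
Proof. by apply/of_degreeP => t; rewrite cf_mono; have [->|] := eqVneq s t; rewrite ?eqxx. Qed.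

Lemma of_degree_le_mono s : of_degree_le (size s) (mono s).
Proof. by apply/of_degree_leP => t; rewrite cf_mono; have [->|] := eqVneq s t; rewrite ?eqxx. Qed.

Lemma of_degree_leS m n (x : FA) : (m <= n)%N -> of_degree_le m x -> of_degree_le n x.
Proof. by move=> mn H w /H /leq_trans; apply. Qed.

Lemma of_degree_le_of n (x : FA) : of_degree n x -> of_degree_le n x.
Proof. by move=> H w /H ->. Qed.

Lemma of_degree_le_ex (x : FA) : exists n, of_degree_le n x.
Proof.
elim/freealg_ind: x => [s|c x y [n Hx] [m Hy]|].
- by exists (size s); apply: of_degree_le_mono.
- exists (maxn n m); apply: of_degree_leD.
    exact: of_degree_leS (leq_maxl _ _) Hx.
  exact: of_degree_leS (leq_maxr _ _) Hy.
by exists 0%N; apply: of_degree_le0.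
Qed.

Definition hc (k : nat) : FA -> FA := wlin (fun s => if size s == k then mono s else 0).

Lemma cf_hc k x s : cf (hc k x) s = if size s == k then cf x s else 0.
Proof.
elim/freealg_ind: x => [t|c x y Hx Hy|].
- rewrite /hc wlin_mono; case: (eqVneq s t) => [->|st].
    by case: ifP; rewrite ?cf0.
  by case: ifP => _; case: ifP => _; rewrite ?cf0 // cf_mono eq_sym (negPf st).
- rewrite [hc k _]wlinP cfD cfZ cfD cfZ.
  rewrite -[wlin _ x]/(hc k x) -[wlin _ y]/(hc k y); move: Hx Hy.
  case: ifP => _ Ex Ey; first by congr (_ * _ + _); [exact: Ex|exact: Ey].
  by rewrite [X in c * X]Ex [X in _ + X]Ey mulr0 addr0.
by rewrite /hc (linear0 (wlin _)) cf0 if_same.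
Qed.

Lemma of_degree_hc k x : of_degree k (hc k x).
Proof. by apply/of_degreeP => s; rewrite cf_hc; have [//|_] := eqVneq (size s) k; rewrite eqxx. Qed.

Lemma hc_id k x : of_degree k x -> hc k x = x.
Proof.
move=> /of_degreeP H; apply: cf_inj => s; rewrite cf_hc; case: eqP => // sk.
by apply/esym/eqP; apply: contraTT isT => /H.
Qed.

Lemma hc_neq j k x : of_degree j x -> j != k -> hc k x = 0.
Proof.
move=> /of_degreeP H jk; apply: cf_inj => s; rewrite cf_hc cf0; case: eqP => // sk.
by apply/eqP; apply: contraTT isT => /H; rewrite sk => kj; rewrite kj eqxx in jk.
Qed.

Lemma hc_le n k x : of_degree_le n x -> (n < k)%N -> hc k x = 0.
Proof.
move=> /of_degree_leP H nk; apply: cf_inj => s; rewrite cf_hc cf0; case: eqP => // sk.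
by apply/eqP; apply: contraTT isT => /H; rewrite sk leqNgt nk.
Qed.

Lemma sum_hc n x : of_degree_le n x -> x = \sum_(k < n.+1) hc k x.
Proof.
move=> /of_degree_leP H; apply: cf_inj => s; rewrite cf_sum.
under eq_bigr do rewrite cf_hc.
have [sn|sn] := leqP (size s) n.
  rewrite (bigD1 (Ordinal (sn : size s < n.+1)%N)) //= eqxx big1 ?addr0 // => k ks.
  by case: eqP => // E; case/eqP: ks; apply: val_inj.
rewrite big1; last by move=> k _; case: eqP => // E; move: (ltn_ord k); rewrite -E ltnS leqNgt sn.
by apply/eqP; apply: contraTT isT => /H; rewrite leqNgt sn.
Qed.

End Words.

Lemma mulDZl (K : fieldType) (A : algType K) (c : K) (x y a b : A) :
  (c *: x + y) * a * b = c *: (x * a * b) + y * a * b.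
Proof. by rewrite !mulrDl -!scalerAl. Qed.

Section Relations.
Variables (K : fieldType) (N : nat).
Local Notation L := ('I_N * 'I_N)%type.
Local Notation FA := (freealg K N).
Local Notation I4 := ('I_N * 'I_N * 'I_N * 'I_N)%type.

Lemma wlin_sandwich (V : lmodType K) (h : seq L -> V) u v x :
  wlin h (mono K u * x * mono K v) = wlin (fun w => h (u ++ w ++ v)) x.
Proof.
elim/freealg_ind: x => [s|c x y Hx Hy|].
- by rewrite !monoM !wlin_mono catA.
- rewrite mulrDr mulrDl -scalerAr -scalerAl [RHS]wlinP [LHS]wlinP.
  by congr (_ *: _ + _); [exact: Hx|exact: Hy].
by rewrite mulr0 mul0r (linear0 (wlin h)) (linear0 (wlin _)).
Qed.

Lemma cf_wlin (x : FA) s : cf x s = wlin (fun w : seq L => (w == s)%:R : K^o) x.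
Proof.
elim/freealg_ind: x => [t|c x y Hx Hy|].
- by rewrite wlin_mono cf_mono.
- by rewrite cfD cfZ wlinP; congr (_ * _ + _); [exact: Hx|exact: Hy].
by rewrite cf0 (linear0 (wlin _)).
Qed.

Lemma wlin_wfun k (f : 'rV[K]_#|{: k.-tuple L}|) x :
  wlin (wfun f : seq L -> K^o) x = \sum_t f 0 t * cf x (tup t).
Proof.
elim/freealg_ind: x => [s|c x y Hx Hy|].
- by rewrite wlin_mono; apply: eq_bigr => t _; rewrite cf_mono.
- rewrite wlinP; transitivity (c * (\sum_t f 0 t * cf x (tup t)) + \sum_t f 0 t * cf y (tup t)).
    by congr (_ * _ + _); [exact: Hx|exact: Hy].
  rewrite mulr_sumr -big_split; apply: eq_bigr => t _ /=.
  by rewrite cfD cfZ mulrDr mulrCA.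
rewrite (linear0 (wlin _)) big1 // => t _; by rewrite cf0 mulr0.
Qed.

Lemma wlin_mono_id (x : FA) : wlin (fun w => mono K w) x = x.
Proof. by rewrite /wlin -freealgE. Qed.

Variable R : 'M[K]_(N * N).

Lemma wlin_rel (V : lmodType K) (h : seq L -> V) hbar i j r s :
  wlin h (mrea_rel R hbar (i, j, r, s)) =
  \sum_k \sum_l \sum_m \sum_p
    (coef R k l i j * coef R p s m l) *: h [:: (k, m); (p, r)]
  - \sum_a \sum_b \sum_c \sum_d
    (coef R b c a j * coef R r s d c) *: h [:: (i, a); (b, d)]
  - hbar *: (\sum_a coef R a s i j *: h [:: (a, r)]
             - \sum_b coef R r s b j *: h [:: (i, b)]).
Proof.
have lD x y : wlin h (x - y) = wlin h x - wlin h y by rewrite (linearB (wlin h)).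
have lZ c x : wlin h (c *: x) = c *: wlin h x by rewrite (linearZZ (wlin h)).
have lS (F : 'I_N -> FA) : wlin h (\sum_i F i) = \sum_i wlin h (F i).
  by rewrite (linear_sum (wlin h)).
have lm a b : wlin h (letter K a.1 a.2 * letter K b.1 b.2) = h [:: a; b].
  by rewrite !letterE monoM wlin_mono -!surjective_pairing.
have l1 a : wlin h (letter K a.1 a.2) = h [:: a].
  by rewrite letterE wlin_mono -surjective_pairing.
rewrite /mrea_rel lD lD; congr (_ - _ - _).
- rewrite lS; apply: eq_bigr => k _; rewrite lS; apply: eq_bigr => l _.
  rewrite lS; apply: eq_bigr => m _; rewrite lS; apply: eq_bigr => p _.
  by rewrite lZ; congr (_ *: _); apply: (lm (k, m) (p, r)).
- rewrite lS; apply: eq_bigr => k _; rewrite lS; apply: eq_bigr => l _.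
  rewrite lS; apply: eq_bigr => m _; rewrite lS; apply: eq_bigr => p _.
  by rewrite lZ; congr (_ *: _); apply: (lm (i, k) (l, p)).
rewrite lZ.
rewrite lD.
congr (_ *: (_ - _)).
  rewrite lS.
  apply: eq_bigr => a _.
  rewrite lZ.
  congr (_ *: _).
  exact: (l1 (a, r)).
rewrite lS; apply: eq_bigr => a _; rewrite lZ; congr (_ *: _).
exact: (l1 (i, a)).
Qed.

Lemma wlin_rel0 (h : seq L -> K^o) i j r s :
  wlin h (mrea_rel R 0 (i, j, r, s)) =
  rel_form (rkernel R) (fun a b => h [:: a; b]) i j r s.
Proof.
rewrite wlin_rel scale0r subr0 /rel_form; congr (_ - _).
  rewrite act2E; apply: eq_bigr => k _; apply: eq_bigr => l _.
  rewrite mulr_sumr; apply: eq_bigr => m _; rewrite mulr_sumr; apply: eq_bigr => p _.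
  exact/esym/mulrA.
apply: eq_bigr => a _; rewrite act2E; apply: eq_bigr => b _; apply: eq_bigr => c _.
rewrite mulr_sumr; apply: eq_bigr => d _.
exact/esym/mulrA.
Qed.

Definition rel_lin (t : I4) : FA := let: (i, j, r, s) := t in
  \sum_a coef R a s i j *: mono K [:: (a, r)] - \sum_b coef R r s b j *: mono K [:: (i, b)].

Lemma mrea_rel_split hbar t : mrea_rel R hbar t = mrea_rel R 0 t - hbar *: rel_lin t.
Proof.
case: t => [[[i j] r] s].
have E hb := etrans (esym (wlin_mono_id _)) (wlin_rel (@mono K N) hb i j r s).
by rewrite [LHS]E [mrea_rel R 0 _]E scale0r subr0.
Qed.

Lemma of_degree_sum n (I : Type) (r : seq I) (P : pred I) (F : I -> FA) :
  (forall i, P i -> of_degree n (F i)) -> of_degree n (\sum_(i <- r | P i) F i).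
Proof.
move=> H; elim/big_rec: _ => [|i y Pi Hy]; first exact: of_degree0.
by rewrite -[F i]scale1r; apply: of_degreeD => //; apply: H.
Qed.

Lemma of_degreeZ n (c : K) (x : FA) : of_degree n x -> of_degree n (c *: x).
Proof. by move=> H; rewrite -[_ *: x]addr0; apply: of_degreeD => //; exact: of_degree0. Qed.

Lemma of_degreeN n (x : FA) : of_degree n x -> of_degree n (- x).
Proof. by rewrite -scaleN1r; apply: of_degreeZ. Qed.

Lemma of_degreeB n (x y : FA) : of_degree n x -> of_degree n y -> of_degree n (x - y).
Proof. by move=> Hx Hy; rewrite -[x]scale1r; apply: of_degreeD => //; apply: of_degreeN. Qed.

Lemma of_degree_rel0 t : of_degree 2 (mrea_rel R 0 t).
Proof.
case: t => [[[i j] r] s].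
rewrite (etrans (esym (wlin_mono_id _)) (wlin_rel (@mono K N) 0 i j r s)) scale0r subr0.
by apply: of_degreeB; do 4![apply: of_degree_sum => ? _]; apply: of_degreeZ; apply: of_degree_mono.
Qed.

Lemma of_degree_rel_lin t : of_degree 1 (rel_lin t).
Proof.
case: t => [[[i j] r] s]; rewrite /rel_lin.
by apply: of_degreeB; apply: of_degree_sum => ? _; apply: of_degreeZ; apply: of_degree_mono.
Qed.

Lemma of_degree_sandwich n u v (x : FA) : of_degree n x ->
  of_degree (size u + n + size v) (mono K u * x * mono K v).
Proof.
move=> Hx; rewrite -[x]wlin_mono_id /wlin mulr_sumr mulr_suml.
apply: of_degree_sum => w _; rewrite -scalerAr -scalerAl !monoM.
have [->|] := eqVneq (cf x (fmonom_val w)) 0; first by rewrite scale0r; apply: of_degree0.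
move/of_degreeP: Hx => /[apply] E; apply: of_degreeZ.
by rewrite -E -!size_cat; apply: of_degree_mono.
Qed.

Lemma of_degree_le_rel hbar t : of_degree_le 2 (mrea_rel R hbar t).
Proof.
rewrite mrea_rel_split addrC -scaleNr; apply: of_degree_leD.
  by apply: (@of_degree_leS _ _ 1) => //; apply: of_degree_le_of; apply: of_degree_rel_lin.
by apply: of_degree_le_of; apply: of_degree_rel0.
Qed.

Lemma of_degree_le_gen hbar u v t m : ((size u + size v).+2 <= m)%N ->
  of_degree_le m (mono K u * mrea_rel R hbar t * mono K v).
Proof.
move=> H; apply: (of_degree_leS H).
have -> : (size u + size v).+2 = (size u + 2 + size v)%N by lia.
apply: (@of_degree_leM K N (size u + 2) (size v)); last exact: of_degree_le_mono.
apply: (@of_degree_leM K N (size u) 2); first exact: of_degree_le_mono.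
exact: of_degree_le_rel.
Qed.

Section Coordinates.
Variable m : nat.
Local Notation B := {: m.-bseq L}.

Definition bs (s : 'I_#|B|) : seq L := bseqval (enum_val s).

Lemma size_bs s : (size (bs s) <= m)%N. Proof. exact: size_bseq. Qed.

Lemma bsP (w : seq L) : (size w <= m)%N -> exists s, w = bs s.
Proof. by move=> sw; exists (enum_rank (Bseq sw)); rewrite /bs enum_rankK. Qed.

Lemma bs_inj : injective bs.
Proof. by move=> s t /val_inj/enum_val_inj. Qed.

Definition coords (x : FA) : 'rV[K]_#|B| := \row_s cf x (bs s).

Definition uncoords (z : 'rV[K]_#|B|) : FA := \sum_s z 0 s *: mono K (bs s).

Lemma coordsD (c : K) x y : coords (c *: x + y) = c *: coords x + coords y.
Proof. by apply/rowP => s; rewrite !mxE cfD cfZ. Qed.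

Lemma coords0 : coords 0 = 0.
Proof. by apply/rowP => s; rewrite !mxE cf0. Qed.

Lemma coords_sum (I : finType) (c : I -> K) (F : I -> FA) :
  coords (\sum_i c i *: F i) = \sum_i c i *: coords (F i).
Proof.
apply/rowP => s; rewrite mxE cf_sum summxE; apply: eq_bigr => i _.
by rewrite cfZ !mxE.
Qed.

Lemma coordsK x : of_degree_le m x -> uncoords (coords x) = x.
Proof.
move=> /of_degree_leP H; apply: cf_inj => w; rewrite cf_sum.
have [/bsP[s ->]|sw] := leqP (size w) m.
  rewrite (bigD1 s) //= [X in _ + X]big1 => [|t ts].
    by rewrite cfZ cf_mono eqxx mulr1 mxE addr0.
  by rewrite cfZ cf_mono (inj_eq bs_inj) (negPf ts) mulr0.
have -> : cf x w = 0 by apply/eqP; apply: contraTT sw => /H; rewrite -leqNgt.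
rewrite big1 // => t _; rewrite cfZ cf_mono; case: eqVneq => [E|_]; last by rewrite mulr0.
by move: sw; rewrite -E ltnNge size_bs.
Qed.

(** Index set of the products word, relation, word. The total degree is not part of the type:
    [genrow] is zero where it exceeds m, so that the index set is a plain product of finite
    types. *)
Definition rows := (m.-bseq L * m.-bseq L * I4)%type.

Variable hbar : K.

(* Opaque for the same reason as [mono]. *)
Fact genrow_subproof : {g : rows -> FA | forall e,
  g e = if ((size e.1.1 + size e.1.2).+2 <= m)%N
        then mono K e.1.1 * mrea_rel R hbar e.2 * mono K e.1.2 else 0}.
Proof. by eexists. Qed.
Definition genrow : rows -> FA := sval genrow_subproof.

Lemma genrowE e : genrow e = if ((size e.1.1 + size e.1.2).+2 <= m)%N
  then mono K e.1.1 * mrea_rel R hbar e.2 * mono K e.1.2 else 0.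
Proof. exact: (svalP genrow_subproof). Qed.

(** Its row space is J_m(hbar). A priori this is smaller than the part of the ideal in degree at
    most m, since cancellations from higher degrees may occur; the PBW property is about this
    difference. *)
Definition rel_mx : 'M[K]_(#|{: rows}|, #|B|) :=
  \matrix_(e, s) cf (genrow (enum_val e)) (bs s).

Lemma of_degree_le_genrow e : of_degree_le m (genrow e).
Proof.
rewrite genrowE; case: ifP => H; first exact: of_degree_le_gen.
exact: of_degree_le0.
Qed.

Lemma row_rel_mx e : row e rel_mx = coords (genrow (enum_val e)).
Proof. by apply/rowP => s; rewrite !mxE. Qed.

Lemma mul_rel_mx z : z *m rel_mx = coords (\sum_e z 0 e *: genrow (enum_val e)).
Proof. by rewrite mulmx_sum_row coords_sum; apply: eq_bigr => e _; rewrite row_rel_mx. Qed.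

Lemma genrow_ideal e : mrea_ideal R hbar (genrow e).
Proof.
rewrite genrowE; case: ifP => _; last by apply: (gen_ideal_zmod _).1.
by apply: gen_ideal_mulr; apply: gen_ideal_mull; apply/asboolP; exists [:: (1, e.2, 1)];
  rewrite big_seq1 mul1r mulr1.
Qed.

Lemma idealD (c : K) x y : mrea_ideal R hbar x -> mrea_ideal R hbar y -> mrea_ideal R hbar (c *: x + y).
Proof.
move=> Hx Hy.
rewrite -[y]opprK; apply: (gen_ideal_zmod _).2.
  by rewrite -mul_malgC; apply: gen_ideal_mull.
by rewrite -sub0r; apply: (gen_ideal_zmod _).2 => //; apply: (gen_ideal_zmod _).1.
Qed.

Lemma gen_coords u v t : ((size u + size v).+2 <= m)%N ->
  (coords (mono K u * mrea_rel R hbar t * mono K v)%R <= rel_mx)%MS.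
Proof.
move=> H.
have Hu : (size u <= m)%N by lia.
have Hv : (size v <= m)%N by lia.
have := row_sub (enum_rank ((Bseq Hu, Bseq Hv, t) : rows)) rel_mx.
by rewrite row_rel_mx enum_rankK genrowE /= H.
Qed.

End Coordinates.

Lemma mrea_ideal_ind hbar (P : FA -> Prop) : P 0 ->
  (forall (c : K) x y, P x -> P y -> P (c *: x + y)) ->
  (forall u v t, P (mono K u * mrea_rel R hbar t * mono K v)) ->
  forall x, mrea_ideal R hbar x -> P x.
Proof.
move=> P0 PD Pg x /asboolP[s ->].
have Pu u t b : P (mono K u * mrea_rel R hbar t * b).
  elim/freealg_ind: b => [v|c y z Hy Hz|]; last by rewrite mulr0.
    exact: Pg.
  by rewrite mulrDr -scalerAr; exact: (PD c _ _ Hy Hz).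
have Pt a t b : P (a * mrea_rel R hbar t * b).
  elim/freealg_ind: a => [u|c y z Hy Hz|]; last by rewrite mul0r mul0r.
    exact: Pu.
  by rewrite mulDZl; exact: (PD c _ _ Hy Hz).
elim: s => [|e s IH]; first by rewrite big_nil.
by rewrite big_cons -[X in X + _]scale1r; exact: (PD 1 _ _ (Pt _ _ _) IH).
Qed.

(** The threshold m0 is the degree of a presentation of x by relations and may exceed the degree of
    x. *)
Lemma ideal_coords hbar x : mrea_ideal R hbar x -> exists m0, forall m, (m0 <= m)%N ->
  of_degree_le m x /\ (coords m x <= rel_mx m hbar)%MS.
Proof.
move: x; apply: mrea_ideal_ind.
- by exists 0%N => m _; split; [exact: of_degree_le0|rewrite coords0 sub0mx].
- move=> c y z [m1 H1] [m2 H2]; exists (maxn m1 m2) => m.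
  rewrite geq_max => /andP[/H1[H3 H4] /H2[H5 H6]].
  split; first exact: of_degree_leD.
  by rewrite coordsD addmx_sub // scalemx_sub.
move=> u v t; exists (size u + size v).+2 => m Hm; split; first exact: of_degree_le_gen.
exact: gen_coords.
Qed.

Section Homogeneous.
Variables k m : nat.
Local Notation n1 := #|{: k.-tuple L}|.

Definition hcoords (x : FA) : 'rV[K]_n1 := \row_t cf x (tup t).

Definition sel : 'M[K]_(#|{: m.-bseq L}|, n1) := \matrix_(s, t) (bs s == tup t)%:R.

Hypothesis km : (k <= m)%N.

Lemma mul_sel x : coords m x *m sel = hcoords x.
Proof.
apply/rowP => t; rewrite !mxE.
have /bsP[s E] : (size (tup t) <= m)%N by rewrite size_tup.
rewrite E (bigD1 s) //= !mxE E eqxx mulr1 big1 ?addr0 // => u us.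
by rewrite !mxE E (inj_eq (@bs_inj _)) (negPf us) mulr0.
Qed.

(** Since [wfun f] vanishes on words of length other than k, rows of another degree impose no
    condition, and any m >= k gives the same annihilator. *)
Lemma annihilates_rel f : f *m (rel_mx m 0 *m sel)^T = 0 <->
  annihilates (rkernel R) k (wfun f).
Proof.
have E e : (f *m (rel_mx m 0 *m sel)^T) 0 e = wlin (wfun f : seq L -> K^o) (genrow 0 (enum_val e)).
  rewrite wlin_wfun mxE; apply: eq_bigr => t _; congr (_ * _).
  have -> : (rel_mx m 0 *m sel)^T t e = (row e (rel_mx m 0) *m sel) 0 t.
    by rewrite -row_mul !mxE.
  by rewrite row_rel_mx mul_sel mxE.
have G u v i j r s : wlin (wfun f : seq L -> K^o) (mono K u * mrea_rel R 0 (i, j, r, s) * mono K v) =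
    rel_form (rkernel R) (fun a b => wfun f (u ++ [:: a, b & v])) i j r s.
  by rewrite wlin_sandwich wlin_rel0.
have W w : size w != k -> wfun f w = 0.
  move=> sw; apply: big1 => t _; case: eqVneq => [wt|_]; last by rewrite mulr0.
  by rewrite wt size_tup eqxx in sw.
split=> H.
  move=> u v i j r s suv; rewrite -G.
  have Hu : (size u <= m)%N by lia.
  have Hv : (size v <= m)%N by lia.
  move/rowP/(_ (enum_rank ((Bseq Hu, Bseq Hv, (i, j, r, s)) : rows m))): H.
  by rewrite E mxE enum_rankK genrowE /= suv km.
apply/rowP => e; rewrite E mxE genrowE; case: ifP => [suv|_]; last by rewrite (linear0 (wlin _)).
case: (enum_val e).2 => -[[i j] r] s; rewrite G.
have [|sk] := eqVneq (size (enum_val e).1.1 + size (enum_val e).1.2).+2 k; first exact: H.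
rewrite rel_formE big1 // => x _.
by rewrite W ?mulr0 // size_cat /= !addnS.
Qed.

End Homogeneous.
End Relations.

(** * Homogeneous components and leading parts *)

Section Components.
Variables (K : fieldType) (N : nat) (R : 'M[K]_(N * N)).
Local Notation L := ('I_N * 'I_N)%type.
Local Notation FA := (freealg K N).

Lemma ideal0 hbar : mrea_ideal R hbar 0.
Proof. by apply: (gen_ideal_zmod _).1. Qed.

Lemma hcP k (c : K) (x y : FA) : hc k (c *: x + y) = c *: hc k x + hc k y.
Proof. exact: wlinP. Qed.

Lemma hc0 k : hc k (0 : FA) = 0.
Proof. exact: (linear0 (wlin _)). Qed.

Lemma hc_ideal0 k x : mrea_ideal R 0 x -> mrea_ideal R 0 (hc k x).
Proof.
move: x; apply: mrea_ideal_ind.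
- by rewrite hc0; apply: ideal0.
- by move=> c x y Hx Hy; rewrite hcP; apply: idealD.
move=> u v t; have D := @of_degree_sandwich K N _ u v _ (@of_degree_rel0 _ _ R t).
have [<-|nk] := eqVneq (size u + 2 + size v)%N k.
  rewrite (hc_id D); apply: gen_ideal_mulr; apply: gen_ideal_mull; apply/asboolP.
  by exists [:: (1, t, 1)]; rewrite big_seq1 mul1r mulr1.
by rewrite (hc_neq D nk); apply: ideal0.
Qed.

Section Component.
Variable k : nat.
Local Notation n1 := #|{: k.-tuple L}|.

Definition hrel_mx := rel_mx R k 0 *m sel K N k k.

Definition huncoords (z : 'rV[K]_n1) : FA := \sum_t z 0 t *: mono K (tup t).

Lemma hcoordsD (c : K) (x y : FA) :
  hcoords k (c *: x + y) = c *: hcoords k x + hcoords k y.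
Proof. by apply/rowP => s; rewrite !mxE cfD cfZ. Qed.

Lemma hcoords_inj (x y : FA) : of_degree k x -> of_degree k y ->
  hcoords k x = hcoords k y -> x = y.
Proof.
move=> /of_degreeP Hx /of_degreeP Hy E; apply: cf_inj => w.
have [/tupP[t ->]|sw] := eqVneq (size w) k; first by move/rowP/(_ t): E; rewrite !mxE.
have Z (z : FA) : (forall s, cf z s != 0 -> size s = k) -> cf z w = 0.
  by move=> H; apply/eqP; apply: contraTT sw => /H ->; rewrite eqxx.
by rewrite (Z _ Hx) (Z _ Hy).
Qed.

Lemma huncoordsK : cancel huncoords (hcoords k).
Proof.
move=> z; apply/rowP => s; rewrite mxE cf_sum (bigD1 s) //= [X in _ + X]big1 => [|t ts].
  by rewrite cfZ cf_mono eqxx mulr1 addr0.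
by rewrite cfZ cf_mono (inj_eq (@tup_inj _ _)) (negPf ts) mulr0.
Qed.

Lemma of_degree_huncoords z : of_degree k (huncoords z).
Proof.
apply: of_degree_sum => t _; apply: of_degreeZ.
by have := @of_degree_mono K N (tup t); rewrite size_tup.
Qed.

Lemma hcoords_hc (x : FA) : hcoords k (hc k x) = hcoords k x.
Proof. by apply/rowP => t; rewrite !mxE cf_hc size_tup eqxx. Qed.

Lemma ideal_hcoords x : of_degree k x -> mrea_ideal R 0 x <-> (hcoords k x <= hrel_mx)%MS.
Proof.
move=> Hx; split.
  have H0 (y : FA) : (forall t : 'I_n1, cf y (tup t) = 0) -> (hcoords k y <= hrel_mx)%MS.
    by move=> H; have -> : hcoords k y = 0; [apply/rowP => t; rewrite !mxE H|apply: sub0mx].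
  move: x {Hx}; apply: mrea_ideal_ind.
  - by apply: H0 => t; rewrite cf0.
  - by move=> c x y Hx Hy; rewrite hcoordsD addmx_sub // scalemx_sub.
  move=> u v t; have D := @of_degree_sandwich K N _ u v _ (@of_degree_rel0 _ _ R t).
  have [E|nk] := eqVneq (size u + 2 + size v)%N k.
    rewrite -(mul_sel (leqnn k)); apply: submxMr; apply: gen_coords.
    by rewrite -E; lia.
  apply: H0 => s; move/of_degreeP: D => D; apply/eqP; apply: contraTT nk => /D.
  by rewrite size_tup negbK => ->.
move=> /submxP[z]; rewrite /hrel_mx mulmxA mul_rel_mx mul_sel //.
set y := \sum_e _ => E.
have -> : x = hc k y.
  by apply: hcoords_inj => //; [exact: of_degree_hc|rewrite hcoords_hc].
apply: hc_ideal0; rewrite /y; elim/big_rec: _ => [|e w _ Hw]; first exact: ideal0.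
by apply: idealD => //; apply: genrow_ideal.
Qed.

Lemma pi_eq hbar x y : (\pi_(mrea R hbar) x = \pi_(mrea R hbar) y) <->
  mrea_ideal R hbar (x - y).
Proof.
have H := @Defs.eqquotP FA (mrea_ideal R hbar) x y.
split=> [E|E]; first by rewrite -[mrea_ideal _ _ _]H; apply/eqP.
by apply/eqP; rewrite H.
Qed.

Lemma pi_linear hbar (c : K) x y : \pi_(mrea R hbar) (c *: x + y) =
  c *: \pi_(mrea R hbar) x + \pi_(mrea R hbar) y.
Proof.
rewrite (raddfD \pi_(mrea R hbar)); congr (_ + _).
exact: (@pi_quot_scale K FA).
Qed.

Lemma pi0 hbar : \pi_(mrea R hbar) 0 = 0.
Proof. exact: (raddf0 \pi_(mrea R hbar)). Qed.

Lemma pi_sum hbar (I : finType) (c : I -> K) (x : I -> FA) :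
  \pi_(mrea R hbar) (\sum_i c i *: x i) = \sum_i c i *: \pi_(mrea R hbar) (x i).
Proof.
elim/big_rec2: _ => [|i y z _ <-]; first exact: pi0.
exact: pi_linear.
Qed.

Lemma hcoords_sum (I : finType) (c : I -> K) (F : I -> FA) :
  hcoords k (\sum_i c i *: F i) = \sum_i c i *: hcoords k (F i).
Proof.
apply/rowP => s; rewrite mxE cf_sum summxE; apply: eq_bigr => i _.
by rewrite cfZ !mxE.
Qed.

(** A basis of a complement to the relations, lifted to words of length k, projects to a basis of
    the component. *)
Lemma rea_comp_dim : has_dim (rea_comp R k) (n1 - \rank hrel_mx).
Proof.
pose G := hrel_mx; pose C := row_base (G^C)%MS.
rewrite -[(_ - _)%N](mxrank_compl G).
have dC (c : 'rV[K]_(\rank (G^C)%MS)) :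
    hcoords k (\sum_i c 0 i *: huncoords (row i C)) = c *m C.
  rewrite hcoords_sum mulmx_sum_row; apply: eq_bigr => i _.
  by rewrite huncoordsK.
have degC (c : 'I_(\rank (G^C)%MS) -> K) : of_degree k (\sum_i c i *: huncoords (row i C)).
  by apply: of_degree_sum => i _; apply: of_degreeZ; apply: of_degree_huncoords.
exists (fun i => \pi_(rea R) (huncoords (row i C))); split.
  apply/seteqP; split=> [_ [x Hx <-]|_ [c _ <-]]; last first.
    by exists (\sum_i c i *: huncoords (row i C)); rewrite ?pi_sum.
  have : (hcoords k x <= G + G^C)%MS by apply: submx_full; apply: addsmx_compl_full.
  move/sub_addsmxP => [[a b] /= E].
  have /submxP[c Ec] : (b *m (G^C)%MS <= C)%MS by rewrite eq_row_base submxMl.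
  exists (fun i => c 0 i) => //; rewrite -pi_sum; apply/pi_eq.
  have -> : \sum_i c 0 i *: huncoords (row i C) - x =
    -1 *: x + \sum_i c 0 i *: huncoords (row i C) by rewrite scaleN1r addrC.
  apply/ideal_hcoords; first exact: of_degreeD.
  rewrite hcoordsD dC -Ec E scaleN1r opprD -addrA addNr addr0 -mulNmx.
  exact: submxMl.
move=> c /=; rewrite -pi_sum -(pi0 0) => /pi_eq; rewrite subr0.
move/ideal_hcoords => /(_ (degC c)); pose c' := \row_i c i.
have -> : \sum_i c i *: huncoords (row i C) = \sum_i c' 0 i *: huncoords (row i C).
  by apply: eq_bigr => i _; rewrite mxE.
rewrite dC => H i.
have : (c' *m C <= G :&: G^C)%MS.
  by rewrite sub_capmx H /=; apply: (submx_trans (submxMl _ _)); rewrite eq_row_base.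
rewrite capmx_compl submx0 mulmx_free_eq0 ?row_base_free // => /eqP/rowP/(_ i).
by rewrite !mxE.
Qed.

End Component.
End Components.

Lemma mulBZsandwich (K : fieldType) (A : algType K) (c : K) (w x y a b : A) :
  w = x - c *: y -> a * w * b = a * x * b - c *: (a * y * b).
Proof. by move=> ->; rewrite mulrBr mulrBl -scalerAr -scalerAl. Qed.

Section Leading.
Variables (K : fieldType) (N : nat) (R : 'M[K]_(N * N)).
Local Notation L := ('I_N * 'I_N)%type.
Local Notation FA := (freealg K N).
Variable m : nat.

Definition rdeg (e : rows N m) : nat := (size e.1.1 + size e.1.2).+2.

Fact linrow_subproof : {g : rows N m -> FA | forall e,
  g e = if (rdeg e <= m)%N then mono K e.1.1 * rel_lin R e.2 * mono K e.1.2 else 0}.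
Proof. by eexists. Qed.
Definition linrow : rows N m -> FA := sval linrow_subproof.

Lemma linrowE e : linrow e =
  if (rdeg e <= m)%N then mono K e.1.1 * rel_lin R e.2 * mono K e.1.2 else 0.
Proof. exact: (svalP linrow_subproof). Qed.

Lemma genrow_split hbar e : genrow R hbar e = genrow R 0 e - hbar *: linrow e.
Proof.
rewrite !genrowE linrowE /rdeg; case: (_ <= m)%N.
  exact: (mulBZsandwich _ _ (mrea_rel_split R hbar _)).
rewrite scaler0.
by rewrite subr0.
Qed.

Lemma of_degree_genrow0 e : of_degree (rdeg e) (genrow R 0 e).
Proof.
rewrite genrowE; case: ifP => _; last exact: of_degree0.
have -> : rdeg e = (size e.1.1 + 2 + size e.1.2)%N by rewrite /rdeg; lia.
by apply: of_degree_sandwich; apply: of_degree_rel0.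
Qed.

Lemma of_degree_linrow e : of_degree (rdeg e).-1 (linrow e).
Proof.
rewrite linrowE; case: ifP => _; last exact: of_degree0.
have -> : (rdeg e).-1 = (size e.1.1 + 1 + size e.1.2)%N by rewrite /rdeg; lia.
by apply: of_degree_sandwich; apply: of_degree_rel_lin.
Qed.

Lemma of_degree_le_genrow_rdeg hbar e : of_degree_le (rdeg e) (genrow R hbar e).
Proof.
rewrite genrowE; case: ifP => _; last exact: of_degree_le0.
exact: of_degree_le_gen.
Qed.

Lemma hc_genrow_ideal hbar k e : (rdeg e <= k)%N -> mrea_ideal R 0 (hc k (genrow R hbar e)).
Proof.
move=> ek; rewrite genrow_split addrC -scaleNr hcP; apply: idealD.
  rewrite (@hc_le _ _ (rdeg e).-1 k (linrow e)); first exact: ideal0.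
  - by apply: of_degree_le_of; apply: of_degree_linrow.
  - by rewrite /rdeg /= in ek *.
by apply: hc_ideal0; apply: genrow_ideal.
Qed.

Lemma cf_genrow_split hbar e s :
  cf (genrow R hbar e) s = cf (genrow R 0 e) s - hbar * cf (linrow e) s.
Proof. by rewrite [in LHS]genrow_split cfD cfN cfZ. Qed.

(** Give every letter weight t. The quadratic part of a row has weight t to the degree of the row;
    the linear part has one factor less, and hbar supplies the missing t. *)
Lemma cf_genrow_scale t hbar e s :
  cf (genrow R (t * hbar) e) s * t ^+ size s = t ^+ rdeg e * cf (genrow R hbar e) s.
Proof.
have key (a b c d : K) : a = c - hbar * d -> b = c - (t * hbar) * d ->
    (c != 0 -> size s = rdeg e) -> (d != 0 -> size s = (rdeg e).-1) ->
    b * t ^+ size s = t ^+ rdeg e * a.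
  move=> -> ->; have [-> H _|_] := eqVneq d 0.
    rewrite !mulr0 !subr0; have [->|/H ->] := eqVneq c 0; first by rewrite mulr0 mul0r.
    by rewrite mulrC.
  have [->|_] := eqVneq c 0; last first.
    by move=> /(_ isT) E1 /(_ isT) E2; move: E1; rewrite E2 /rdeg /=; lia.
  by move=> _ /(_ isT) ->; rewrite -[in RHS](@prednK (rdeg e)) // exprS; ring.
apply: (key _ _ _ _ (cf_genrow_split _ _ _) (cf_genrow_split _ _ _)).
  by move/of_degreeP: (@of_degree_genrow0 e); apply.
by move/of_degreeP: (@of_degree_linrow e); apply.
Qed.

Definition colsel k : 'M[K]_#|{: m.-bseq L}| := diag_mx (\row_s (k < size (bs s))%N%:R).
Definition rowsel k : 'M[K]_#|{: rows N m}| := diag_mx (\row_e (rdeg (enum_val e) <= k)%N%:R).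

Lemma rowsel_colsel hbar k : rowsel k *m rel_mx R m hbar *m colsel k = 0.
Proof.
apply/matrixP => e s; rewrite mul_diag_mx mul_mx_diag !mxE.
have [ek|_] := leqP (rdeg _) k; last by rewrite !mul0r.
have [sk|_] := ltnP k (size _); last by rewrite mulr0.
rewrite mul1r mulr1; apply/eqP; apply: contraTT sk.
move/of_degree_leP: (@of_degree_le_genrow_rdeg hbar (enum_val e)) => /[apply] H.
by rewrite -leqNgt (leq_trans H).
Qed.

(** For hbar = 0 rows are homogeneous, so the matrix is the sum of its part on words longer than k
    and its part from rows of degree at most k. *)
Lemma colsel_row0 k (z : 'rV[K]_#|{: rows N m}|) : z *m rel_mx R m 0 *m colsel k = 0 ->
  (z *m rel_mx R m 0 <= rowsel k *m rel_mx R m 0)%MS.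
Proof.
move=> H.
have E : rel_mx R m 0 = rel_mx R m 0 *m colsel k + rowsel k *m rel_mx R m 0.
  apply/matrixP => e s; rewrite mxE mul_diag_mx mul_mx_diag !mxE.
  have [-> |] := eqVneq (cf (genrow R 0 (enum_val e)) (bs s)) 0.
    by rewrite mulr0 mul0r addr0.
  move/of_degreeP: (@of_degree_genrow0 (enum_val e)) => /[apply] ->.
  by case: ltnP => _; rewrite !(mul0r, mul1r, mulr0, mulr1, addr0, add0r).
have -> : z *m rel_mx R m 0 = z *m (rowsel k *m rel_mx R m 0).
  by rewrite [in LHS]E mulmxDr mulmxA H add0r.
exact: submxMl.
Qed.

Lemma coords_colsel k x : of_degree_le k x -> coords m x *m colsel k = 0.
Proof.
move=> /of_degree_leP H; apply/rowP => s; rewrite mul_mx_diag !mxE.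
have [sk|_] := ltnP k (size _); last by rewrite mulr0.
by rewrite mulr1; apply/eqP; apply: contraTT sk => /H; rewrite -leqNgt.
Qed.

End Leading.

Section DegenerationRank.
Variables (K : numFieldType) (N : nat) (R : 'M[K]_(N * N)) (m : nat).

Lemma cts_rel_mx_hbar t0 (f : K -> K) : cts_at t0 f -> cts_mx t0 (fun t => rel_mx R m (f t)).
Proof.
move=> cf_ e s; apply: (@eq_cts _ _ (fun t => cf (genrow R 0 (enum_val e)) (bs s) +
    - (f t * cf (linrow R (enum_val e)) (bs s)))).
  by move=> t; rewrite mxE; apply/esym; apply: cf_genrow_split.
apply: cts_add; first exact: cts_cst.
by apply: cts_opp; apply: cts_mul => //; exact: cts_cst.
Qed.

Lemma rel_mx_scale (t hbar : K) : t != 0 -> exists (D1 : 'rV[K]_#|{: rows N m}|)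
    (D2 : 'rV[K]_#|{: m.-bseq ('I_N * 'I_N)}|),
  [/\ diag_mx D1 \in unitmx, diag_mx D2 \in unitmx &
   rel_mx R m (t * hbar) = diag_mx D1 *m rel_mx R m hbar *m diag_mx D2].
Proof.
move=> t0; exists (\row_e t ^+ rdeg (enum_val e)), (\row_s (t ^+ size (bs s))^-1).
split.
- rewrite unitmxE det_diag unitfE; apply/prodf_neq0 => e _.
  by rewrite mxE expf_neq0.
- rewrite unitmxE det_diag unitfE; apply/prodf_neq0 => e _.
  by rewrite mxE invr_neq0 // expf_neq0.
apply/matrixP => e s.
transitivity (t ^+ rdeg (enum_val e) * cf (genrow R hbar (enum_val e)) (bs s) *
    (t ^+ size (bs s))^-1); last first.
  by rewrite mul_diag_mx mul_mx_diag !mxE.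
rewrite mxE -[X in _ = X / _](cf_genrow_scale R t hbar (enum_val e) (bs s)).
by rewrite mulfK ?expf_neq0.
Qed.

(** Rescaling letters gives the rank at t hbar the same upper bound for all t != 0, while lower
    semicontinuity at t = 0 bounds it from below. The hypotheses let the diagonal rescalings pass
    through A and B. *)
Lemma rank_degenerate hbar p r (A : 'M[K]_(p, #|{: rows N m}|)) (B : 'M[K]_(_, r)) :
  (forall D : 'rV[K]_#|{: rows N m}|, exists D', A *m diag_mx D = D' *m A) ->
  (forall D : 'rV[K]_#|{: m.-bseq ('I_N * 'I_N)}|, exists D', diag_mx D *m B = B *m D') ->
  (\rank (A *m rel_mx R m 0 *m B) <= \rank (A *m rel_mx R m hbar *m B))%N.
Proof.
move=> HA HB.
have c : cts_mx 0 (fun t => A *m rel_mx R m (t * hbar) *m B).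
  apply: cts_mulmx; last exact: cts_mx_cst.
  apply: cts_mulmx; first exact: cts_mx_cst.
  by apply: cts_rel_mx_hbar; apply: cts_mul; [exact: cts_id|exact: cts_cst].
have := rank_lsc c; rewrite mul0r => H.
have H' : \forall t \near (0 : K)^', (\rank (A *m rel_mx R m 0 *m B) <=
    \rank (A *m rel_mx R m (t * hbar) *m B))%N /\ t != 0.
  near=> t; split; last by near: t; exact: nbhs_dnbhs_neq.
  near: t; exact: (cvg_within _ H).
have [t [Ht t0]] := filter_ex H'; apply: (leq_trans Ht).
have [D1 [D2 [_ _ ->]]] := rel_mx_scale hbar t0.
have [D1' E1] := HA D1; have [D2' E2] := HB D2.
rewrite !mulmxA E1 -!mulmxA E2 !mulmxA.
apply: (leq_trans (mxrankM_maxl _ _)).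
by rewrite -!mulmxA mxrankM_maxr.
Unshelve. all: by end_near.
Qed.

End DegenerationRank.

Lemma hc_sum (K : fieldType) N k (I : finType) (c : I -> K) (F : I -> freealg K N) :
  hc k (\sum_i c i *: F i) = \sum_i c i *: hc k (F i).
Proof.
apply: (etrans (linear_sum (wlin (fun s => if size s == k then mono K s else 0)) _ _ _)).
by apply: eq_bigr => i _; apply: (linearZZ (wlin _)).
Qed.

(* With P the projection onto words longer than k and Q the selection of the rows
   of degree at most k, rank M = rank (M P) + dim (M :&: ker P), and
   Q M <= M :&: ker P with equality at hbar = 0; all inequalities are equalities. *)
Lemma pbw_of_rank (K : numFieldType) N (R : 'M[K]_(N * N)) hbar :
  (forall m, \rank (rel_mx R m hbar) <= \rank (rel_mx R m 0))%N ->
  forall k x, mrea_ideal R hbar x -> of_degree_le k x -> mrea_ideal R 0 (hc k x).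
Proof.
move=> Hr k x Ix xk; have [m0 Hm0] := ideal_coords Ix.
pose m := maxn m0 k; have [xm xM] := Hm0 m (leq_maxl _ _).
pose M h := rel_mx R m h; pose P := colsel K N m k; pose Q := rowsel K N m k.
have Pd (D : 'rV[K]_#|{: m.-bseq ('I_N * 'I_N)}|) : exists D', diag_mx D *m P = P *m D'.
  by exists (diag_mx D); apply: diag_mxC.
have Qd (D : 'rV[K]_#|{: rows N m}|) : exists D', Q *m diag_mx D = D' *m Q.
  by exists (diag_mx D); apply: diag_mxC.
have le1 : (\rank (M 0%R *m P) <= \rank (M hbar *m P))%N.
  have e h : 1%:M *m M h *m P = M h *m P := congr1 (fun X => X *m P) (mul1mx _).
  have H1 (D : 'rV[K]_#|{: rows N m}|) : exists D', 1%:M *m diag_mx D = D' *m 1%:M.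
    by exists (diag_mx D); rewrite mul1mx mulmx1.
  have H := rank_degenerate R hbar H1 Pd.
  exact: leq_trans (eq_leq (congr1 mxrank (esym (e 0)))) (leq_trans H (eq_leq (congr1 mxrank (e hbar)))).
have le2 : (\rank (Q *m M 0%R) <= \rank (Q *m M hbar))%N.
  have H1 (D : 'rV[K]_#|{: m.-bseq ('I_N * 'I_N)}|) : exists D', diag_mx D *m 1%:M = 1%:M *m D'.
    by exists (diag_mx D); rewrite mul1mx mulmx1.
  have H := rank_degenerate R hbar Qd H1.
  exact: leq_trans (eq_leq (congr1 mxrank (esym (mulmx1 _)))) (leq_trans H (eq_leq (congr1 mxrank (mulmx1 _)))).
have sub h : (Q *m M h <= M h :&: kermx P)%MS.
  by rewrite sub_capmx submxMl /=; apply/sub_kermxP; apply: rowsel_colsel.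
have sup0 : (M 0%R :&: kermx P <= Q *m M 0)%MS.
  apply/row_subP => i; have : (row i (M 0%R :&: kermx P)%MS <= M 0%R :&: kermx P)%MS by apply: row_sub.
  by rewrite sub_capmx => /andP[/submxP[z ->] /sub_kermxP]; apply: colsel_row0.
have eqr : (M hbar :&: kermx P <= Q *m M hbar)%MS.
  rewrite -(mxrank_leqif_sup (sub hbar)) eqn_leq mxrankS //=.
  rewrite -(leq_add2l (\rank (M hbar *m P))) mxrank_mul_ker.
  apply: (leq_trans (Hr m)); rewrite -/(M 0%R) -(mxrank_mul_ker (M 0%R) P).
  by apply: leq_add => //; apply: leq_trans le2; apply: mxrankS.
have : (coords m x <= M hbar :&: kermx P)%MS.
  by rewrite sub_capmx xM /=; apply/sub_kermxP; apply: coords_colsel.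
move=> /submx_trans/(_ eqr)/submxP[z].
rewrite mulmxA mul_rel_mx => E.
have Ex : x = \sum_e (z *m Q) 0 e *: genrow R hbar (enum_val e).
  rewrite -[LHS](coordsK xm) E coordsK //.
  elim/big_rec: _ => [|e y _ Hy]; first exact: of_degree_le0.
  by apply: of_degree_leD => //; apply: of_degree_le_genrow.
rewrite Ex hc_sum.
elim/big_rec: _ => [|e y _ Hy]; first exact: ideal0.
rewrite mul_mx_diag !mxE; case: (leqP (rdeg _) k) => [ek|_] /=; last by rewrite mulr0 scale0r add0r.
by apply: idealD; [exact: hc_genrow_ideal|exact: Hy].
Qed.

(** * The shift of the generators *)

Section TraceForms.
Variables (K : numFieldType) (I : finType) (nu : K) (rho : I -> I -> I -> I -> K).
Hypothesis rho_hecke : hecke_kernel nu rho.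

Let eps (a : I * I) : K := (a.1 == a.2)%:R.

Lemma sum_eps (F : I -> K) x : \sum_y (x == y)%:R * F y = F x.
Proof.
rewrite (bigD1 x) //= eqxx mul1r big1 ?addr0 // => y /negPf yx.
by rewrite eq_sym yx mul0r.
Qed.

(** Evaluating one letter by the trace form [eps] leaves products of two R-matrices. By R^2 = 1 + nu
    R the common term Z and the identity terms cancel between the two halves, and nu times the
    linear part of the relation remains. *)
Lemma rel_form_eps g i j r s :
  rel_form rho (fun a b => eps b * g a + eps a * g b) i j r s =
  nu * (\sum_a rho i j a s * g (a, r) - \sum_b rho b j r s * g (i, b)).
Proof.
have H2 x y c d : \sum_a \sum_b rho x y a b * rho a b c d =
    ((x == c) && (y == d))%:R + nu * rho x y c d.
  by rewrite -rho_hecke pair_big.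
have [Z EZ] : {Z | Z = \sum_k \sum_l rho i j k l * \sum_m rho m l r s * g (k, m)} by eexists.
have E1 : act2 rho (fun k l => \sum_m \sum_p rho m l p s *
    (eps (p, r) * g (k, m) + eps (k, m) * g (p, r))) i j =
    Z + \sum_p ((i == p) && (j == s))%:R * g (p, r) + nu * \sum_p rho i j p s * g (p, r).
  transitivity (Z + \sum_p (\sum_k \sum_l rho i j k l * rho k l p s) * g (p, r)); last first.
    rewrite -addrA mulr_sumr -big_split /=; congr (_ + _); apply: eq_bigr => p _ /=.
    by rewrite H2 mulrDl mulrA.
  under [X in _ + X]eq_bigr => p _ do rewrite mulr_suml.
  rewrite [X in _ + X]exchange_big EZ -big_split /act2 /= -(pair_big xpredT xpredT
    (fun k l => rho i j k l * \sum_m \sum_p rho m l p s *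
      (eps (p, r) * g (k, m) + eps (k, m) * g (p, r)))) /=.
  apply: eq_bigr => k _.
  under [X in _ = _ + X]eq_bigr => p _ do rewrite mulr_suml.
  rewrite [X in _ = _ + X]exchange_big -big_split; apply: eq_bigr => l _ /=.
  under [X in _ = _ + X]eq_bigr => p _ do rewrite -mulrA.
  rewrite -mulr_sumr -mulrDr; congr (_ * _).
  transitivity (\sum_m \sum_p (rho m l p s * (eps (p, r) * g (k, m))) +
      \sum_m \sum_p (rho m l p s * (eps (k, m) * g (p, r)))).
    rewrite -big_split; apply: eq_bigr => m _; rewrite -big_split; apply: eq_bigr => p _ /=.
    by rewrite mulrDr.
  congr (_ + _).
    apply: eq_bigr => m _; rewrite -(sum_eps (fun p => rho m l p s * g (k, m)) r).
    by apply: eq_bigr => p _; rewrite /eps /= eq_sym mulrCA.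
  rewrite -(sum_eps (fun m => \sum_p rho m l p s * g (p, r)) k).
  apply: eq_bigr => m _; rewrite mulr_sumr; apply: eq_bigr => p _.
  by rewrite /eps /= mulrCA.
have E2 : \sum_a act2 rho (fun b c => \sum_d rho d c r s *
    (eps (b, d) * g (i, a) + eps (i, a) * g (b, d))) a j =
    Z + \sum_a ((a == r) && (j == s))%:R * g (i, a) + nu * \sum_a rho a j r s * g (i, a).
  transitivity (Z + \sum_a (\sum_b \sum_c rho a j b c * rho b c r s) * g (i, a)); last first.
    rewrite -addrA mulr_sumr -big_split /=; congr (_ + _); apply: eq_bigr => p _ /=.
    by rewrite H2 mulrDl mulrA.
  rewrite EZ -(sum_eps (fun a => \sum_k \sum_l rho a j k l * \sum_m rho m l r s * g (k, m)) i).
  rewrite -big_split; apply: eq_bigr => a _ /=.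
  rewrite mulr_sumr mulr_suml -big_split /act2 /= -(pair_big xpredT xpredT
    (fun b c => rho a j b c * \sum_d rho d c r s *
      (eps (b, d) * g (i, a) + eps (i, a) * g (b, d)))) /=.
  apply: eq_bigr => b _; rewrite mulr_sumr mulr_suml -big_split; apply: eq_bigr => c _ /=.
  rewrite mulrCA -[in RHS]mulrA -mulrDr; congr (_ * _).
  rewrite -(sum_eps (fun d => rho d c r s * g (i, a)) b) mulr_sumr -big_split.
  apply: eq_bigr => d _; rewrite /eps /=; ring.
rewrite /rel_form E1 E2.
have -> : \sum_p ((i == p) && (j == s))%:R * g (p, r) = (j == s)%:R * g (i, r).
  rewrite -(sum_eps (fun p => (j == s)%:R * g (p, r)) i); apply: eq_bigr => p _.
  by rewrite mulrA -natrM mulnb.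
have -> : \sum_a ((a == r) && (j == s))%:R * g (i, a) = (j == s)%:R * g (i, r).
  rewrite -(sum_eps (fun p => (j == s)%:R * g (i, p)) r); apply: eq_bigr => p _.
  by rewrite mulrA -natrM mulnb [r == p]eq_sym.
ring.
Qed.

Lemma rel_form_eps2 i j r s : rel_form rho (fun a b => eps a * eps b) i j r s = 0.
Proof.
(* For g = [eps] the linear part cancels while the left side is twice the wanted form, so division
   by 2 concludes. *)
have := rel_form_eps eps i j r s.
under eq_bigr => a _ do rewrite mulrC.
rewrite (eq_bigr (fun a => (r == a)%:R * rho i j a s)); last by move=> a _; rewrite /eps /= eq_sym.
rewrite sum_eps.
under [X in _ - X]eq_bigr => a _ do rewrite mulrC.
rewrite (sum_eps (fun b => rho b j r s)) subrr mulr0 rel_formE => E.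
have : (2 : K) * rel_form rho (fun a b => eps a * eps b) i j r s = 0.
  rewrite -[RHS]E rel_formE mulr_sumr; apply: eq_bigr => e _; ring.
by move/eqP; rewrite mulf_eq0 pnatr_eq0 => /eqP.
Qed.

Lemma rel_form_shift (c : K) (f g : _) (h : K) i j r s :
  rel_form rho (fun a b => f a b - c * (eps b * g a + eps a * g b) + h * (eps a * eps b)) i j r s =
  rel_form rho f i j r s - c * nu * (\sum_a rho i j a s * g (a, r) - \sum_b rho b j r s * g (i, b)).
Proof.
rewrite -mulrA -rel_form_eps -[RHS]addr0 -(mulr0 h) -[in RHS](rel_form_eps2 i j r s) !rel_formE.
rewrite !mulr_sumr -sumrB -big_split; apply: eq_bigr => e _ /=; ring.
Qed.

End TraceForms.

Section AbstractAlgebra.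
Variables (K : fieldType) (A : algType K).

Lemma mul_shift (a b : K) (x y : A) :
  (x - a *: 1) * (y - b *: 1) = x * y - (b *: x + a *: y) + (a * b) *: 1.
Proof.
rewrite mulrBl !mulrBr -!scalerAr -!scalerAl !mulr1 !mul1r scalerA.
by rewrite opprB opprD !addrA (mulrC b a) [LHS](AC 4 (1*2*4*3)) /=.
Qed.

Lemma subZZ (a b : K) (x y : A) : x - a *: y - b *: y = x - (b + a) *: y.
Proof. by rewrite scalerDl opprD addrA -!addrA (addrC (- (a *: y))). Qed.

Lemma mul_sums (I J : finType) (c : I -> K) (d : J -> K) (x : I -> A) (y : J -> A) (r : A) :
  (\sum_i c i *: x i) * r * (\sum_j d j *: y j) =
  \sum_i \sum_j (c i * d j) *: (x i * r * y j).
Proof.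
rewrite !mulr_suml; apply: eq_bigr => i _; rewrite mulr_sumr; apply: eq_bigr => j _.
by rewrite -!scalerAl -scalerAr scalerA.
Qed.

End AbstractAlgebra.

Section Shift.
Variables (K : numFieldType) (N : nat).
Local Notation L := ('I_N * 'I_N)%type.
Local Notation FA := (freealg K N).

Definition shift_letter (c : K) (l : L) : FA := mono K [:: l] - (c * (l.1 == l.2)%:R) *: 1.

Definition shift_word (c : K) (s : seq L) : FA := \prod_(l <- s) shift_letter c l.

Definition shift c : FA -> FA := wlin (shift_word c).

Lemma shift_word0 c : shift_word c [::] = 1.
Proof. exact: big_nil. Qed.

Lemma shift_word_cat c s t : shift_word c (s ++ t) = shift_word c s * shift_word c t.
Proof. exact: big_cat. Qed.

Lemma shiftM c x y : shift c (x * y) = shift c x * shift c y.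
Proof. exact: (wlin_mul (shift_word0 c) (@shift_word_cat c)). Qed.

Lemma shiftB c x y : shift c (x - y) = shift c x - shift c y.
Proof. exact: (linearB (wlin (shift_word c))). Qed.

Lemma shiftZ c (a : K) x : shift c (a *: x) = a *: shift c x.
Proof. exact: (linearZZ (wlin (shift_word c))). Qed.

Lemma shift_sum c (I : finType) (a : I -> K) (F : I -> FA) :
  shift c (\sum_i a i *: F i) = \sum_i a i *: shift c (F i).
Proof.
apply: (etrans (linear_sum (wlin (shift_word c)) _ _ _)).
by apply: eq_bigr => i _; apply: shiftZ.
Qed.

Lemma shift_mono c s : shift c (mono K s) = shift_word c s.
Proof. exact: wlin_mono. Qed.

Lemma shift_word1 c l : shift_word c [:: l] = shift_letter c l.
Proof. exact: big_seq1. Qed.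

Lemma cf_comp_wlin (h : seq L -> FA) x w :
  cf (wlin h x) w = wlin (fun s => cf (h s) w : K^o) x.
Proof. by rewrite cf_sum; apply: eq_bigr => v _; rewrite cfZ. Qed.

Lemma cf_shift_word2 c a b w : cf (shift_word c [:: a; b]) w =
  ([:: a; b] == w)%:R
  - c * ((b.1 == b.2)%:R * ([:: a] == w)%:R + (a.1 == a.2)%:R * ([:: b] == w)%:R)
  + (c * c * ([::] == w)%:R) * ((a.1 == a.2)%:R * (b.1 == b.2)%:R).
Proof.
have -> : shift_word c [:: a; b] = shift_letter c a * shift_letter c b.
  by rewrite /shift_word big_cons big_seq1.
rewrite [X in cf X](mul_shift _ _ (mono K [:: a]) (mono K [:: b])) cfD.
congr (_ + _); last by rewrite cfZ -mono_nil cf_mono; ring.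
rewrite cfD; congr (_ + _); first by rewrite monoM cf_mono.
rewrite cfN; congr (- _); rewrite cfD mulrDr; congr (_ + _).
  by rewrite cfZ cf_mono mulrA.
by rewrite cfZ cf_mono mulrA.
Qed.

Variables (R : 'M[K]_(N * N)) (nu : K).
Hypothesis R_hecke : hecke_kernel nu (rkernel R).

(** The constants produced by the two sums are the same multiple of R^{rs}_{ij} and cancel. *)
Lemma shift_rel_lin c t : shift c (rel_lin R t) = rel_lin R t.
Proof.
case: t => [[[i j] r] s]; apply: cf_inj => w.
have sE l : cf (shift c (mono K [:: l])) w = cf (mono K [:: l]) w - c * (l.1 == l.2)%:R * ([::] == w)%:R.
  by rewrite shift_mono shift_word1 cfD cfN cfZ -mono_nil [in X in _ - _ * X]cf_mono.
have lD (x y : FA) : cf (shift c (x - y)) w = cf (shift c x) w - cf (shift c y) w.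
  by rewrite shiftB cfD cfN.
have lS (F : 'I_N -> K) (G : 'I_N -> FA) : cf (shift c (\sum_i F i *: G i)) w =
    \sum_i F i * cf (shift c (G i)) w.
  by rewrite shift_sum cf_sum; apply: eq_bigr => a _; rewrite cfZ.
pose d : K := c * ([::] == w)%:R.
have h1 : cf (shift c (\sum_a coef R a s i j *: mono K [:: (a, r)])) w =
    cf (\sum_a coef R a s i j *: mono K [:: (a, r)]) w - coef R r s i j * d.
  rewrite lS cf_sum -(sum_eps (fun a => coef R a s i j * d) r) -sumrB.
  by apply: eq_bigr => a _; rewrite sE cfZ /d /= eq_sym; ring.
have h2 : cf (shift c (\sum_b coef R r s b j *: mono K [:: (i, b)])) w =
    cf (\sum_b coef R r s b j *: mono K [:: (i, b)]) w - coef R r s i j * d.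
  rewrite lS cf_sum -(sum_eps (fun a => coef R r s a j * d) i) -sumrB.
  by apply: eq_bigr => a _; rewrite sE cfZ /d /=; ring.
have fin (p u e : K) : (p - e) - (u - e) = p - u by ring.
have cfB (x y : FA) : cf (x - y) w = cf x w - cf y w by rewrite cfD cfN.
exact: etrans (lD _ _) (etrans (congr2 (fun u v => u - v) h1 h2) (etrans (fin _ _ _) (esym (cfB _ _)))).
Qed.

Lemma shift_rel c hbar t :
  shift c (mrea_rel R hbar t) = mrea_rel R (hbar + c * nu) t.
Proof.
have lD (h : K) (x y : FA) : shift c (x - h *: y) = shift c x - h *: shift c y.
  by rewrite shiftB shiftZ.
rewrite [in LHS]mrea_rel_split lD shift_rel_lin [RHS]mrea_rel_split.
case: t => [[[i j] r] s].
have E0 : shift c (mrea_rel R 0 (i, j, r, s)) =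
    mrea_rel R 0 (i, j, r, s) - (c * nu) *: rel_lin R (i, j, r, s).
  apply: cf_inj => w.
  rewrite cf_comp_wlin wlin_rel0.
  transitivity (rel_form (rkernel R) (fun a b => ([:: a; b] == w)%:R
    - c * ((b.1 == b.2)%:R * ([:: a] == w)%:R + (a.1 == a.2)%:R * ([:: b] == w)%:R)
    + (c * c * ([::] == w)%:R) * ((a.1 == a.2)%:R * (b.1 == b.2)%:R)) i j r s).
    by rewrite !rel_formE; apply: eq_bigr => e _; rewrite cf_shift_word2.
  rewrite (rel_form_shift R_hecke) cfD cfN cfZ; congr (_ - _ * _).
    by rewrite cf_wlin wlin_rel0.
  rewrite /rel_lin cfD; congr (_ + _); last (rewrite cfN; congr (- _));
    by rewrite cf_sum; apply: eq_bigr => a _; rewrite cfZ cf_mono.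
exact: etrans (congr1 (fun u => u - hbar *: rel_lin R (i, j, r, s)) E0) (subZZ _ _ _ _).
Qed.

Lemma of_degree_le_shift c n x : of_degree_le n x -> of_degree_le n (shift c x).
Proof.
have H s : of_degree_le (size s) (shift_word c s).
  elim: s => [|l s IH]; first by rewrite shift_word0 -mono_nil; apply: (@of_degree_le_mono K N [::]).
  rewrite -cat1s shift_word_cat shift_word1.
  apply: (@of_degree_leM K N 1%N (size s)) => //.
  rewrite /shift_letter addrC -scaleNr -mono_nil; apply: of_degree_leD.
    by apply: (@of_degree_leS K N 0) => //; apply: (@of_degree_le_mono K N [::]).
  exact: (@of_degree_le_mono K N [:: l]).
move=> /of_degree_leP Hx; rewrite /shift /wlin.
elim/big_rec: _ => [|w y _ Hy]; first exact: of_degree_le0.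
have [->|/Hx sn] := eqVneq (cf x (fmonom_val w)) 0; first by rewrite scale0r add0r.
by apply: of_degree_leD; [exact: of_degree_leS sn (H _)|exact: Hy].
Qed.

Lemma shiftK c x : shift (- c) (shift c x) = x.
Proof.
elim/freealg_ind: x => [s|a x y Hx Hy|].
- rewrite shift_mono; elim: s => [|l s IH].
    by rewrite shift_word0 -mono_nil shift_mono shift_word0 mono_nil.
  rewrite -cat1s shift_word_cat shiftM IH -monoM; congr (_ * _).
  rewrite shift_word1 shiftB shiftZ shift_mono shift_word1 -mono_nil shift_mono shift_word0.
  by rewrite /shift_letter mulNr scaleNr opprK addrK.
- have P d u v : shift d (a *: u + v) = a *: shift d u + shift d v by exact: wlinP.
  apply: (etrans (congr1 (shift (- c)) (P c x y))).
  exact: (etrans (P (- c) _ _) (congr2 (fun u v => a *: u + v) Hx Hy)).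
by apply: (etrans (congr1 (shift (- c)) (linear0 (wlin _)))); exact: (linear0 (wlin _)).
Qed.

Lemma gen_le m hbar p p' a b t : of_degree_le p a -> of_degree_le p' b ->
  ((p + p').+2 <= m)%N -> (coords m (a * mrea_rel R hbar t * b)%R <= rel_mx R m hbar)%MS.
Proof.
move=> Ha Hb Hm; rewrite -(coordsK Ha) -(coordsK Hb) [X in coords m X]mul_sums.
rewrite [X in coords m X](_ : _ = \sum_i 1 *: \sum_j ((coords p a 0 i * coords p' b 0 j)
   *: (mono K (bs i) * mrea_rel R hbar t * mono K (bs j)))); last first.
  by apply: eq_bigr => i _; rewrite scale1r.
rewrite coords_sum; apply: summx_sub => i _; apply: scalemx_sub.
rewrite coords_sum; apply: summx_sub => j _; apply: scalemx_sub.
apply: gen_coords; apply: leq_trans Hm; rewrite !ltnS.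
by apply: leq_add; apply: size_bs.
Qed.

Definition shift_mx m c : 'M[K]_#|{: m.-bseq L}| :=
  \matrix_s coords m (shift c (mono K (bs s))).

Lemma mul_shift_mx m c z : z *m shift_mx m c = coords m (shift c (uncoords z)).
Proof.
rewrite /uncoords shift_sum coords_sum mulmx_sum_row.
by apply: eq_bigr => s _; rewrite rowK.
Qed.

Lemma shift_mx_free m c : row_free (shift_mx m c).
Proof.
apply/row_freeP; exists (shift_mx m (- c)); apply/row_matrixP => i.
rewrite row_mul rowK mul_shift_mx coordsK; last first.
  by apply: of_degree_le_shift; apply: (of_degree_leS (size_bs i)); apply: of_degree_le_mono.
rewrite shiftK; apply/rowP => s; rewrite !mxE cf_mono (inj_eq (@bs_inj _ _)).
by [].
Qed.

(** The shift is an automorphism that respects degrees, so it acts injectively on coordinates up to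
    degree m and carries relations to relations. *)
Lemma rank_shift m c hbar : (\rank (rel_mx R m hbar) <= \rank (rel_mx R m (hbar + c * nu)))%N.
Proof.
apply: (leq_trans (eq_leq (esym (mxrankMfree (rel_mx R m hbar) (shift_mx_free m c))))).
apply: mxrankS; apply/row_subP => e.
rewrite row_mul mul_shift_mx row_rel_mx coordsK; last exact: of_degree_le_genrow.
rewrite genrowE; case: ifP => H; last first.
  by rewrite -[0 : FA](scale0r 0) shiftZ scale0r coords0 sub0mx.
rewrite shiftM shiftM shift_rel !shift_mono; apply: gen_le H.
  by rewrite -shift_mono; apply: of_degree_le_shift; apply: of_degree_le_mono.
by rewrite -shift_mono; apply: of_degree_le_shift; apply: of_degree_le_mono.
Qed.

End Shift.

(** * Dependence on the parameter *)

Section RankSplit.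
Variables (K : fieldType) (N : nat) (R : 'M[K]_(N * N)) (m : nat).
Local Notation L := ('I_N * 'I_N)%type.
Local Notation M := (rel_mx R m 0).

Let ge k : 'M[K]_#|{: m.-bseq L}| := diag_mx (\row_s (k <= size (bs s))%N%:R).
Let homog k : 'M[K]_#|{: m.-bseq L}| := diag_mx (\row_s (size (bs s) == k)%N%:R).

Lemma rank_sel k : (k <= m)%N -> \rank (M *m homog k) = \rank (M *m sel K N k m).
Proof.
move=> km; have E : homog k = sel K N k m *m (sel K N k m)^T.
  apply/matrixP => s t; rewrite [RHS]mxE.
  transitivity (\sum_(u : 'I_#|{: k.-tuple L}|) ((bs s == tup u) && (bs t == tup u))%:R : K); last first.
    by apply: eq_bigr => u _; rewrite !mxE -natrM mulnb.
  rewrite !mxE; have [sk|sk] := eqVneq (size (bs s)) k.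
    have [u E] := tupP sk; rewrite E (bigD1 u) //= eqxx big1 ?addr0 => [|v vu].
      by rewrite -E (inj_eq (@bs_inj _ _)) eq_sym mulrb.
    by rewrite (inj_eq (@tup_inj _ _)) eq_sym (negPf vu).
  rewrite mul0rn big1 // => u _; case: (eqVneq (bs s) (tup u)) => // E.
  by rewrite E size_tup eqxx in sk.
rewrite E mulmxA mxrankMfree //; apply/row_freeP; exists (sel K N k m).
apply/matrixP => u v; rewrite !mxE.
have /bsP[s Es] : (size (tup u) <= m)%N by rewrite size_tup.
rewrite (bigD1 s) //= !mxE -Es eqxx mul1r (inj_eq (@tup_inj _ _)) big1 ?addr0 // => t ts.
by rewrite !mxE Es (inj_eq (@bs_inj _ _)) (negPf ts) mul0r.
Qed.

Lemma homogE k : M *m homog k =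
  diag_mx (\row_e (rdeg (enum_val e) == k)%N%:R) *m M.
Proof.
apply/matrixP => e s; rewrite mul_mx_diag mul_diag_mx !mxE.
have [->|] := eqVneq (cf (genrow R 0 (enum_val e)) (bs s)) 0; first by rewrite mulr0 mul0r.
by move/of_degreeP: (@of_degree_genrow0 K N R m (enum_val e)) => /[apply] ->; rewrite mulrC.
Qed.

Lemma rank_ge k : (k <= m)%N ->
  \rank (M *m ge k) = (\rank (M *m sel K N k m) + \rank (M *m ge k.+1))%N.
Proof.
move=> km; rewrite -(rank_sel km) -(mxrank_mul_ker (M *m ge k) (ge k.+1)) addnC.
have geS : ge k *m ge k.+1 = ge k.+1.
  rewrite mulmx_diag; congr diag_mx; apply/rowP => s; rewrite !mxE -natrM mulnb.
  by case: (ltnP k) => [/ltnW -> //|_]; rewrite andbF.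
have geE : ge k = homog k + ge k.+1.
  rewrite /ge /homog -linearD /=; congr diag_mx; apply/rowP => s; rewrite !mxE.
  by case: ltngtP => _; rewrite ?addr0 ?add0r.
have geH : ge k *m homog k = homog k.
  rewrite mulmx_diag; congr diag_mx; apply/rowP => s; rewrite !mxE -natrM mulnb.
  by case: eqP => [->|_]; rewrite ?leqnn ?andbF.
have Hge : homog k *m ge k.+1 = 0.
  rewrite mulmx_diag -[RHS](linear0 (@diag_mx K _)); congr diag_mx.
  apply/rowP => s; rewrite !mxE -natrM mulnb.
  by case: eqP => [->|_] //; rewrite ltnn.
rewrite -mulmxA geS; congr (_ + _)%N; apply: eqmx_rank; apply/andP; split; last first.
  rewrite sub_capmx; apply/andP; split.
    rewrite -geH diag_mxC mulmxA homogE -mulmxA; exact: submxMl.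
  by apply/sub_kermxP; rewrite -mulmxA Hge mulmx0.
apply/row_subP => i; set r := row _ _.
have : (r <= M *m ge k :&: kermx (ge k.+1))%MS by apply: row_sub.
rewrite sub_capmx => /andP[/submxP[z rE] /sub_kermxP r0].
suff -> : r = z *m (M *m homog k) by apply: submxMl.
have E : r *m ge k = r.
  rewrite rE -!mulmxA; congr (_ *m (_ *m _)).
  rewrite mulmx_diag; congr diag_mx; apply/rowP => s; rewrite !mxE -natrM mulnb.
  by rewrite andbb.
by rewrite -[LHS]E geE mulmxDr r0 addr0 rE -!mulmxA geH.
Qed.

(** For hbar = 0 the row space splits by degree. This converts constancy of the ranks in each single
    degree into constancy of the dimension of J_m(0). *)
Lemma rank_split : \rank M = (\sum_(k < m.+1) \rank (M *m sel K N k m))%N.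
Proof.
have H j : (j <= m.+1)%N -> \rank M =
    (\sum_(k < j) \rank (M *m sel K N k m) + \rank (M *m ge j))%N.
  elim: j => [_|j IH jm].
    rewrite big_ord0 add0n; congr mxrank; rewrite -[LHS]mulmx1; congr (_ *m _).
    by apply/matrixP => s t; rewrite !mxE.
  rewrite big_ord_recr /= -addnA -rank_ge ?IH //; exact: ltnW.
rewrite (H m.+1) // [X in (_ + X)%N](_ : _ = 0%N) ?addn0 //.
apply/eqP; rewrite mxrank_eq0; apply/eqP/matrixP => e s; rewrite mul_mx_diag !mxE.
by rewrite ltnNge size_bs mulr0.
Qed.

End RankSplit.

Section Continuity.
Variables (K : numFieldType) (N : nat) (q0 : K) (Rq : K -> 'M[K]_(N * N)).
Hypothesis Rq_cts : cts_mx q0 Rq.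
Local Notation L := ('I_N * 'I_N)%type.

Lemma cts_coef i j k l : cts_at q0 (fun q => coef (Rq q) i j k l).
Proof. exact: Rq_cts. Qed.

Lemma cts_rel_mx m hbar : cts_mx q0 (fun q => rel_mx (Rq q) m hbar).
Proof.
move=> e s; set u := (enum_val e).1.1; set v := (enum_val e).1.2.
case Et : (enum_val e).2 => [[[i j] r] t].
pose h w : K^o := (u ++ w ++ v == bs s)%:R.
pose F q : K := if ((size u + size v).+2 <= m)%N then
  \sum_k \sum_l \sum_o \sum_p
    (coef (Rq q) k l i j * coef (Rq q) p t o l) * h [:: (k, o); (p, r)]
  - \sum_a \sum_b \sum_c \sum_d
    (coef (Rq q) b c a j * coef (Rq q) r t d c) * h [:: (i, a); (b, d)]
  - hbar * (\sum_a coef (Rq q) a t i j * h [:: (a, r)]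
             - \sum_b coef (Rq q) r t b j * h [:: (i, b)]) else 0.
apply: (@eq_cts _ _ F) => [q|].
  rewrite mxE genrowE /F -/u -/v; case: ifP => _; last by rewrite cf0.
  by rewrite cf_wlin wlin_sandwich Et wlin_rel.
rewrite /F; case: ((size u + size v).+2 <= m)%N; last exact: cts_cst.
have cc := cts_coef; have ck := @cts_cst K q0.
apply: cts_add; last first.
  apply: cts_opp; apply: cts_mul; first exact: ck.
  apply: cts_add; last apply: cts_opp; apply: cts_sum => a _; apply: cts_mul; by [exact: cc|exact: ck].
by apply: cts_add; last apply: cts_opp; do 4![apply: cts_sum => ? _];
  apply: cts_mul; [apply: cts_mul; exact: cc|exact: ck|apply: cts_mul; exact: cc|exact: ck].
Qed.

Lemma cts_lop (rho : K -> 'I_N -> 'I_N -> 'I_N -> 'I_N -> K) i phi s :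
  (forall x y a b, cts_at q0 (fun q => rho q x y a b)) ->
  cts_at q0 (fun q => lop (rho q) i phi s).
Proof.
move=> H; elim: i s phi => [|i IH] [|x s] phi /=; try exact: cts_cst; last exact: IH.
case: s => [|y s]; first exact: cts_cst.
by apply: cts_sum => p _; apply: cts_mul; [exact: H|exact: cts_cst].
Qed.

Lemma cts_intertwine n rep pth d (T1 T2 : K -> nat -> 'M[K]_d) Z : good n q0 ->
  {in tabs n n, forall a, rep a \in tabs n n} ->
  {in tabs n n, forall a, far_path (rep a) (pth a)} ->
  (forall i, cts_mx q0 (fun q => T1 q i)) -> (forall i, cts_mx q0 (fun q => T2 q i)) ->
  cts_mx q0 (fun q => intertwine q n rep pth (T1 q) (T2 q) Z).
Proof.
move=> q0g rT pf; case: d T1 T2 Z => [|d] T1 T2 Z c1 c2; first by case.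
move=> i j; rewrite /intertwine.
have c : cts_mx q0 (fun q => average q n (block_rep (T1 q) (T2 q)) rep pth
        (@block_mx K d.+1 d.+1 d.+1 d.+1 0 Z 0 0)).
  apply: cts_average => // k x y.
  apply: (@eq_cts _ _ (fun q => match fintype.split (x : 'I_(d.+1 + d.+1)), fintype.split (y : 'I_(d.+1 + d.+1)) with
    | inl a, inl b => T1 q k a b | inr a, inr b => T2 q k a b | _, _ => 0 end)).
    move=> q; rewrite /block_rep !mxE; case: fintype.split => a; rewrite !mxE; case: fintype.split => b; by rewrite ?mxE.
  by case: fintype.split => a; case: fintype.split => b; [exact: c1|exact: cts_cst|exact: cts_cst|exact: c2].
apply: (eq_cts _ (c (lshift d.+1 i) (rshift d.+1 j))) => q.
by rewrite !mxE.
Qed.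

Hypothesis near_hecke : \forall q \near q0, hecke_symmetry q (Rq q) /\ skew_invertible (Rq q).

(** Two lower semicontinuous ranks with constant sum cannot jump. The parameter m is m = k for the
    dimensions of part 1, and larger for the rank comparison at q = 1 in part 2. *)
Lemma near_rank k m : (k <= m)%N -> good k q0 -> \forall q \near q0,
  \rank (rel_mx (Rq q) m 0 *m sel K N k m) = \rank (rel_mx (Rq q0) m 0 *m sel K N k m).
Proof.
move=> km q0g; have [rep [pth [rT pf pe rp]]] := @tab_paths k k (leqnSn k).
have q0H : hecke_symmetry q0 (Rq q0) /\ skew_invertible (Rq q0) := nbhs_singleton near_hecke.
pose F q := intertwine_mx k q rep pth (rkernel (Rq q)).
pose G q := rel_mx (Rq q) m 0 *m sel K N k m.
have FG q : good k q -> hecke_symmetry q (Rq q) /\ skew_invertible (Rq q) ->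
    (\rank (F q) + \rank (G q))%N = #|{: k.-tuple L}|.
  move=> gq [Hh Hs]; apply: rank_intertwine_mx => //.
  - exact: rkernel_braid Hh.
  - exact: flip_rkernel_braid Hh.
  - exact: rkernel_hecke Hh.
  - exact: flip_rkernel_hecke Hh.
  - exact: rkernel_skew Hs.
  - by move=> f; apply: annihilates_rel.
have cG : cts_mx q0 G by apply: cts_mulmx; [exact: cts_rel_mx|exact: cts_mx_cst].
have cF : cts_mx q0 F.
  move=> z; case/mxvec_indexP => s t.
  have c : cts_mx q0 (fun q => intertwine q k rep pth (lop_mx k (rkernel (Rq q)))
    (fun i => (lop_mx k (flip_kernel (rkernel (Rq q))) i)^T) (vec_mx (delta_mx 0 z))).
    apply: cts_intertwine => // i x y.
      apply: (@eq_cts _ _ (fun q => lop (rkernel (Rq q)) i (fun w => (w == tup y)%:R) (tup x))).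
        by move=> q; rewrite mxE.
      by apply: cts_lop => *; apply: cts_coef.
    apply: (@eq_cts _ _ (fun q => lop (flip_kernel (rkernel (Rq q))) i (fun w => (w == tup x)%:R) (tup y))).
      by move=> q; rewrite !mxE.
    by apply: cts_lop => *; apply: cts_coef.
  by apply: (eq_cts _ (c s t)) => q; rewrite mxE mxvecE.
have H0 := FG _ q0g q0H.
near=> q.
have H1 : (\rank (F q) + \rank (G q))%N = #|{: k.-tuple L}|.
  apply: FG; first by near: q; exact: near_good.
  by near: q.
have H2 : (\rank (F q0) <= \rank (F q))%N by near: q; exact: rank_lsc cF.
have H3 : (\rank (G q0) <= \rank (G q))%N by near: q; exact: rank_lsc cG.
have key (a b c d n : nat) : (a + b)%N = n -> (c + d)%N = n -> (c <= a)%N -> (d <= b)%N -> b = d.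
  by clear; lia.
exact: key H1 H0 H2 H3.
Unshelve. all: by end_near.
Qed.

End Continuity.

(** * The associated graded algebra *)

Section AssociatedGradedIso.
Variables (K : fieldType) (N : nat) (R : 'M[K]_(N * N)) (hbar : K).
Local Notation L := ('I_N * 'I_N)%type.
Local Notation FA := (freealg K N).
Local Notation A := (mrea R hbar).
Local Notation F := (mrea_fil R hbar).
Local Notation GR := (gr F).

Lemma pi_mul h (x y : FA) : \pi_(mrea R h) (x * y) = \pi_(mrea R h) x * \pi_(mrea R h) y.
Proof. exact: pi_quot_mul. Qed.

Lemma pi_one h : \pi_(mrea R h) 1 = 1.
Proof. exact: pi_quot_one. Qed.

(** The class of the word s, placed in Rees degree [size s]; modulo [gr_ideal] this is its
    symbol. *)
Definition word_poly (s : seq L) : {poly A} := (\pi_A (mono K s))%:P * 'X^(size s).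

Lemma coef_word_poly s k : (word_poly s)`_k = \pi_A (hc k (mono K s)).
Proof.
rewrite coefCM coefXn /hc wlin_mono eq_sym; case: eqP => _; first by rewrite mulr1.
by rewrite mulr0 pi0.
Qed.

Lemma rees_word_subproof s : rees_pred F (word_poly s).
Proof.
apply/asboolP => k; rewrite coef_word_poly; exists (hc k (mono K s)) => //.
by apply: of_degree_le_of; apply: of_degree_hc.
Qed.

Definition rees_word s : rees F := Rees (rees_word_subproof s).

Lemma rees_word0 : rees_word [::] = 1.
Proof. by apply: val_inj; rewrite /= /word_poly mono_nil pi_one mul1r expr0. Qed.

Lemma rees_word_cat s t : rees_word (s ++ t) = rees_word s * rees_word t.
Proof.
apply: val_inj; rewrite /= /word_poly -monoM pi_mul polyCM size_cat exprD.
by rewrite -!mulrA; congr (_ * _); rewrite !mulrA; congr (_ * _); rewrite commr_polyXn.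
Qed.

Definition symb : FA -> rees F := wlin rees_word.

Lemma symbM x y : symb (x * y) = symb x * symb y.
Proof. exact: (wlin_mul rees_word0 rees_word_cat). Qed.

Lemma symbP c x y : symb (c *: x + y) = c *: symb x + symb y.
Proof. exact: wlinP. Qed.

Lemma symbB x y : symb (x - y) = symb x - symb y.
Proof. exact: (linearB (wlin rees_word)). Qed.

Lemma symb1 : symb 1 = 1.
Proof. by rewrite -mono_nil /symb wlin_mono rees_word0. Qed.

Lemma coef_symb x k : (val (symb x))`_k = \pi_A (hc k x).
Proof.
elim/freealg_ind: x => [s|c x y Hx Hy|].
- by rewrite /symb wlin_mono coef_word_poly.
- rewrite symbP hcP pi_linear coefD coefCM mulr_algl.
  by congr (_ *: _ + _); [exact: Hx|exact: Hy].
have -> : symb 0 = 0 by apply: (linear0 (wlin _)).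
by rewrite coef0 hc0 pi0.
Qed.

Hypothesis pbw : forall k x, mrea_ideal R hbar x -> of_degree_le k x -> mrea_ideal R 0 (hc k x).

(** Identifies the kernel of the map from the free algebra to the graded algebra. That it lies in
    the ideal for hbar = 0 is the PBW property; the converse holds because the quadratic part of a
    relation equals a linear element in the quotient. *)
Lemma gr_ideal_symb x : gr_ideal (symb x) <-> mrea_ideal R 0 x.
Proof.
split.
  move=> /asboolP H; have [n xn] := of_degree_le_ex x.
  rewrite (sum_hc xn).
  (* If the class of [hc k x] lies in F_(k-1), then [hc k x] minus some y of degree below k is in
     the ideal, and its leading part is [hc k x]. For k = 0 the class itself is zero, as F_(-1) =
     0. *)
  have Hk k : mrea_ideal R 0 (hc k x).
    have := H k; rewrite coef_symb; case: k => [|k] /=.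
      move=> E; rewrite -[hc 0 x](@hc_id _ _ 0); last exact: of_degree_hc.
      apply: pbw; last by apply: of_degree_le_of; apply: of_degree_hc.
      by rewrite -[hc 0 x]subr0; apply/pi_eq; rewrite E pi0.
    move=> [y yk E].
    have E1 : hc k.+1 (- 1 *: y + hc k.+1 x) = hc k.+1 x.
      rewrite hcP (hc_le yk) // scaler0 add0r hc_id //; exact: of_degree_hc.
    rewrite -E1; apply: pbw.
      by rewrite scaleN1r addrC; apply/pi_eq; rewrite E.
    apply: of_degree_leD; first exact: of_degree_leS yk.
    by apply: of_degree_le_of; apply: of_degree_hc.
  elim/big_rec: _ => [|k y _ Hy]; first exact: ideal0.
  by rewrite -[hc _ _]scale1r; apply: idealD.
move: x; apply: mrea_ideal_ind.
- have -> : symb 0 = 0 by apply: (linear0 (wlin _)).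
  exact: (gr_ideal_zmod F).1.
- move=> c x y Hx Hy; rewrite symbP -mulr_algl -[symb y]opprK.
  apply: (gr_ideal_zmod F).2; first exact: (gr_ideal_proper F).2.
  by rewrite -sub0r; apply: (gr_ideal_zmod F).2 => //; apply: (gr_ideal_zmod F).1.
move=> u v t; rewrite symbM symbM; apply: gr_ideal_mulr; apply: (gr_ideal_proper F).2.
apply/asboolP => k; rewrite coef_symb.
have D := @of_degree_rel0 K N R t.
have [<-|k2] := eqVneq 2%N k; last first.
  by rewrite (hc_neq D k2) pi0; apply: fil_pred0.
rewrite (hc_id D) /=; exists (hbar *: rel_lin R t).
  by apply: of_degree_le_of; apply: of_degreeZ; apply: of_degree_rel_lin.
apply/esym/pi_eq; rewrite -mrea_rel_split; apply/asboolP.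
by exists [:: (1, t, 1)]; rewrite big_seq1 mul1r mulr1.
Qed.

Lemma gr_eq (x y : rees F) : \pi_GR x = \pi_GR y <-> gr_ideal (x - y).
Proof.
have H := @Defs.eqquotP (rees F) (gr_ideal (F := F)) x y.
split=> [E|E]; first by rewrite -[gr_ideal _]H; apply/eqP.
by apply/eqP; rewrite H.
Qed.

Lemma gr_symb_eq x y : \pi_GR (symb x) = \pi_GR (symb y) <->
  \pi_(rea R) x = \pi_(rea R) y.
Proof.
split=> [/gr_eq|/pi_eq H]; first by rewrite -symbB => /gr_ideal_symb /pi_eq.
by apply/gr_eq; rewrite -symbB; apply/gr_ideal_symb.
Qed.

Lemma hc_sum_hc n (y : nat -> FA) k : ((n <= k)%N -> y k = 0) ->
  hc k (\sum_(j < n) hc j (y j)) = hc k (y k).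
Proof.
move=> y0; apply: cf_inj => s; apply: (etrans (cf_hc _ _ _)); apply: (etrans _ (esym (cf_hc _ _ _))).
case: eqP => // sk; rewrite cf_sum; under eq_bigr => j _ do rewrite cf_hc sk.
have [kn|kn] := ltnP k n.
  rewrite (bigD1 (Ordinal kn)) //= eqxx big1 ?addr0 // => j jk.
  by case: eqP => // kj; case/eqP: jk; apply: val_inj.
rewrite (y0 kn) cf0 big1 // => j _; case: eqP => // kj.
by move: (ltn_ord j); rewrite -kj ltnNge kn.
Qed.

(* Leading parts: [p_k = \pi y_k] with [y_k] of degree at most [k], and only the
   component of degree [k] of [y_k] matters modulo [F_(k-1)]. *)
Lemma gr_symb_surj (p : rees F) : exists2 x, \pi_GR (symb x) = \pi_GR p &
  forall k, (forall i, i != k -> (val p)`_i = 0) -> of_degree k x.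
Proof.
have H k : exists y : FA, of_degree_le k y /\ \pi_A y = (val p)`_k /\ ((val p)`_k = 0 -> y = 0).
  have [p0|p0] := eqVneq (val p)`_k 0.
    by exists 0; split; [exact: of_degree_le0|rewrite p0 pi0].
  have [y yk E] := reesP p k.
  by exists y; do !split=> //; rewrite -E; move=> E0; rewrite -E E0 eqxx in p0.
have [y yP] := choice H; pose n := size (val p).
exists (\sum_(k < n) hc k (y k)); last first.
  move=> k Hk; apply: of_degree_sum => i _.
  have [->|ik] := eqVneq (i : nat) k; first exact: of_degree_hc.
  by have [_ [_ ->]] := yP i; rewrite ?Hk // hc0; apply: of_degree0.
apply/gr_eq/asboolP => k; rewrite raddfB coefB coef_symb /=.
have -> : hc k (\sum_(j < n) hc j (y j)) = hc k (y k).
  by apply: hc_sum_hc => nk; have [_ [_ ->]] := yP k; rewrite // nth_default.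
have [yk [<- _]] := yP k.
have -> : \pi_A (hc k (y k)) - \pi_A (y k) = \pi_A (-1 *: y k + hc k (y k)).
  by rewrite pi_linear scaleN1r addrC.
case: k yk => [|k] yk.
  rewrite hc_id; first by rewrite scaleN1r addNr pi0.
  by apply/of_degreeP => s s0; move/of_degree_leP: yk => /(_ s s0); rewrite leqn0 => /eqP.
exists (-1 *: y k.+1 + hc k.+1 (y k.+1)) => //; apply/of_degree_leP => s.
rewrite cfD cfZ cf_hc; case: (eqVneq (size s) k.+1) => [_|sk]; first by rewrite mulN1r addNr eqxx.
rewrite addr0 mulN1r oppr_eq0; move/of_degree_leP: yk => /[apply].
by rewrite leq_eqVlt (negPf sk).
Qed.

(** The equivalence determines x uniquely, so the map obtained by choice is well defined, and it
    carries the information for injectivity too. *)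
Lemma gr_lift_ex (z : GR) : exists x : rea R, forall y, \pi_GR (symb y) = z <-> \pi_(rea R) y = x.
Proof.
have [x E _] := gr_symb_surj (repr z); exists (\pi_(rea R) x) => y.
by rewrite -[z]reprK -E; apply: gr_symb_eq.
Qed.

Definition gr_to_rea (z : GR) : rea R := projT1 (cid (gr_lift_ex z)).

Lemma gr_to_reaE x : gr_to_rea (\pi_GR (symb x)) = \pi_(rea R) x.
Proof. by rewrite /gr_to_rea; case: cid => w H /=; apply/esym/H. Qed.

Lemma gr_symbP (z : GR) : exists x, z = \pi_GR (symb x).
Proof. by have [x E _] := gr_symb_surj (repr z); exists x; rewrite E reprK. Qed.

Lemma pi_gr_linear (c : K) (x y : rees F) : \pi_GR (c *: x + y) = c *: \pi_GR x + \pi_GR y.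
Proof.
rewrite (raddfD \pi_GR); congr (_ + _).
exact: (@pi_quot_scale K (rees F)).
Qed.

Lemma gr_to_rea_linear : linear gr_to_rea.
Proof.
move=> c z w; have [x ->] := gr_symbP z; have [y ->] := gr_symbP w.
by rewrite -pi_gr_linear -symbP !gr_to_reaE; apply: pi_linear.
Qed.

HB.instance Definition _ := GRing.isLinear.Build K GR (rea R) *:%R gr_to_rea gr_to_rea_linear.

Lemma gr_to_rea_monoid : monoid_morphism gr_to_rea.
Proof.
split.
  have -> : 1 = \pi_GR (symb 1) by rewrite symb1; apply/esym/pi_quot_one.
  by rewrite gr_to_reaE; apply: pi_one.
move=> z w; have [x ->] := gr_symbP z; have [y ->] := gr_symbP w.
have -> : \pi_GR (symb x) * \pi_GR (symb y) = \pi_GR (symb (x * y)).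
  by rewrite symbM; apply/esym/pi_quot_mul.
by rewrite !gr_to_reaE; apply: pi_mul.
Qed.

HB.instance Definition _ := GRing.isMonoidMorphism.Build GR (rea R) gr_to_rea gr_to_rea_monoid.

Lemma gr_rea_iso : graded_iso (gr_comp F) (rea_comp R).
Proof.
exists gr_to_rea; split.
  exists (fun x : rea R => \pi_GR (symb (repr x))) => [z|x]; last first.
    exact: (etrans (gr_to_reaE _) (reprK _)).
  have [x ->] := gr_symbP z; rewrite -[X in repr X]/(gr_to_rea (\pi_GR (symb x))) gr_to_reaE.
  by apply/gr_symb_eq; rewrite reprK.
move=> k; apply/seteqP; split=> [_ [_ [p pk <-] <-]|_ [x xk <-]].
  have [x E xk] := gr_symb_surj p; exists x; first exact: xk.
  by rewrite -E; exact: (esym (gr_to_reaE x)).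
exists (\pi_GR (symb x)); last exact: gr_to_reaE.
by exists (symb x) => // i ik; rewrite coef_symb (hc_neq xk) ?pi0 // eq_sym.
Qed.

End AssociatedGradedIso.

(** * Connectedness and the main theorem *)

Section Topology.

Lemma connected_const (T : topologicalType) (S : set T) (f : T -> nat) : connected S ->
  (forall p, S p -> \forall q \near p, S q -> f q = f p) ->
  forall p q, S p -> S q -> f p = f q.
Proof.
move=> cS loc p q Sp Sq.
pose I (A : set T) := interior A.
have : S `&` [set x | f x = f p] = S.
  apply: cS; first by exists p.
  - exists (I [set x | S x -> f x = f p]); first exact: open_interior.
    apply/seteqP; split=> x [Sx fx]; split=> //.
      by apply: filterS (loc x Sx) => y Hy /Hy; rewrite fx.
    by move: (interior_subset fx) => /(_ Sx).
  exists (~` I [set x | S x -> f x <> f p]).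
    by apply: open_closedC; exact: open_interior.
  apply/seteqP; split=> x [Sx fx]; split=> //.
    by move=> /interior_subset /(_ Sx).
  apply: contrapT => nfx; apply: fx.
  by apply: filterS (loc x Sx) => y Hy /Hy ->.
move=> /seteqP[_ /(_ q Sq)] [_ fq]; exact/esym.
Qed.

(** Replace f by its value g on small punctured neighbourhoods. Then g agrees with f where P holds,
    is locally constant on all of U, bad points included, and is constant by connectedness. *)
Lemma punctured_const (K : numFieldType) (U : set K) (P : K -> Prop) (f : K -> nat) :
  connected U ->
  (forall q, U q -> exists n, \forall p \near q^', f p = n /\ U p) ->
  (forall q, U q -> P q -> \forall p \near q, f p = f q) ->
  forall p q, U p -> P p -> U q -> P q -> f p = f q.
Proof.
move=> cU pf lf p q Up Pp Uq Pq.
have /choice [g gP] : forall x, exists n, U x -> \forall p \near x^', f p = n /\ U p.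
  by move=> x; have [/pf [n Hn]|nU] := pselect (U x); [exists n|exists 0%N].
have gE x n : U x -> (\forall p \near x^', f p = n) -> g x = n.
  by move=> Ux Hn; have [y [[<- _] <-]] := filter_ex (filterI (gP x Ux) Hn).
have gP' x : U x -> P x -> g x = f x.
  by move=> Ux Px; apply: gE => //; apply: nbhs_dnbhs; apply: lf.
rewrite -(gP' p) // -(gP' q) //; apply: (connected_const cU _ Up Uq) => {p q Up Pp Uq Pq}.
move=> x Ux; have := nbhs_interior (gP x Ux : nbhs x (fun y => y != x -> f y = g x /\ U y)).
apply: filterS => y Hy Uy; have [-> //|yx] := eqVneq y x.
apply: gE => //; apply: nbhs_dnbhs.
have Hyx : \forall z \near y, z != x.
  have := @cts_near_neq0 K y (fun z => z - x).
  rewrite subr_eq0 => H; have {H} := H (cts_add (@cts_id _ _) (@cts_cst _ _ _)) yx.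
  by apply: filterS => z; rewrite subr_eq0.
by apply: filterS2 Hy Hyx => z Hz zx; have [-> _] := Hz zx.
Qed.

Lemma near_expr_neq1 (K : numFieldType) (q0 : K) m : (0 < m)%N -> q0 != 0 ->
  \forall q \near q0^', q ^+ m != 1.
Proof.
move=> m0 q00; have [E|ne] := eqVneq (q0 ^+ m) 1; last first.
  apply: nbhs_dnbhs; have := @cts_near_neq0 K q0 (fun z => z ^+ m - 1).
  rewrite subr_eq0 => H.
  have {H} := H (cts_add (@cts_exp _ _ m _ (@cts_id _ _)) (@cts_cst _ _ _)) ne.
  by apply: filterS => z; rewrite subr_eq0.
(* The quotient of q^m - q0^m by q - q0; at q0 it is m q0^(m-1), nonzero in characteristic zero, so
   the root of unity q0 is isolated. *)
have c : cts_at q0 (fun q => \sum_(i < m) q ^+ (m.-1 - i) * q0 ^+ i).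
  apply: cts_sum => i _; apply: cts_mul; last exact: cts_cst.
  by apply: cts_exp; apply: cts_id.
have s0 : \sum_(i < m) q0 ^+ (m.-1 - i) * q0 ^+ i != 0.
  rewrite (eq_bigr (fun=> q0 ^+ m.-1)) => [|i _]; last first.
    by rewrite -exprD subnK // -ltnS prednK.
  by rewrite sumr_const card_ord mulrn_eq0 negb_or -lt0n m0 expf_neq0.
have H1 := nbhs_dnbhs (cts_near_neq0 c s0).
apply: filterS2 H1 (nbhs_dnbhs_neq q0) => q sq qq0.
by rewrite -subr_eq0 -E subrXX mulf_neq0 // subr_eq0.
Qed.

Lemma near_punctured_good (K : numFieldType) n (q0 : K) : q0 != 0 ->
  \forall q \near q0^', good n q.
Proof.
move=> q00.
have H0 : \forall q \near q0^', q != 0.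
  by apply: nbhs_dnbhs; apply: (cts_near_neq0 (@cts_id _ _)).
have H1 : \forall q \near q0^', forall m, m \in iota 1 (4 * n.+1) -> q ^+ m != 1.
  by apply: near_all => m; rewrite mem_iota => /andP[m0 _]; apply: near_expr_neq1.
apply: filterS2 H0 H1 => q qq0 H; apply: good_expr => // m mn.
by apply: H; rewrite mem_iota; lia.
Qed.

Section Complex.
Variable R : realType.

(* Named so that the topology of [numFieldType] is inferred on [R[i]]. *)
Definition complex_field : numFieldType := R[i].
Local Notation C := complex_field.
Local Open Scope complex_scope.

Lemma cvg_real_complex (t : R) : (x%:C : C) @[x --> t] --> (t%:C : C).
Proof.
apply/(@cvgrPdist_lt C C) => e; rewrite ltcE /= => /andP[/eqP ie re].
have -> : e = (complex.Re e)%:C by case: e ie {re} => a b /= ->.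
near=> x; rewrite -rmorphB normc_def /= expr0n addr0 sqrtr_sqr ltcR.
near: x; exact: cvgr_dist_lt.
Unshelve. all: by end_near.
Qed.

Lemma segment_const (f : C -> nat) (q0 u v : C) :
  (forall t : R, 0 <= t <= 1 -> \forall q \near q0 + (u + t%:C * (v - u)),
     f q = f (q0 + (u + t%:C * (v - u)))) ->
  f (q0 + u) = f (q0 + v).
Proof.
move=> H; pose g (t : R) : C := q0 + (u + t%:C * (v - u)).
have cg : continuous g.
  move=> t; apply: cvgD; first exact: cvg_cst.
  apply: cvgD; first exact: cvg_cst.
  by apply: cvgM; [exact: cvg_real_complex|exact: cvg_cst].
have cS : connected (g @` `[0, 1]%classic).
  apply: connected_continuous_connected; first exact: segment_connected.
  exact: continuous_subspaceT.
have -> : q0 + u = g 0 by rewrite /g mul0r addr0.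
have -> : q0 + v = g 1 by rewrite /g mul1r (addrC u) subrK.
apply: (connected_const cS).
- move=> _ [t t01 <-]; have /H : 0 <= t <= 1 by move: t01; rewrite /= in_itv.
  by apply: filterS => q -> _.
- by exists 0 => //; rewrite /= in_itv /= lexx ler01.
by exists 1 => //; rewrite /= in_itv /= lexx ler01.
Qed.

(* The segment from [u] to [w * u] avoids [0] unless [w] is a nonpositive real. *)
Lemma segment_neq0 (u w : C) (t : R) : u != 0 -> 0 <= t <= 1 ->
  (complex.Im w != 0) || (0 < complex.Re w) -> u + t%:C * (w * u - u) != 0.
Proof.
case: w => a b u0 /andP[t0 t1] /= H.
have -> : u + t%:C * ((a +i* b) * u - u) = (1 + t%:C * ((a +i* b) - 1)) * u by ring.
rewrite mulf_neq0 //; apply/eqP => E.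
have /= Ei := congr1 (@complex.Im R) E; have /= Er := congr1 (@complex.Re R) E.
case/orP: H => H.
  have : t * b = 0 by move: Ei; simpc; lra.
  move/eqP; rewrite mulf_eq0 (negPf H) orbF => /eqP tE.
  by move: Er; rewrite tE; simpc; lra.
by move: Er; simpc; nra.
Qed.

(** A punctured disc is path connected: two points are joined by their segment, or by two segments
    when their ratio is a negative real. Along these f is locally constant. *)
Lemma complex_punctured_const (U : set C) (P : C -> Prop) (f : C -> nat) q0 :
  open U -> U q0 -> (\forall q \near q0^', P q) ->
  (forall q, U q -> P q -> \forall p \near q, f p = f q) ->
  exists n, \forall p \near q0^', f p = n /\ U p.
Proof.
move=> oU Uq0 nP lf.
have nU : \forall q \near q0, U q by exact: open_nbhs_nbhs.
have /nbhs_ballP[e /= e0 He] : \forall q \near q0, U q /\ (q != q0 -> P q).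
  by apply: filterS2 nU (nP : nbhs q0 (fun q => q != q0 -> P q)) => q.
have B z : z != 0 -> `|z| < e -> \forall q \near q0 + z, f q = f (q0 + z).
  move=> z0 ze.
  have [Uz Pz] : U (q0 + z) /\ (q0 + z != q0 -> P (q0 + z)).
    by apply: He; rewrite -ball_normE /= opprD addNKr normrN.
  by apply: lf => //; apply: Pz; rewrite -subr_eq0 addrC addKr.
have conv (u v : C) (t : R) : `|u| < e -> `|v| < e -> 0 <= t <= 1 -> `|u + t%:C * (v - u)| < e.
  move=> ue ve /andP[t0 t1].
  have -> : u + t%:C * (v - u) = (1 - t)%:C * u + t%:C * v.
    by rewrite rmorphB rmorph1; ring.
  apply: (le_lt_trans (ler_normD _ _)); rewrite !normrM.
  have nr (x : R) : 0 <= x -> `|x%:C| = x%:C :> C by move=> x0; rewrite ger0_norm // lecR.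
  rewrite !nr ?subr_ge0 //.
  have -> : e = (1 - t)%:C * e + t%:C * e by rewrite -mulrDl -rmorphD subrK rmorph1 mul1r.
  have [->|tn0] := eqVneq t 0.
    by rewrite subr0 rmorph0 !mul0r !addr0 rmorph1 !mul1r.
  apply: ler_ltD.
    by apply: ler_wpM2l; [rewrite lecR subr_ge0|apply: ltW].
  by rewrite ltr_pM2l // ltcR lt_def tn0.
have seg (u w : C) : u != 0 -> `|u| < e -> `|w * u| < e ->
    (complex.Im w != 0) || (0 < complex.Re w) -> f (q0 + u) = f (q0 + w * u).
  move=> u0 ue we wP; apply: segment_const => t t01.
  by apply: B; [exact: segment_neq0|exact: conv].
have key (u v : C) : u != 0 -> v != 0 -> `|u| < e -> `|v| < e -> f (q0 + u) = f (q0 + v).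
  move=> u0 v0 ue ve; pose w := v / u; have vE : v = w * u by rewrite divfK.
  have w0 : w != 0 by rewrite mulf_neq0 ?invr_neq0.
  have [wP|] := boolP ((complex.Im w != 0) || (0 < complex.Re w)).
    by rewrite vE; apply: seg; rewrite -?vE.
  rewrite negb_or negbK => /andP[/eqP wi wr].
  have wr0 : complex.Re w != 0.
    by apply: contra w0 => /eqP wr0; rewrite eq_complex wi wr0 !eqxx.
  (* The segment from u to v meets the centre, so go through i u instead, which has the same modulus
     as u. *)
  have ni : `|'i%C : C| = 1 by rewrite normc_def /= expr0n expr1n add0r sqrtr1.
  have iu : `|'i%C * u| < e by rewrite normrM ni mul1r.
  have i0 : ('i%C : C) != 0 by rewrite -normr_eq0 ni oner_neq0.
  rewrite (@seg u 'i%C) //; last by rewrite /= oner_neq0.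
  have vE' : v = (w * - 'i%C) * ('i%C * u).
    by rewrite mulrA -[_ * - _ * _]mulrA mulNr -expr2 sqr_i opprK mulr1.
  rewrite vE'; apply: seg => //; first by rewrite mulf_neq0.
    by rewrite -vE'.
  apply/orP; left; move: wi wr0; case: (w) => a b /= -> a0.
  by rewrite mulrN1 mul0r addr0 oppr_eq0 ?mulr1.
have e2 : `|e / 2| < e by rewrite ger0_norm ?divr_ge0 ?ltW // ltr_pdivrMr // ltr_pMr // ltr1n.
have e20 : e / 2 != 0 by rewrite mulf_neq0 ?invr_neq0 ?gt_eqF ?pnatr_eq0.
exists (f (q0 + e / 2)).
have nb : \forall q \near q0^', ball q0 e q by apply: nbhs_dnbhs; exact: nbhsx_ballx.
apply: filterS2 nb (nbhs_dnbhs_neq q0) => q qe qn; split; last by have [] := He q qe.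
have -> : q = q0 + (q - q0) by rewrite addrC subrK.
apply: key => //; first by rewrite subr_eq0.
by move: qe; rewrite -ball_normE /= distrC.
Qed.

End Complex.
End Topology.

(** * Continuity of power series and constancy of ranks along the family *)

Lemma sum_geometric_le (K : numFieldType) (x : K) n : 0 <= x -> x <= 2^-1 ->
  \sum_(k < n) x ^+ k.+1 <= 2 * x.
Proof.
move=> x0 x2; elim: n => [|n IH]; first by rewrite big_ord0 mulr_ge0.
rewrite big_ord_recl expr1 -[2]/(1 + 1) mulrDl mul1r lerD2l.
rewrite (eq_bigr (fun k : 'I_n => x * x ^+ k.+1)); last by move=> k _; rewrite -exprS.
rewrite -mulr_sumr -[leRHS]mulr1 ler_wpM2l //.
apply: (le_trans IH); rewrite -[leRHS](@mulfV _ (2 : K)) ?pnatr_eq0 //.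
by rewrite ler_pM2l.
Qed.

(** Only pointwise convergence near a is assumed. Convergence at the single point a + r bounds |c_n|
    r^n, and comparison with a geometric series then bounds |f z - c_0| by a multiple of |z - a|. *)
Lemma analytic_cts (K : numFieldType) (f : K -> K) a : analytic_at f a -> cts_at a f.
Proof.
move=> [c Hc].
have fa : f a = c 0%N.
  have H := nbhs_singleton Hc.
  apply: (@cvg_unique K (@norm_hausdorff K K) _ _ _ _ H).
  apply: cvg_near_cst; exists 1%N => // n /= n0.
  rewrite /series /= big_mkord; case: n n0 => // n _.
  rewrite big_ord_recl subrr expr0 mulr1 big1 ?addr0 // => i _.
  by rewrite expr0n mulr0.
have [e /= e0 He] := (nbhs_ballP _ _).1 Hc.
pose r := e / 2; have r0 : 0 < r by rewrite divr_gt0.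
have /He Hr : ball a e (a + r).
  rewrite -ball_normE /= opprD addNKr normrN gtr0_norm //.
  by rewrite ltr_pdivrMr // ltr_pMr // ltr1n.
have [M M0 HM] : exists2 M : K, 0 < M & forall n, `|c n| * r ^+ n <= M.
  have [N _ HN] : \forall n \near \oo, `|f (a + r) - series (fun n => c n * (a + r - a) ^+ n) n| < 1.
    by have /cvgrPdist_lt := Hr; apply.
  (* Beyond N every term is a difference of two partial sums that both lie within 1 of the limit,
     hence at most 2; the finitely many earlier terms are added to the bound. *)
  exists (2 + \sum_(n < N) `|c n| * r ^+ n).
    by rewrite ltr_wpDr // sumr_ge0 // => i _; rewrite mulr_ge0 // exprn_ge0 // ltW.
  move=> n; have [nN|nN] := ltnP n N.
    rewrite (bigD1 (Ordinal nN)) //= addrCA lerDl addr_ge0 // sumr_ge0 // => i _.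
    by rewrite mulr_ge0 // exprn_ge0 // ltW.
  apply: le_trans (_ : 2 <= _); last first.
    by rewrite lerDl sumr_ge0 // => i _; rewrite mulr_ge0 // exprn_ge0 // ltW.
  have H1 := HN n nN; have H2 := HN n.+1 (leq_trans nN (leqnSn n)).
  have -> : `|c n| * r ^+ n = `|c n * (a + r - a) ^+ n|.
    by rewrite addrAC subrr add0r normrM normrX (gtr0_norm r0).
  have -> : c n * (a + r - a) ^+ n =
      (f (a + r) - series (fun n => c n * (a + r - a) ^+ n) n) -
      (f (a + r) - series (fun n => c n * (a + r - a) ^+ n) n.+1).
    by rewrite seriesSr; ring.
  by apply: (le_trans (ler_normB _ _)); rewrite -[2]/(1 + 1) lerD // ltW.
apply/(@cvgrPdist_lt K K K (nbhs a) (nbhs_filter a)) => eps eps0; rewrite fa.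
have near_a d : 0 < d -> \forall z \near a, `|a - z| < d.
  exact: (@cvgrPdist_lt K K K (nbhs a) (nbhs_filter a) id a).1 (@cts_id K a) d.
near=> z.
have Hz : (series (fun n => c n * (z - a) ^+ n) @ \oo --> f z) by near: z.
have [n Hn n0] : exists2 n, `|f z - series (fun n => c n * (z - a) ^+ n) n| < eps / 2 & (0 < n)%N.
  have /cvgrPdist_lt /(_ (eps / 2)) := Hz; rewrite divr_gt0 // => /(_ isT) [n _ Hn].
  by exists n.+1 => //; apply: Hn => /=.
pose x := `|z - a| / r.
have x0 : 0 <= x by rewrite divr_ge0 // ltW.
have x2 : x <= 2^-1.
  rewrite ler_pdivrMr // -normrN opprB ltW //; near: z; apply: near_a.
  by rewrite mulr_gt0.
have xe : M * (2 * x) <= eps / 2.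
  have -> : M * (2 * x) = `|a - z| * (M * 2 / r) by rewrite distrC /x; ring.
  have Mr : 0 < M * 2 / r by rewrite divr_gt0 // mulr_gt0.
  rewrite -ler_pdivlMr // ltW //; near: z; apply: near_a.
  by apply: divr_gt0; apply: divr_gt0 => //; apply: mulr_gt0.
have S : `|series (fun n => c n * (z - a) ^+ n) n - c 0%N| <= M * (2 * x).
  rewrite /series /= big_mkord; case: n n0 {Hn} => // n _.
  rewrite big_ord_recl expr0 mulr1 addrC addKr.
  apply: (le_trans (ler_norm_sum _ _ _)).
  apply: le_trans (_ : M * \sum_(k < n) x ^+ k.+1 <= _); last first.
    by apply: ler_wpM2l; [exact: ltW|exact: sum_geometric_le].
  rewrite mulr_sumr; apply: ler_sum => k _.
  rewrite normrM normrX /x expr_div_n mulrA ler_pdivlMr ?exprn_gt0 //.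
  rewrite mulrAC ler_wpM2r ?exprn_ge0 //; exact: HM.
rewrite distrC; have -> : f z - c 0%N = (f z - series (fun n => c n * (z - a) ^+ n) n) +
  (series (fun n => c n * (z - a) ^+ n) n - c 0%N) by rewrite addrA subrK.
apply: (le_lt_trans (ler_normD _ _)).
rewrite [eps](splitr eps); apply: ltr_leD => //; exact: le_trans xe.
Unshelve. all: by end_near.
Qed.

(** Over the reals U is an interval of positive numbers, and such a number is 1 or not a root of
    unity, so every point is good. Over the complex numbers bad points may exist but have good
    punctured neighbourhoods. *)
Lemma const_good (R : realType) (K : numFieldType) (hK : real_or_complex R K) (n : nat) (U : set K)
    (f : K -> nat) :
  open U -> connected U -> U 1 -> ~ U 0 ->
  (forall q, U q -> good n q -> \forall p \near q, f p = f q) ->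
  forall q, U q -> good n q -> f q = f 1.
Proof.
case: hK U f => [|] U f oU cU U1 nU0 lf q Uq gq.
  have pos p : U p -> 0 < p.
    move=> Up; rewrite ltNge; apply/negP => p0; apply: nU0.
    by move/connected_intervalP: cU => /(_ p 1 Up U1); apply; rewrite p0 ler01.
  apply: (connected_const cU _ Uq U1) => p Up.
  have gp : good n p.
    apply: good_generic; first by rewrite gt_eqF ?pos.
    have [->|p1] := eqVneq p 1; [by left|right=> m m0].
    by rewrite unity_rootE pexpr_eq1 ?ltW ?pos.
  by apply: filterS (lf p Up gp) => x ->.
apply: (punctured_const cU (P := good n)) => // [p Up|]; last exact: good1.
apply: (@complex_punctured_const R U (good n)) => //.
apply: near_punctured_good; apply/eqP => p0; apply: nU0; by rewrite -p0.
Qed.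

Section Family.
Variables (R : realType) (K : numFieldType) (hK : real_or_complex R K) (N : nat).
Variables (U : set K) (Rq : K -> 'M[K]_(N * N)).
Hypothesis U_open : open U.
Hypothesis U_connected : connected U.
Hypothesis U1 : U 1.
Hypothesis Rq_hecke : forall q : K, U q -> hecke_symmetry q (Rq q).
Hypothesis Rq_skew : forall q : K, U q -> skew_invertible (Rq q).
Hypothesis Rq_analytic : analytic_on U Rq.

Let cts q : U q -> cts_mx q Rq.
Proof. by move=> Uq i j; apply: analytic_cts; apply: Rq_analytic. Qed.

Let neq0 q : U q -> q != 0. Proof. by case/Rq_hecke. Qed.

Let near_U q : U q -> \forall p \near q, U p.
Proof. by move=> Uq; apply: open_nbhs_nbhs. Qed.

Let near_H q : U q -> \forall p \near q, hecke_symmetry p (Rq p) /\ skew_invertible (Rq p).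
Proof. by move=> /near_U; apply: filterS => p Up; split; [exact: Rq_hecke|exact: Rq_skew]. Qed.

Lemma rank_generic k q : U q -> generic q ->
  \rank (hrel_mx (Rq q) k) = \rank (hrel_mx (Rq 1) k).
Proof.
move=> Uq gq.
apply: (@const_good R K hK k U (fun q => \rank (hrel_mx (Rq q) k))) => //.
- by move=> /neq0; rewrite eqxx.
- by move=> p Up gp; apply: near_rank => //; [exact: cts|exact: near_H].
by apply: good_generic => //; apply: neq0.
Qed.

Lemma rank_mrea_le m hbar q : U q -> generic q ->
  (\rank (rel_mx (Rq q) m hbar) <= \rank (rel_mx (Rq q) m 0))%N.
Proof.
move=> Uq gq.
have shift p : U p -> p - p^-1 != 0 ->
    (\rank (rel_mx (Rq p) m hbar) <= \rank (rel_mx (Rq p) m 0))%N.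
  move=> Up p0.
  have E : hbar + - hbar / (p - p^-1) * (p - p^-1) = 0 by rewrite divfK // subrr.
  by rewrite -[in leqRHS]E; exact: (rank_shift (rkernel_hecke (Rq_hecke Up))).
have sq (p : K) : p != 0 -> p ^+ 2 != 1 -> p - p^-1 != 0.
  move=> p0; apply: contra; rewrite subr_eq0 => /eqP E.
  by apply/eqP; rewrite expr2; exact: etrans (congr1 ( *%R p) E) (mulfV p0).
have [q1|/(sq _ (neq0 Uq))] := eqVneq (q ^+ 2) 1; last exact: shift.
(* The shift fails only for q^2 = 1, and -1 is excluded by genericity. *)
have -> : q = 1 by case: gq => // /(_ 2%N isT); rewrite unity_rootE q1 eqxx.
have H1 := nbhs_dnbhs (rank_lsc (@cts_rel_mx K N 1 Rq (cts U1) m hbar)).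
have H2 : \forall p \near (1 : K)^', forall k, k \in iota 0 m.+1 ->
    \rank (rel_mx (Rq p) m 0 *m sel K N k m) = \rank (rel_mx (Rq 1) m 0 *m sel K N k m).
  apply: near_all => k; rewrite mem_iota add0n ltnS => km.
  exact: (nbhs_dnbhs (near_rank (cts U1) (near_H U1) km (good1 K k))).
have H3 := near_expr_neq1 (isT : (0 < 2)%N) (neq0 U1).
have H4 := nbhs_dnbhs (near_U U1).
(* A nearby p with p^2 != 1 mediates: rank at (1, hbar) <= rank at (p, hbar) <= rank at (p, 0) =
   rank at (1, 0), by semicontinuity, the shift at p, and constancy in each degree. *)
have [p [[[r1 r2] p2] Up]] := filter_ex (filterI (filterI (filterI H1 H2) H3) H4).
apply: (leq_trans r1); apply: (leq_trans (shift p Up (sq _ (neq0 Up) p2))).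
apply: eq_leq; apply: (etrans (rank_split (Rq p) m)); apply: (etrans _ (esym (rank_split (Rq 1) m))).
by apply: eq_bigr => k _; apply: (r2 k); rewrite mem_iota add0n ltn_ord.
Qed.

Lemma family_same_dim k q : U q -> generic q -> same_dim (rea_comp (Rq q) k) (rea_comp (Rq 1) k).
Proof.
move=> Uq gq; exists (#|{: k.-tuple ('I_N * 'I_N)}| - \rank (hrel_mx (Rq q) k))%N.
  exact: rea_comp_dim.
by rewrite rank_generic //; exact: rea_comp_dim.
Qed.

Lemma family_graded_iso q hbar : U q -> generic q ->
  graded_iso (gr_comp (mrea_fil (Rq q) hbar)) (rea_comp (Rq q)).
Proof.
move=> Uq gq; apply: gr_rea_iso; apply: pbw_of_rank => m.
exact: rank_mrea_le.
Qed.

End Family.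

Theorem proposition20 (R : realType) (K : numFieldType)
    (hK : real_or_complex R K) (N : nat) (R0 : 'M[K]_(N * N))
    (U : set K) (Rq : K -> 'M[K]_(N * N))
    (R0_hecke : hecke_symmetry 1 R0)
    (R0_skew : skew_invertible R0)
    (R0_invol : R0 *m R0 = 1%:M)
    (U_open : open U) (U_connected : connected U) (U1 : U 1)
    (Rq_hecke : forall q : K, U q -> hecke_symmetry q (Rq q))
    (Rq_skew : forall q : K, U q -> skew_invertible (Rq q))
    (Rq_analytic : analytic_on U Rq)
    (Rq_1 : Rq 1 = R0)
    (q : K) (Uq : U q) (q_generic : generic q) :
  (forall k : nat, same_dim (rea_comp (Rq q) k) (rea_comp R0 k)) /\
  (forall hbar : K,
     graded_iso (gr_comp (mrea_fil (Rq q) hbar)) (rea_comp (Rq q))).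
Proof.
split=> [k|hbar]; last exact: (family_graded_iso U_open U1).
by rewrite -Rq_1; apply: (family_same_dim hK U_open).
Qed.
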